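(* Let $1<p,q<\infty$ with $\frac1p+\frac1q<1$ and $p>2$. The Hilbert operator $\mathcal H:AT^q_p\to AT^q_p$ is bounded but not compact.
   Context: $\mathbb D$ is the open unit disc of $\mathbb C$, $\mathbb T$ the unit circle, $dA$ the normalized area Lebesgue measure on $\mathbb D$, $|d\xi|$ arc length on $\mathbb T$. For $\xi\in\mathbb T$ put $$\Gamma_{1/2}(\xi)=\{z\in\mathbb D:|z|<1/2\}\cup\bigcup_{|z|<1/2}[z,\xi),$$ where $[z,\xi)$ is the half-open line segment from $z$ to $\xi$. For $1<p,q<\infty$, $AT^q_p$ is the Banach space of analytic functions $f$ on $\mathbb D$ such that $$\|f\|_{AT^q_p}=\left\{\int_{\mathbb T}\left(\int_{\Gamma_{1/2}(\xi)}|f(z)|^p\,\frac{dA(z)}{1-|z|^2}\right)^{q/p}|d\xi|\right\}^{1/q}<\infty.$$ The Hilbert operator is, for $f(z)=\sum_{k\ge0}a_kz^k$ analytic in $\mathbb D$, $$\mathcal H(f)(z)=\sum_{n=0}^\infty\left(\sum_{k=0}^\infty\frac{a_k}{n+k+1}\right)z^n,\qquad z\in\mathbb D.$$ *)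

(* Defs.v *)
From mathcomp Require Import all_boot all_order all_algebra.
From mathcomp Require Import all_classical all_reals all_analysis.
From mathcomp Require Export complex.

Set Implicit Arguments.
Unset Strict Implicit.
Unset Printing Implicit Defensive.

Import Order.TTheory GRing.Theory Num.Theory.
Import numFieldNormedType.Exports.

Local Open Scope classical_set_scope.
Local Open Scope ring_scope.

(* The copy [R[i]^o] of the complex field [R[i]] is the one that carries the
   topology given by the modulus. *)
Notation Cplx R := ((R[i])^o).

Lemma pi_inv_ge0 (R : realType) : 0 <= (pi : R)^-1.
Proof. by rewrite invr_ge0 pi_ge0. Qed.

Section TentSpaces.
Context {R : realType}.
Implicit Types (f g : Cplx R -> Cplx R) (a : (Cplx R)^nat) (p q : R).

(* In [R[i]] the norm [`|z|] is itself an element of [R[i]]. *)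
Definition cabs (z : Cplx R) : R := complex.Re `|z|.

Definition disc : set (Cplx R) := [set z | cabs z < 1].

Definition circle_pt (theta : R) : Cplx R := Complex (cos theta) (sin theta).

Definition power_series_on_disc a f : Prop :=
  forall z, disc z -> series (fun k => a k * z ^+ k) @ \oo --> f z.

(* Functions on the disc are represented by functions on the whole plane whose
   values outside the disc are irrelevant. *)
Definition analytic_on_disc f : Prop := exists a, power_series_on_disc a f.

(* The coefficients a_k of f; they are unique when f is analytic, and 0 by
   convention otherwise. *)
Definition taylor f : (Cplx R)^nat :=
  xget (fun=> 0) [set a | power_series_on_disc a f].

Definition Gamma_half (xi : Cplx R) : set (Cplx R) :=
  [set z | disc z /\ cabs z < 2^-1] `|`
  [set w | exists z : Cplx R, exists t : R,
     [/\ cabs z < 2^-1, 0 <= t, t < 1 &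
         w = (1 - t)%:C%C * z + t%:C%C * xi]].

Definition dA :
    {measure set (measurableTypeR R * measurableTypeR R) -> \bar R} :=
  mscale (NngNum (pi_inv_ge0 R))
    (lebesgue_measure \x lebesgue_measure)%E.

Definition cone_integral p f (xi : Cplx R) : \bar R :=
  (\int[dA]_(xy in [set xy | Gamma_half xi (Complex xy.1 xy.2)])
     ((cabs (f (Complex xy.1 xy.2)) `^ p
        / (1 - cabs (Complex xy.1 xy.2) ^+ 2))%:E))%E.

Definition AT_norm p q f : \bar R :=
  ((\int[lebesgue_measure]_(theta in `[0%R, (2 * pi)%R])
     (cone_integral p f (circle_pt theta) `^ (q / p))) `^ (q^-1))%E.

Definition AT p q : set (Cplx R -> Cplx R) :=
  [set f | analytic_on_disc f /\ (AT_norm p q f < +oo)%E].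

Definition hilbert_coef_series a (n : nat) : (Cplx R)^nat :=
  series (fun k => a k / (n + k + 1)%:R).

Definition hilbert_coef a (n : nat) : Cplx R :=
  limn (hilbert_coef_series a n).

Definition hilbert_series f (z : Cplx R) : (Cplx R)^nat :=
  series (fun n => hilbert_coef (taylor f) n * z ^+ n).

Definition hilbert f (z : Cplx R) : Cplx R := limn (hilbert_series f z).

(* [limn] is total, so the convergence of the series defining [hilbert f]
   has to be asserted separately. *)
Definition hilbert_well_defined f : Prop :=
  (forall n, cvgn (hilbert_coef_series (taylor f) n)) /\
  (forall z, disc z -> cvgn (hilbert_series f z)).

Definition AT_bounded p q (T : (Cplx R -> Cplx R) -> Cplx R -> Cplx R) : Prop :=
  exists M : R, forall f, AT p q f ->
    (AT_norm p q (T f) <= M%:E * AT_norm p q f)%E.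

(* Compactness in its sequential form, equivalent to relative compactness of
   the image of the unit ball since the target is a Banach space. *)
Definition AT_compact p q (T : (Cplx R -> Cplx R) -> Cplx R -> Cplx R) : Prop :=
  forall u : nat -> Cplx R -> Cplx R,
    (forall n, AT p q (u n)) ->
    (exists M : R, forall n, (AT_norm p q (u n) <= M%:E)%E) ->
    exists (phi : nat -> nat) (g : Cplx R -> Cplx R),
      [/\ increasing_seq phi, AT p q g &
          (fun k => AT_norm p q (fun z => T (u (phi k)) z - g z)) @ \oo
            --> 0%E].

End TentSpaces.

(* Main.v *)
(* Put s = 1/p + 1/q < 1.  The mean value property, averaged over a disc of
   radius comparable to 1 - |z|, bounds |f(z)|^p (1 - |z|) by the cone integrals
   at all points of an arc of length comparable to 1 - |z|; hence |f(z)| is at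
   most a constant times ||f|| (1 - |z|)^(-s), and |f|^q has radial and circular
   means controlled by ||f||.  For p > 2 the resulting L^2 means on circles grow
   slower than (1 - r)^(-1), so Bessel's inequality gives
   sum |a_k| / (k + 1) < oo, and H f is well defined with
     |H f(z)| <= 6 int_0^1 |f(t)| / ((1 - t) + |1 - z|) dt.
   A Schur test with the weight (1 - t)^al, q/p < al < min (q/p + 1, q - 1),
   followed by an integration over the cones, bounds H f in AT.

   For the failure of compactness take u_d(z) = d^(1-s) / (1 - (1 - d) z), which
   is bounded in AT as d -> 0.  H u_d tends to 0 pointwise on (0, 1), so a norm
   limit g of a subsequence vanishes there by the growth estimate; but
   Re H u_d(1 - d) >= d^(-s) / 8, and the growth estimate at 1 - d keeps the norm
   of H u_d - g away from 0. *)

Require Import Defs.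
From mathcomp Require Import all_boot all_order all_algebra.
From mathcomp Require Import all_classical all_reals all_analysis.
From mathcomp Require Import measurable_realfun.
From mathcomp Require Import ring lra.

Set Implicit Arguments.
Unset Strict Implicit.
Unset Printing Implicit Defensive.

Import Order.TTheory GRing.Theory Num.Theory.
Import numFieldNormedType.Exports.

Local Open Scope classical_set_scope.
Local Open Scope ring_scope.

(** * The modulus and unimodular numbers *)

Section ComplexBasics.
Context {R : realType}.
Implicit Types (z w : Cplx R) (x y : R).

(** Neither the cones nor the cone integral as a function of the angle is shown to be measurable.
    Norms are therefore only compared: from below with step functions on arcs or an explicit radial
    integral, from above with a measurable majorant. Means over circles are finite means over N-th
    roots of unity, exact on polynomials of degree below N. Uniform convergence of the Taylor
    polynomials on smaller discs carries them over to [f], which gives both the sub-mean value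
    property and Bessel's inequality. All explicit estimates rest on one model integral, of rho^(-g)
    (e + rho)^(-b) over a space where the set rho < r has measure at most A r^n: n = 1 on the radius
    and on the circle, n = 2 in the cones. The condition s < 1 says q/p + 1 < q, which is what
    leaves room for the exponent [al] of the Schur weight; p > 2 enters only through the
    well-definedness of H f, in the growth of the L^2 means when q >= 2. *)

Lemma normC_cabs z : `|z| = (cabs z)%:C%C.
Proof. by rewrite /cabs normc_def. Qed.

Lemma cabsE z : cabs z = Num.sqrt (complex.Re z ^+ 2 + complex.Im z ^+ 2).
Proof. by rewrite /cabs normc_def. Qed.

Lemma cabs_ge0 z : 0 <= cabs z.
Proof. by rewrite cabsE sqrtr_ge0. Qed.

Lemma cabs_normc z : cabs z = Normc.normc z.
Proof. by rewrite cabsE; case: z. Qed.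

Lemma cabsM z w : cabs (z * w) = cabs z * cabs w.
Proof. by rewrite !cabs_normc Normc.normcM. Qed.

Lemma cabsN z : cabs (- z) = cabs z.
Proof. by rewrite !cabs_normc normcN. Qed.

Lemma cabsD z w : cabs (z + w) <= cabs z + cabs w.
Proof. by rewrite !cabs_normc le_normcD. Qed.

Lemma cabsB z w : cabs (z - w) <= cabs z + cabs w.
Proof. by rewrite -(cabsN w) cabsD. Qed.

Lemma cabs_distC z w : cabs (z - w) = cabs (w - z).
Proof. by rewrite -cabsN opprB. Qed.

Lemma cabs0 : cabs (0 : Cplx R) = 0.
Proof. by rewrite cabs_normc Normc.normc0. Qed.

Lemma cabs1 : cabs (1 : Cplx R) = 1.
Proof. by rewrite cabs_normc Normc.normc1. Qed.

Lemma cabsX z n : cabs (z ^+ n) = cabs z ^+ n.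
Proof. by elim: n => [|n IH]; rewrite ?expr0 ?cabs1// !exprS cabsM IH. Qed.

Lemma cabsV z : cabs z^-1 = (cabs z)^-1.
Proof. by rewrite !cabs_normc Normc.normcV. Qed.

Lemma cabs_real x : cabs (x%:C%C : Cplx R) = `|x|.
Proof. by rewrite cabsE /= expr0n addr0 sqrtr_sqr. Qed.

Lemma cabs_nat n : cabs (n%:R : Cplx R) = n%:R.
Proof.
by rewrite (_ : n%:R = (n%:R : R)%:C%C) ?cabs_real ?normr_nat// rmorph_nat.
Qed.

Lemma cabs_sqr z : cabs z ^+ 2 = complex.Re z ^+ 2 + complex.Im z ^+ 2.
Proof. by rewrite cabsE sqr_sqrtr// addr_ge0// sqr_ge0. Qed.

Lemma cabs_ge_Re z : `|complex.Re z| <= cabs z.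
Proof. by rewrite cabsE -sqrtr_sqr ler_wsqrtr// lerDl sqr_ge0. Qed.

Lemma cabs_ge_Im z : `|complex.Im z| <= cabs z.
Proof. by rewrite cabsE -sqrtr_sqr ler_wsqrtr// lerDr sqr_ge0. Qed.

Lemma cabs_le_ReIm z : cabs z <= `|complex.Re z| + `|complex.Im z|.
Proof.
rewrite cabsE -(@ler_pXn2r _ 2)// ?nnegrE ?sqrtr_ge0 ?addr_ge0// sqr_sqrtr ?addr_ge0 ?sqr_ge0//.
rewrite -[complex.Re z ^+ 2]real_normK ?num_real//.
rewrite -[complex.Im z ^+ 2]real_normK ?num_real// sqrrD.
by rewrite -addrA [X in _ <= _ + X]addrC addrA lerDl mulrn_wge0// mulr_ge0.
Qed.

Lemma cabs_dist z w : `|cabs z - cabs w| <= cabs (z - w).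
Proof.
rewrite ler_norml; have := cabsD (z - w) w; have := cabsD (w - z) z.
rewrite !subrK (cabs_distC w); lra.
Qed.

Lemma cabs_sum (I : Type) (r : seq I) (P : pred I) (F : I -> Cplx R) :
  cabs (\sum_(i <- r | P i) F i) <= \sum_(i <- r | P i) cabs (F i).
Proof.
elim/big_rec2 : _ => [|i x y _ h]; first by rewrite cabs0.
by rewrite (le_trans (cabsD _ _))// lerD2l.
Qed.

Lemma ReD z w : complex.Re (z + w) = complex.Re z + complex.Re w.
Proof. by case: z w => [? ?] [? ?]. Qed.

Lemma ImD z w : complex.Im (z + w) = complex.Im z + complex.Im w.
Proof. by case: z w => [? ?] [? ?]. Qed.

Lemma ReN z : complex.Re (- z) = - complex.Re z.
Proof. by case: z => [? ?]. Qed.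

Lemma ImN z : complex.Im (- z) = - complex.Im z.
Proof. by case: z => [? ?]. Qed.

Lemma ReM z w : complex.Re (z * w) =
  complex.Re z * complex.Re w - complex.Im z * complex.Im w.
Proof. by case: z w => [? ?] [? ?]. Qed.

Lemma ImM z w : complex.Im (z * w) =
  complex.Re z * complex.Im w + complex.Im z * complex.Re w.
Proof. by case: z w => [? ?] [? ?]. Qed.

Lemma Re_sum (I : Type) (r : seq I) (P : pred I) (F : I -> Cplx R) :
  complex.Re (\sum_(i <- r | P i) F i) = \sum_(i <- r | P i) complex.Re (F i).
Proof. by elim/big_rec2 : _ => // i x y _ <-; rewrite ReD. Qed.

Lemma Im_sum (I : Type) (r : seq I) (P : pred I) (F : I -> Cplx R) :
  complex.Im (\sum_(i <- r | P i) F i) = \sum_(i <- r | P i) complex.Im (F i).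
Proof. by elim/big_rec2 : _ => // i x y _ <-; rewrite ImD. Qed.

Lemma cvg_cabsP (u : nat -> Cplx R) (l : Cplx R) :
  u @ \oo --> l <-> (fun n => cabs (l - u n)) @ \oo --> (0 : R).
Proof.
split.
  move=> /cvgrPdist_lt ul; apply/cvgrPdist_lt => e e0.
  have /= := ul e%:C%C; rewrite ltcR => /(_ e0); apply: filterS => n.
  by rewrite sub0r normrN [X in _ -> X < _]ger0_norm ?cabs_ge0// normC_cabs ltcR.
move=> /cvgrPdist_lt ul; apply/cvgrPdist_lt => e e0.
(* A positive element of [R[i]] is real, so the radii of the complex topology are the positive
   reals. *)
have [r re] : exists r, e = r%:C%C.
  by move/complex_realP: (ger0_real (ltW e0)).
subst e; move: e0; rewrite ltcR => /ul; apply: filterS => n.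
by rewrite sub0r normrN ger0_norm ?cabs_ge0// normC_cabs ltcR.
Qed.

Lemma cvg_ReIm (u : nat -> Cplx R) (a b : R) :
  (fun n => complex.Re (u n)) @ \oo --> a ->
  (fun n => complex.Im (u n)) @ \oo --> b ->
  u @ \oo --> (Complex a b : Cplx R).
Proof.
move=> ua ub; apply/cvg_cabsP.
apply: (@squeeze_cvgr _ _ _ _ (cst 0)
  (fun n => `|a - complex.Re (u n)| + `|b - complex.Im (u n)|)).
- apply: nearW => n; rewrite cabs_ge0/= (le_trans (cabs_le_ReIm _))//.
  by rewrite ReD ImD ReN ImN.
- exact: cvg_cst.
- rewrite -[X in _ --> X](addr0 0); apply: cvgD.
    rewrite -(normr0 R) -(subrr a); apply: cvg_norm; apply: cvgB => //.
    exact: cvg_cst.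
  rewrite -(normr0 R) -(subrr b); apply: cvg_norm; apply: cvgB => //.
  exact: cvg_cst.
Qed.

Lemma cvg_Re (u : nat -> Cplx R) (l : Cplx R) :
  u @ \oo --> l -> (fun n => complex.Re (u n)) @ \oo --> complex.Re l.
Proof.
move=> /cvg_cabsP/cvgrPdist_lt ul; apply/cvgrPdist_lt => e /ul.
apply: filterS => n; rewrite sub0r normrN ger0_norm ?cabs_ge0//; apply: le_lt_trans.
by rewrite -ReN -ReD cabs_ge_Re.
Qed.

Lemma cvg_Im (u : nat -> Cplx R) (l : Cplx R) :
  u @ \oo --> l -> (fun n => complex.Im (u n)) @ \oo --> complex.Im l.
Proof.
move=> /cvg_cabsP/cvgrPdist_lt ul; apply/cvgrPdist_lt => e /ul.
apply: filterS => n; rewrite sub0r normrN ger0_norm ?cabs_ge0//; apply: le_lt_trans.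
by rewrite -ImN -ImD cabs_ge_Im.
Qed.

Lemma cvg_cabs (u : nat -> Cplx R) (l : Cplx R) :
  u @ \oo --> l -> (fun n => cabs (u n)) @ \oo --> cabs l.
Proof.
move=> /cvg_cabsP/cvgrPdist_lt ul; apply/cvgrPdist_lt => e /ul.
apply: filterS => n; rewrite sub0r normrN ger0_norm ?cabs_ge0//; apply: le_lt_trans.
exact: cabs_dist.
Qed.

Lemma cabs_summable_cvg (u : nat -> Cplx R) :
  cvgn (series (fun k => cabs (u k))) -> cvgn (series u).
Proof.
move=> cu.
have aux (v : nat -> R) : (forall k, `|v k| <= cabs (u k)) -> cvgn (series v).
  move=> vu; apply: normed_cvg.
  by apply: series_le_cvg cu => [k|k|k] //=; exact: cabs_ge0.
apply/cvg_ex; exists (Complex (limn (series (fun k => complex.Re (u k))))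
   (limn (series (fun k => complex.Im (u k)))) : Cplx R).
apply: cvg_ReIm.
  rewrite (_ : (fun n => _) = series (fun k => complex.Re (u k))).
    by apply: aux => k; exact: cabs_ge_Re.
  by apply/funext => n; rewrite /series /= Re_sum.
rewrite (_ : (fun n => _) = series (fun k => complex.Im (u k))).
  by apply: aux => k; exact: cabs_ge_Im.
by apply/funext => n; rewrite /series /= Im_sum.
Qed.

Lemma nonneg_bounded_series_cvg (v : nat -> R) (M : R) : (forall k, 0 <= v k) ->
  (forall n, series v n <= M) -> cvgn (series v).
Proof.
move=> v0 vM; apply: nondecreasing_is_cvgn.
  by apply/nondecreasing_seqP => n; rewrite /series/= big_nat_recr//= lerDl.
by exists M => _ [n _ <-].
Qed.

Lemma circle_ptD x y : circle_pt (x + y) = circle_pt x * circle_pt y :> Cplx R.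
Proof.
rewrite /circle_pt cosD sinD; apply/eqP; rewrite eq_complex/=.
by rewrite eqxx/=; apply/eqP; ring.
Qed.

Lemma circle_pt0 : circle_pt 0 = 1 :> Cplx R.
Proof. by rewrite /circle_pt cos0 sin0. Qed.

Lemma circle_ptX x n : circle_pt x ^+ n = circle_pt (x *+ n) :> Cplx R.
Proof.
elim: n => [|n IH]; first by rewrite expr0 mulr0n circle_pt0.
by rewrite exprS IH -circle_ptD mulrS.
Qed.

Lemma cabs_circle_pt x : cabs (circle_pt x) = 1.
Proof. by rewrite cabsE /= cos2Dsin2 sqrtr1. Qed.

Lemma cabs_circle_ptB x y :
  cabs (circle_pt x - circle_pt y) = 2 * `|sin ((x - y) / 2)|.
Proof.
apply/eqP; rewrite -(@eqrXn2 _ 2)// ?cabs_ge0 ?mulr_ge0//.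
rewrite cabs_sqr exprMn real_normK ?num_real// ReD ReN ImD ImN /=.
have e : cos (x - y) = 1 - 2 * sin ((x - y) / 2) ^+ 2.
  rewrite {1}(_ : x - y = ((x - y) / 2) *+ 2); last by rewrite -mulr_natr divfK.
  rewrite cos_mulr2n cos2sin2; move: (sin _) => t.
  by ring.
apply/eqP; have := cosB x y; rewrite e.
have := cos2Dsin2 x; have := cos2Dsin2 y.
set cx := cos x; set sx := sin x; set cy := cos y; set sy := sin y.
set t := sin _ => h1 h2 h3.
transitivity ((cx ^+ 2 + sx ^+ 2) + (cy ^+ 2 + sy ^+ 2) - 2 * (cx * cy + sx * sy)).
  by ring.
by rewrite h1 h2 -h3; ring.
Qed.

Lemma abs_sin_le x : `|sin x| <= `|x|.
Proof.
wlog x0 : x / 0 <= x.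
  move=> h; have [/h//|/ltW xn] := leP 0 x.
  by rewrite -normrN -sinN -(normrN x) h// oppr_ge0.
have [->|xn0] := eqVneq x 0; first by rewrite sin0.
have x1 : 0 < x by rewrite lt_neqAle eq_sym xn0.
have [|c _] := @MVT _ sin cos 0 x x1 (fun y _ => is_derive_sin y).
  exact/continuous_subspaceT/continuous_sin.
rewrite sin0 !subr0 => ->; rewrite normrM ler_piMl//.
by rewrite ler_norml cos_geN1 cos_le1.
Qed.

Lemma cabs_circle_ptB_le x y : cabs (circle_pt x - circle_pt y) <= `|x - y|.
Proof.
rewrite cabs_circle_ptB; have := abs_sin_le ((x - y) / 2).
by rewrite normrM [`|2^-1|]ger0_norm//; lra.
Qed.

End ComplexBasics.

(** * Lebesgue integrals under affine maps and rotations *)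

Section IntegralMonotone.
Local Open Scope ereal_scope.
Context d (T : measurableType d) (R : realType) (mu : {measure set T -> \bar R}).

(** The integral of a nonnegative function is a supremum over the simple functions below it, and
    this set grows with the function. This is what makes integrals over the cones and over the angle
    comparable. *)
Lemma ge0_le_integral_nonmeas (D : set T) (f g : T -> \bar R) :
  (forall x, D x -> 0 <= f x) -> (forall x, D x -> f x <= g x) ->
  \int[mu]_(x in D) f x <= \int[mu]_(x in D) g x.
Proof.
move=> f0 fg; rewrite integral_mkcond [leRHS]integral_mkcond.
have f0' x : 0 <= (f \_ D) x by rewrite patchE; case: ifPn => // /set_mem /f0.
have fg' x : (f \_ D) x <= (g \_ D) x.
  by rewrite !patchE; case: ifPn => // /set_mem /fg.
rewrite !ge0_integralTE//; last by move=> x; exact: le_trans (fg' x).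
apply: ub_ereal_sup => _ [h hf <-]; apply: ereal_sup_ubound; exists h => //.
by move=> x; exact: le_trans (fg' x).
Qed.

Import HBNNSimple.

(** A simple function below [f] is measurable and almost everywhere below [g], so ordinary
    monotonicity applies to it in place of [f]. It serves to discard the endpoints of the angular
    interval. *)
Lemma ae_ge0_le_integral_majorant (f g : T -> \bar R) :
  (forall x, 0 <= f x) -> (forall x, 0 <= g x) -> measurable_fun setT g ->
  {ae mu, forall x, f x <= g x} ->
  \int[mu]_x f x <= \int[mu]_x g x.
Proof.
move=> f0 g0 mg fg; rewrite ge0_integralTE//.
apply: ub_ereal_sup => _ [h hf <-]; rewrite -integralT_nnsfun.
apply: ae_ge0_le_integral => //.
- by move=> x _; rewrite lee_fin.
- exact/measurable_EFinP/measurable_funPT.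
- by apply: filterS fg => x /(le_trans (hf x)).
Qed.

End IntegralMonotone.

Section AffineChange.
Context {R : realType}.
Let leb : {measure set (measurableTypeR R) -> \bar R} := lebesgue_measure.

Lemma measurable_affine (k c : R) : measurable_fun [set: measurableTypeR R]
  (fun x : measurableTypeR R => k * x + c : measurableTypeR R).
Proof.
by apply: measurable_funD => //; apply: measurable_funM.
Qed.

(** The pushforward of Lebesgue measure under the affine map, scaled by [|k|], gives every interval
    []a, b]] its length, which determines it. A negative [k] exchanges the open and the closed end,
    hence the two computations. *)
Lemma lebesgue_measure_affine (k c : R) (A : set (measurableTypeR R)) :
  k != 0 -> measurable A ->
  (`|k|%:E * lebesgue_measure [set x : R | A (k * x + c)%R])%E = lebesgue_measure A.
Proof.
move=> k0 mA.
pose nk : {nonneg R} := NngNum (normr_ge0 k).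
pose mf := (fun x : measurableTypeR R => k * x + c : measurableTypeR R).
pose nu := mscale nk (pushforward leb mf).
have := @lebesgue_measure_unique _ (nu (measurable_affine k c)) _ A mA; rewrite /nu /mscale /pushforward /=.
move=> -> // X [[a b] /= _ <-]; rewrite /mscale/=.
rewrite /pushforward.
have [ab|ba] := leP a b; last first.
  by rewrite set_itv_ge ?bnd_simp -?leNgt ?ltW// preimage_set0 !measure0 mule0.
rewrite lebesgue_measure_itv/= lte_fin.
have [k1|k1|k1] := ltgtP 0 k; last by rewrite -k1 eqxx in k0.
  rewrite (_ : _ @^-1` _ = `](a - c) / k, (b - c) / k]%classic).
    rewrite lebesgue_measure_itv/= lte_fin ltr_pM2r ?invr_gt0// ltrD2r.
    case: ifP => ab'; last by rewrite mule0.
    rewrite -EFinM gtr0_norm// -!EFinD; congr EFin.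
    by field; rewrite gt_eqF.
  apply/seteqP; split => x /=; rewrite /mf !in_itv/= ltr_pdivrMr//
    ler_pdivlMr// (mulrC x) => /andP[h1 h2]; apply/andP; split; lra.
rewrite (_ : _ @^-1` _ = `[(b - c) / k, (a - c) / k[%classic).
  rewrite lebesgue_measure_itv/= lte_fin ltr_nM2r ?invr_lt0// ltrD2r.
  case: ifP => ab'; last by rewrite mule0.
  rewrite -EFinM ltr0_norm// -!EFinD; congr EFin.
  by field; rewrite lt_eqF.
apply/seteqP; split => x /=; rewrite /mf !in_itv/= ler_ndivrMr//
  ltr_ndivlMr// (mulrC x) => /andP[h1 h2]; apply/andP; split; lra.
Qed.

Lemma ge0_integral_affine (k c : R) (D : set (measurableTypeR R)) (f : R -> \bar R) :
  k != 0 -> measurable D -> measurable_fun D (f : measurableTypeR R -> _) ->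
  (forall x, D x -> 0 <= f x)%E ->
  (`|k|%:E * \int[lebesgue_measure]_(x in [set x : R | D (k * x + c)%R]) f (k * x + c)%R
   = \int[lebesgue_measure]_(x in D) f x)%E.
Proof.
move=> k0 mD mf f0.
pose nk : {nonneg R} := NngNum (normr_ge0 k).
pose mg := (fun x : measurableTypeR R => k * x + c : measurableTypeR R).
have -> : (\int[lebesgue_measure]_(x in [set x : R | D (k * x + c)%R]) f (k * x + c)%R =
  \int[pushforward leb mg]_(x in D) f x)%E.
  rewrite ge0_integral_pushforward//.
    exact: measurable_affine.
  by move=> y /set_mem /f0.
have -> : (`|k|%:E = nk%:num%:E)%E by [].
rewrite -(ge0_integral_mscale _ mD)//; first exact: measurable_affine.
move=> mmg.
apply: eq_measure_integral => A mA _.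
exact: (lebesgue_measure_affine c k0 mA).
Qed.

End AffineChange.

Section Rotation.
Context {R : realType}.
Notation leb := (@lebesgue_measure R).
Notation RR := (measurableTypeR R * measurableTypeR R)%type.
Local Open Scope ereal_scope.

Lemma integral_translation (c : R) (f : R -> \bar R) :
  measurable_fun [set: measurableTypeR R] (f : measurableTypeR R -> _) ->
  (forall x, 0 <= f x) ->
  \int[leb]_x f (x + c)%R = \int[leb]_x f x.
Proof.
move=> mf f0.
rewrite -(@ge0_integral_affine _ 1%R c setT f)// ?oner_eq0// normr1 mul1e.
by under [in RHS]eq_integral do rewrite mul1r.
Qed.

Lemma measurable_fun_pairR (g h : RR -> R) :
  measurable_fun [set: RR] g -> measurable_fun [set: RR] h ->
  measurable_fun [set: RR] (fun w => (g w, h w) : RR).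
Proof. by move=> mg mh; exact/measurable_fun_pairP. Qed.

Lemma measurable_fst_RR : measurable_fun [set: RR] (fun w : RR => w.1 : R).
Proof. exact: measurable_fst. Qed.

Lemma measurable_snd_RR : measurable_fun [set: RR] (fun w : RR => w.2 : R).
Proof. exact: measurable_snd. Qed.

(** For a fixed second coordinate a shear is a translation, so Tonelli reduces the claim to the
    line. *)
Lemma integral_shear_fst (a : R) (f : RR -> \bar R) :
  measurable_fun [set: RR] f -> (forall x, 0 <= f x) ->
  \int[leb \x leb]_w f ((w.1 + a * w.2)%R, w.2) = \int[leb \x leb]_w f w.
Proof.
move=> mf f0.
rewrite (@fubini_tonelli2 _ _ _ _ _ _ _ f)//.
rewrite (@fubini_tonelli2 _ _ _ _ _ _ _ (fun w : RR => f ((w.1 + a * w.2)%R, w.2)))//.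
  apply: eq_integral => y _; rewrite /fubini_G/=.
  rewrite (@integral_translation (a * y)%R (fun x => f (x, y)))//.
  exact: measurableT_comp mf (measurable_pair2 _).
apply: (measurableT_comp mf); apply: measurable_fun_pairR.
  apply: measurable_funD; first exact: measurable_fst_RR.
  by apply: measurable_funM => //; exact: measurable_snd_RR.
exact: measurable_snd_RR.
Qed.

Lemma integral_shear_snd (a : R) (f : RR -> \bar R) :
  measurable_fun [set: RR] f -> (forall x, 0 <= f x) ->
  \int[leb \x leb]_w f (w.1, (w.2 + a * w.1)%R) = \int[leb \x leb]_w f w.
Proof.
move=> mf f0.
rewrite (@fubini_tonelli1 _ _ _ _ _ _ _ f)//.
rewrite (@fubini_tonelli1 _ _ _ _ _ _ _ (fun w : RR => f (w.1, (w.2 + a * w.1)%R)))//.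
  apply: eq_integral => y _; rewrite /fubini_F/=.
  rewrite (@integral_translation (a * y)%R (fun x => f (y, x)))//.
  exact: measurableT_comp mf (measurable_pair1 _).
apply: (measurableT_comp mf); apply: measurable_fun_pairR.
  exact: measurable_fst_RR.
apply: measurable_funD; first exact: measurable_snd_RR.
by apply: measurable_funM => //; exact: measurable_fst_RR.
Qed.

(* A rotation by an angle that is not an odd multiple of pi is a product of
   three shears, with parameters - tan (t / 2), sin t and - tan (t / 2). *)
Lemma integral_rotation (c s : R) (f : RR -> \bar R) :
  (c ^+ 2 + s ^+ 2 = 1)%R ->
  measurable_fun [set: RR] f -> (forall x, 0 <= f x) ->
  \int[leb \x leb]_w f ((c * w.1 - s * w.2)%R, (s * w.1 + c * w.2)%R) =
  \int[leb \x leb]_w f w.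
Proof.
move=> cs mf f0.
wlog c1 : c s cs f mf f0 / (c != -1)%R => [wlg|].
  have [c1|] := eqVneq c (-1)%R; last exact: wlg.
  have s0 : s = 0%R.
    by apply/eqP; rewrite -sqrf_eq0 -(addKr (c ^+ 2)%R (s ^+ 2)%R) cs c1; apply/eqP; ring.
  (* The remaining case is the half turn, the composite of two quarter turns, for which [c] is 0. *)
  have e w : (c * w.1 - s * w.2, s * w.1 + c * w.2)%R =
     ((0 * (0 * w.1 - 1 * w.2) - 1 * (1 * w.1 + 0 * w.2))%R,
      (1 * (0 * w.1 - 1 * w.2) + 0 * (1 * w.1 + 0 * w.2))%R) :> R * R.
    by rewrite c1 s0; congr pair; ring.
  under eq_integral do rewrite e.
  have o : (0 ^+ 2 + 1 ^+ 2 = 1 :> R)%R by ring.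
  have n : (0 != -1 :> R)%R by rewrite eq_sym oppr_eq0 oner_eq0.
  rewrite -[RHS](wlg 0%R 1%R)//.
  rewrite -[RHS](wlg 0%R 1%R o (fun w => f ((0 * w.1 - 1 * w.2)%R, (1 * w.1 + 0 * w.2)%R)))//.
  apply: (measurableT_comp mf); apply: measurable_fun_pairR.
    by apply: measurable_funB; apply: measurable_funM.
  by apply: measurable_funD; apply: measurable_funM.
have c10 : (1 + c != 0)%R by rewrite addrC addr_eq0.
pose a := (- s / (1 + c))%R.
have e w : (c * w.1 - s * w.2, s * w.1 + c * w.2)%R =
  ((w.1 + a * w.2 + a * (w.2 + s * (w.1 + a * w.2)))%R,
   (w.2 + s * (w.1 + a * w.2))%R) :> R * R.
  have h1 : (1 + a * s = c)%R.
    rewrite /a; apply: (mulIf c10); rewrite mulrDl mulrAC divfK// mul1r.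
    by rewrite -[X in (X + c + _ = _)%R]cs; ring.
  have h2 : (a + a * (1 + s * a) = - s)%R.
    by rewrite (mulrC s) h1 -{1}(mulr1 a) -mulrDr /a divfK.
  congr pair.
    transitivity ((1 + a * s) * w.1 + (a + a * (1 + s * a)) * w.2)%R; last by ring.
    by rewrite h1 h2; ring.
  transitivity (s * w.1 + (1 + a * s) * w.2)%R; last by ring.
  by rewrite h1; ring.
under eq_integral do rewrite e.
have mshear1 (b : R) (g : RR -> \bar R) : measurable_fun setT g ->
  measurable_fun setT (fun w : RR => g ((w.1 + b * w.2)%R, w.2)).
  move=> mg; apply: (measurableT_comp mg); apply: measurable_fun_pairR.
    apply: measurable_funD; first exact: measurable_fst_RR.
    by apply: measurable_funM => //; exact: measurable_snd_RR.
  exact: measurable_snd_RR.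
have mshear2 (b : R) (g : RR -> \bar R) : measurable_fun setT g ->
  measurable_fun setT (fun w : RR => g (w.1, (w.2 + b * w.1)%R)).
  move=> mg; apply: (measurableT_comp mg); apply: measurable_fun_pairR.
    exact: measurable_fst_RR.
  apply: measurable_funD; first exact: measurable_snd_RR.
  by apply: measurable_funM => //; exact: measurable_fst_RR.
rewrite -[RHS](integral_shear_fst a mf f0).
rewrite -[RHS](@integral_shear_snd s (fun w : RR => f ((w.1 + a * w.2)%R, w.2)))//; last first.
  exact: mshear1.
rewrite -[RHS](@integral_shear_fst a
  (fun w : RR => f ((w.1 + a * (w.2 + s * w.1))%R, (w.2 + s * w.1)%R)))//.
exact: (mshear2 s _ (mshear1 a _ mf)).
Qed.

End Rotation.

(** * Integrals of powers of a distance *)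

Section SingularPower.
Context {R : realType}.

Lemma geometric_nneseries_le (a x : R) : 0 <= a -> 0 <= x -> x < 1 ->
  (\sum_(0 <= k <oo) (a * x ^+ k)%:E <= (a / (1 - x))%:E)%E.
Proof.
move=> a0 x0 x1; apply: lime_le.
  by apply: is_cvg_nneseries => n _ _; rewrite lee_fin mulr_ge0 ?exprn_ge0.
apply: nearW => n; rewrite sumEFin lee_fin.
have -> : \sum_(0 <= i < n) a * x ^+ i = a * (1 - x ^+ n) / (1 - x).
  have x10 : 1 - x != 0 by rewrite subr_eq0 gt_eqF.
  elim: n => [|n IH]; first by rewrite big_geq// expr0 subrr mulr0 mul0r.
  by rewrite big_nat_recr//= IH exprS; field.
rewrite ler_pM2r ?invr_gt0 ?subr_gt0// ler_piMr//.
by rewrite gerBl exprn_ge0.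
Qed.

Lemma dyadic_scale (r : R) : 0 < r ->
  (exists k : nat, 2 ^- k.+1 <= r < 2 ^- k) \/
  (exists k : nat, 2 ^+ k <= r < 2 ^+ k.+1).
Proof.
have key (s : R) : 1 <= s -> exists k : nat, 2 ^+ k <= s < 2 ^+ k.+1.
  move=> s1.
  have ex : exists n : nat, s < 2 ^+ n.
    exists (Num.truncn s).+1; apply: lt_le_trans (truncnS_gt s) _.
    by rewrite -natrX ler_nat ltnW// ltn_expl.
  case: (ex_minnP ex) => -[|m]; first by rewrite expr0 ltNge s1.
  move=> sm hm; exists m; rewrite sm andbT leNgt; apply/negP => /hm.
  by rewrite ltnn.
move=> r0; have [r1|r1] := leP 1 r; [right; exact: key|left].
have [|k /andP[k1 k2]] := key r^-1; first by rewrite invr_ge1 ?unitfE ?gt_eqF// ltW.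
(* Inversion exchanges the open and closed ends of a shell, so when [r] is exactly 2^(-k) its shell
   has index k - 1. *)
have [e|ne] := eqVneq (2 ^+ k) r^-1.
  case: k e {k1 k2} => [e|k e].
    by move: r1; rewrite -(invrK r) -e expr0 invr1 ltxx.
  exists k; rewrite -(invrK r) -e lexx/= ltf_pV2 ?posrE ?exprn_gt0//.
  by rewrite exprS ltr_pMl ?exprn_gt0// ltr1n.
exists k; apply/andP; split.
  by rewrite -(invrK r) lef_pV2 ?posrE ?exprn_gt0 ?invr_gt0// ltW.
rewrite -(invrK r) ltf_pV2 ?posrE ?exprn_gt0 ?invr_gt0//.
by rewrite lt_neqAle ne.
Qed.

Lemma powR_2X (x : R) (k : nat) : (2 ^+ k) `^ x = (2 `^ x) ^+ k.
Proof. by rewrite -powR_mulrn// -powRrM mulrC powRrM powR_mulrn ?powR_ge0. Qed.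

Lemma powR_2Xn (x : R) (k : nat) : (2 ^- k) `^ x = (2 `^ (- x)) ^+ k.
Proof.
have p0 : (2 ^+ k : R) `^ x != 0 by rewrite gt_eqF// powR_gt0 ?exprn_gt0.
rewrite -powR_2X powRN; apply: (mulIf p0); rewrite mulVf// -powRM ?exprn_ge0//.
by rewrite mulVf ?powR1// expf_neq0.
Qed.

Lemma gt0_powRD (x r s : R) : 0 < x -> x `^ (r + s) = x `^ r * x `^ s.
Proof. by move=> x0; rewrite powRD// (gt_eqF x0) implybT. Qed.

Lemma powR2_lt1 (x : R) : x < 0 -> 2 `^ x < 1.
Proof.
move=> x0; rewrite -(opprK x) powRN invf_lt1 ?powR_gt0//.
have := @gt0_ltr_powR R (- x); rewrite oppr_gt0 => /(_ x0 1 2).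
by rewrite powR1 => -> //; rewrite ?nnegrE// ltr1n.
Qed.

Lemma powR_le_neg (x y a : R) : 0 < x -> x <= y -> a <= 0 -> y `^ a <= x `^ a.
Proof.
move=> x0 xy a0; rewrite -(opprK a) !(powRN _ (- a)).
rewrite lef_pV2 ?posrE ?powR_gt0 ?(lt_le_trans x0)//.
by rewrite ge0_ler_powR ?nnegrE ?oppr_ge0// ltW// (lt_le_trans x0).
Qed.

Variables (A n g b : R).
Hypotheses (A0 : 0 <= A) (g0 : 0 < g) (b0 : 0 <= b) (gn : g < n) (ngb : n < g + b).

(* Cut D into the dyadic shells on which rho / e is comparable to 2^k: the
   bounds on the shells form one geometric series for k < 0, because g < n,
   and one for k >= 0, because n < g + b. *)
Lemma singular_power_integral : exists2 C : R, 0 <= C &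
  forall d (T : measurableType d) (mu : {measure set T -> \bar R}) (D : set T)
    (rho : T -> R), measurable D -> measurable_fun [set: T] rho ->
    (forall x, D x -> 0 <= rho x) ->
    (forall r, 0 < r -> (mu (D `&` [set x | (rho x < r)%R]) <= (A * r `^ n)%:E)%E) ->
    forall e : R, 0 < e ->
    (\int[mu]_(x in D) ((rho x `^ (- g) * (e + rho x) `^ (- b))%:E)
      <= (C * e `^ (n - g - b))%:E)%E.
Proof.
pose x1 : R := 2 `^ (g - n); pose x2 : R := 2 `^ (n - g - b).
have two1 : (1 : R) < 2 by rewrite ltr1n.
have x11 : x1 < 1 by rewrite powR2_lt1// subr_lt0.
have x21 : x2 < 1 by rewrite powR2_lt1// -addrA -opprD subr_lt0.
have x10 : 0 <= x1 by exact: powR_ge0.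
have x20 : 0 <= x2 by exact: powR_ge0.
pose a1 : R := A * 2 `^ g; pose a2 : R := A * 2 `^ n.
have a10 : 0 <= a1 by rewrite mulr_ge0 ?powR_ge0.
have a20 : 0 <= a2 by rewrite mulr_ge0 ?powR_ge0.
exists (a1 / (1 - x1) + a2 / (1 - x2)).
  by rewrite addr_ge0// divr_ge0// subr_ge0 ltW.
move=> d T mu D rho mD mrho rho0 hmu e e0.
pose S (r : R) := D `&` [set x | rho x < r].
have mS r : measurable (S r).
  apply: measurableI => //; rewrite -[X in measurable X]setTI.
  exact: (measurable_fun_ltr mrho (measurable_cst r)).
(* Bounds of the integrand on the shells: where rho is below [e], the factor with exponent [b] is
   controlled by [e] alone; where rho is above [e], both factors are controlled by rho. *)
pose c k : R := (2 ^- k.+1 * e) `^ (- g) * e `^ (- b).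
pose c' k : R := (2 ^+ k * e) `^ (- g - b).
have c0 k : 0 <= c k by rewrite mulr_ge0 ?powR_ge0.
have c'0 k : 0 <= c' k by rewrite powR_ge0.
pose F k x := (c k * \1_(S (2 ^- k * e)) x + c' k * \1_(S (2 ^+ k.+1 * e)) x)%:E.
have F0 k x : (0 <= F k x)%E.
  by rewrite lee_fin addr_ge0// mulr_ge0.
have mF k : measurable_fun D (F k).
  apply/measurable_EFinP; apply: measurable_funD; apply: measurable_funM => //;
    exact: measurable_indic.
apply: (@le_trans _ _ (\int[mu]_(x in D) (\sum_(0 <= k <oo) F k x)%E)%E).
  apply: ge0_le_integral_nonmeas => x Dx.
    by rewrite lee_fin mulr_ge0 ?powR_ge0.
  have := rho0 x Dx; rewrite le_eqVlt => /predU1P[r0|r0].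
    (* The zero set of rho meets no shell, but there the negative power is 0 by convention. *)
    rewrite -r0 powR0 ?mul0r; last by rewrite oppr_eq0 gt_eqF.
    by apply: nneseries_ge0 => k _ _; exact: F0.
  have pick k (y : \bar R) : (y <= F k x -> y <= \sum_(0 <= k <oo) F k x)%E.
    move=> h; apply: (le_trans h).
    rewrite (nneseries_split 0 k.+1); last by move=> i _; exact: F0.
    rewrite add0n big_nat_recr//=.
    rewrite -addeA addeC -addeA leeDl// adde_ge0//.
      by apply: nneseries_ge0 => i _ _; exact: F0.
    by apply: sume_ge0 => i _; exact: F0.
  have [[k /andP[k1 k2]]|[k /andP[k1 k2]]] := dyadic_scale (divr_gt0 r0 e0).
    apply: (pick k); rewrite lee_fin.
    rewrite [X in _ <= _ * X + _]indicE mem_set; last first.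
      by split => //=; rewrite -ltr_pdivrMr.
    rewrite mulr1 -[leLHS]addr0 lerD ?mulr_ge0//.
    rewrite ler_pM ?powR_ge0//.
      rewrite powR_le_neg ?oppr_le0 ?(ltW g0)// ?mulr_gt0 ?invr_gt0 ?exprn_gt0//.
      by rewrite -ler_pdivlMr.
    by rewrite powR_le_neg ?oppr_le0// lerDl ltW.
  apply: (pick k); rewrite lee_fin.
  rewrite [X in _ <= _ + _ * X]indicE mem_set; last first.
    by split => //=; rewrite -ltr_pdivrMr.
  rewrite mulr1 -[leLHS]add0r lerD//; first by rewrite mulr_ge0.
  have ek0 : 0 < 2 ^+ k * e by rewrite mulr_gt0 ?exprn_gt0.
  have hk : 2 ^+ k * e <= rho x by rewrite -ler_pdivlMr.
  have -> : c' k = (2 ^+ k * e) `^ (- g) * (2 ^+ k * e) `^ (- b).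
    by rewrite /c' gt0_powRD.
  rewrite ler_pM ?powR_ge0//.
    by rewrite powR_le_neg ?oppr_le0 ?(ltW g0).
  by rewrite powR_le_neg ?oppr_le0// (le_trans hk)// lerDr ltW.
rewrite integral_nneseries//.
have step k : (\int[mu]_(x in D) F k x <=
  (a1 * e `^ (n - g - b) * x1 ^+ k)%:E + (a2 * e `^ (n - g - b) * x2 ^+ k)%:E)%E.
  rewrite /F; under eq_integral do rewrite EFinD.
  rewrite ge0_integralD//; last 4 first.
  - by move=> x _; rewrite lee_fin mulr_ge0.
  - by apply/measurable_EFinP; apply: measurable_funM => //; exact: measurable_indic.
  - by move=> x _; rewrite lee_fin mulr_ge0.
  - by apply/measurable_EFinP; apply: measurable_funM => //; exact: measurable_indic.
  have ind (y r : R) : 0 <= y -> 0 < r ->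
     (\int[mu]_(x in D) (y * \1_(S r) x)%:E <= (y * (A * r `^ n))%:E)%E.
    move=> y0 r0; under eq_integral do rewrite EFinM.
    have mi : measurable_fun D (fun x => (\1_(S r) x : R)%:E).
      by apply/measurable_EFinP; exact: measurable_indic.
    rewrite ge0_integralZl//.
    rewrite integral_indic// EFinM lee_wpmul2l ?lee_fin//.
    apply: le_trans (hmu r r0); apply: le_measure; rewrite ?inE.
    - exact: measurableI.
    - exact: mS.
    - exact: subIsetl.
  have e2 : e `^ (n - g - b) = e `^ (- g) * e `^ (- b) * e `^ n.
    by rewrite -!gt0_powRD//; congr (_ `^ _); ring.
  apply: leeD.
    apply: (le_trans (ind _ _ (c0 k) _)); first by rewrite mulr_gt0 ?invr_gt0 ?exprn_gt0.
    rewrite lee_fin /c !powRM ?invr_ge0 ?exprn_ge0 ?(ltW e0)// !powR_2Xn opprK exprS.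
    rewrite e2 /a1 /x1 !gt0_powRD// !exprMn.
    by rewrite le_eqVlt; apply/orP; left; apply/eqP; ring.
  apply: (le_trans (ind _ _ (c'0 k) _)); first by rewrite mulr_gt0 ?exprn_gt0.
  rewrite lee_fin /c' !powRM ?exprn_ge0 ?(ltW e0)// !powR_2X exprS.
  rewrite e2 /a2 /x2 !gt0_powRD// !exprMn.
  by rewrite le_eqVlt; apply/orP; left; apply/eqP; ring.
apply: (le_trans (lee_nneseries _ (fun k _ => step k))).
  by move=> k _ _; apply: integral_ge0 => x _; exact: F0.
rewrite nneseriesD//; last 2 first.
  by move=> k _ _; rewrite lee_fin !mulr_ge0 ?powR_ge0// exprn_ge0.
  by move=> k _ _; rewrite lee_fin !mulr_ge0 ?powR_ge0// exprn_ge0.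
apply: (le_trans (leeD (geometric_nneseries_le _ x10 x11) (geometric_nneseries_le _ x20 x21))).
- by rewrite mulr_ge0 ?powR_ge0.
- by rewrite mulr_ge0 ?powR_ge0.
rewrite -EFinD lee_fin le_eqVlt; apply/orP; left; apply/eqP; ring.
Qed.

End SingularPower.

(** * Averages over roots of unity *)

Section PowerSeries.
Context {R : realType}.
Implicit Types (a : (Cplx R)^nat) (f : Cplx R -> Cplx R) (z w : Cplx R).

(** The base is an N-th root of unity at distance 2 sin(pi k / N) > 0 from 1, so the geometric sum
    vanishes. *)
Lemma sum_root_powers (N k : nat) : (0 < k < N)%N ->
  \sum_(l < N) circle_pt (2 * pi / N%:R *+ k : R) ^+ l = 0 :> Cplx R.
Proof.
move=> /andP[k0 kN]; set x := circle_pt _.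
have N0 : (0 < N)%N by exact: ltn_trans kN.
have NR : (0 : R) < N%:R by rewrite ltr0n.
have xN : x ^+ N = 1.
  rewrite /x circle_ptX -mulrnA mulnC mulrnA -[_ *+ N]mulr_natr divfK ?gt_eqF//.
  rewrite -circle_ptX (_ : circle_pt _ = 1) ?expr1n//.
  by rewrite /circle_pt mulr_natl cos2pi sin2pi.
have x1 : x - 1 != 0.
  apply/negP => /eqP h; have := congr1 (@cabs R) h.
  rewrite -circle_pt0 cabs_circle_ptB cabs0 subr0 => /eqP.
  rewrite mulf_eq0 pnatr_eq0/= normr_eq0 gt_eqF// sin_gt0_pi//.
  have -> : 2 * pi / N%:R *+ k / 2 = pi * (k%:R / N%:R) :> R.
    by rewrite -mulr_natr; field; rewrite pnatr_eq0 -lt0n.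
  rewrite mulr_gt0 ?pi_gt0 ?divr_gt0 ?ltr0n//=.
  by rewrite -ltr_pdivlMl ?pi_gt0// mulVf ?gt_eqF ?pi_gt0// ltr_pdivrMr// mul1r ltr_nat.
by apply: (mulfI x1); rewrite -subrX1 xN subrr mulr0.
Qed.

(** Expanded in powers of the root of unity, the polynomial P(z + X w) has degree below [N], so
    summation over the roots kills every term but the constant one. *)
Lemma mean_roots_poly (P : {poly Cplx R}) (N : nat) (z w : Cplx R) :
  (size P <= N)%N -> (0 < N)%N ->
  \sum_(l < N) P.[z + circle_pt (2 * pi / N%:R *+ l) * w] = P.[z] *+ N.
Proof.
move=> sP N0; pose Q := P \Po (w *: 'X + z%:P).
have sQ : (size Q <= N)%N.
  apply: (leq_trans (size_comp_poly_leq P _)).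
  have s2 : (size (w *: 'X + z%:P)%R <= 2)%N.
    rewrite (leq_trans (size_polyD _ _))// geq_max.
    by rewrite (leq_trans (size_scale_leq _ _)) ?size_polyX// (leq_trans (size_polyC_leq1 _)).
  apply: (@leq_ltn_trans (size P).-1).
    rewrite -[X in (_ <= X)%N]muln1 leq_mul// -ltnS.
    by move: s2; case: (size _) => [|[|[|]]].
  by case: (size P) sP N0 => [|n].
have QE x : Q.[x] = P.[z + x * w].
  by rewrite horner_comp !hornerE addrC mulrC.
under eq_bigr => l _ do rewrite -QE (horner_coef_wide _ sQ).
rewrite exchange_big/= (bigD1 (Ordinal N0))//= [X in _ + X]big1 ?addr0.
  under eq_bigr do rewrite expr0 mulr1.
  rewrite sumr_const card_ord; congr (_ *+ _).
  by have := QE 0; rewrite mul0r addr0 horner_coef0.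
move=> i i0; under eq_bigr => l _.
  rewrite circle_ptX -mulrnA mulnC mulrnA -circle_ptX; over.
rewrite -mulr_sumr sum_root_powers ?mulr0// ltn_ord andbT lt0n.
by apply: contraNneq i0 => i0; apply/eqP/val_inj.
Qed.

Lemma circle_pt_conj (x : R) : (circle_pt x)^*%C = circle_pt (- x) :> Cplx R.
Proof. by rewrite /circle_pt cosN sinN. Qed.

Lemma sqr_cabs_conj z : (cabs z ^+ 2)%:C%C = z * z^*%C :> Cplx R.
Proof. by rewrite rmorphXn/= -normC_cabs sqr_normc. Qed.

Lemma conjc_sum (I : Type) (r : seq I) (P : pred I) (F : I -> Cplx R) :
  (\sum_(i <- r | P i) F i)^*%C = \sum_(i <- r | P i) (F i)^*%C :> Cplx R.
Proof.
elim/big_rec2 : _ => [|i x y _ <-]; first exact: conjc0.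
by case: (F i) y => [? ?] [? ?]; rewrite /= opprD.
Qed.

Lemma conjcM z w : (z * w)^*%C = z^*%C * w^*%C :> Cplx R.
Proof.
by case: z w => [? ?] [? ?]; apply/eqP; rewrite eq_complex/=; apply/andP; split;
  apply/eqP; ring.
Qed.

Lemma conjcX z n : (z ^+ n)^*%C = z^*%C ^+ n :> Cplx R.
Proof. by elim: n => [|n IH]; rewrite ?expr0 ?conjc1// !exprS conjcM IH. Qed.

Lemma parseval_roots (P : {poly Cplx R}) (N : nat) : (size P <= N)%N -> (0 < N)%N ->
  \sum_(l < N) cabs (P.[circle_pt (2 * pi / N%:R *+ l)]) ^+ 2 =
  (\sum_(k < N) cabs (P`_k) ^+ 2) *+ N.
Proof.
move=> sP N0; apply: (@complexI R); set h := 2 * pi / N%:R.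
have hN : circle_pt (h *+ N) = 1 :> Cplx R.
  rewrite /h -[_ *+ N]mulr_natr divfK ?gt_eqF ?ltr0n//.
  by rewrite /circle_pt mulr_natl cos2pi sin2pi.
rewrite rmorphMn !rmorph_sum/=.
under eq_bigr => l _.
  rewrite sqr_cabs_conj (horner_coef_wide _ sP) conjc_sum mulr_suml.
  under eq_bigr => k _.
    rewrite mulr_sumr.
    under eq_bigr => j _.
      rewrite conjcM conjcX circle_pt_conj mulrACA !circle_ptX -circle_ptD.
      rewrite mulNrn -!mulrnA [(l * k)%N]mulnC [(l * j)%N]mulnC !mulrnA -mulrnBl.
      rewrite -circle_ptX.
      over.
    over.
  over.
rewrite exchange_big/= -sumrMnl; apply: eq_bigr => k _.
transitivity (\sum_(j < N) P`_k * (P`_j)^*%C *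
    \sum_(i < N) circle_pt (h *+ k - h *+ j) ^+ i).
  by rewrite exchange_big/=; apply: eq_bigr => j _; rewrite mulr_sumr.
rewrite (bigD1 k)//= [X in _ + X]big1 ?addr0.
  under eq_bigr do rewrite subrr circle_pt0 expr1n.
  by rewrite sumr_const card_ord sqr_cabs_conj mulr_natr.
move=> j jk.
(* The frequency k - j matters only modulo [N]; a negative one is replaced by N - j + k, which lies
   strictly between 0 and [N]. *)
have [m mN hm] : exists2 m : nat, (0 < m < N)%N &
    circle_pt (h *+ k - h *+ j) = circle_pt (h *+ m) :> Cplx R.
  have [kj|kj] := ltnP j k.
    exists (k - j)%N; first by rewrite subn_gt0 kj (leq_ltn_trans (leq_subr _ _)).
    by rewrite mulrnBr// ltnW.
  have {}kj : (k < j)%N.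
    by rewrite ltn_neqAle kj andbT; apply: contra jk => /eqP/val_inj ->.
  exists (N - j + k)%N.
    rewrite addn_gt0 subn_gt0 ltn_ord/=.
    by rewrite -[X in (_ < X)%N](subnK (ltnW (ltn_ord j))) ltn_add2l.
  rewrite mulrnDr mulrnBr; last by rewrite ltnW.
  have -> : h *+ N - h *+ j + h *+ k = h *+ N + (h *+ k - h *+ j) by ring.
  by rewrite [in RHS]circle_ptD hN mul1r.
by rewrite hm sum_root_powers// mulr0.
Qed.

Lemma series_polyE a M z :
  series (fun k => a k * z ^+ k) M = (\poly_(k < M) a k : {poly Cplx R}).[z].
Proof. by rewrite horner_poly /series/= big_mkord. Qed.

(** At the intermediate radius s = (1 + r)/2 the terms tend to 0, hence are eventually at most 1. On
    the disc of radius [r] they are then dominated by the powers of r/s, uniformly in z. *)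
Lemma power_series_uniform a f (r : R) : power_series_on_disc a f -> r < 1 ->
  forall e, 0 < e -> exists M0, forall M z, (M0 <= M)%N -> cabs z <= r ->
    cabs (f z - series (fun k => a k * z ^+ k) M) <= e.
Proof.
move=> af r1 e e0.
wlog r0 : r r1 / 0 < r => [h|].
  have [||M0 hM] := h (Num.max r 2^-1).
  - by rewrite gt_max r1 invf_lt1// ltr1n.
  - by rewrite lt_max invr_gt0 ltr0n orbT.
  - by exists M0 => M z hM0 zr; apply: hM => //; rewrite le_max zr.
pose s := (1 + r) / 2.
have s1 : s < 1 by rewrite /s; lra.
have rs : r < s by rewrite /s; lra.
have s0 : 0 < s by exact: lt_trans rs.
pose q := r / s.
have q0 : 0 < q by rewrite divr_gt0.
have q1 : q < 1 by rewrite ltr_pdivrMr// mul1r.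
have ds : disc (s%:C%C : Cplx R) by rewrite /disc/= cabs_real gtr0_norm.
have /cvg_cabs : (fun k => a k * (s%:C%C) ^+ k) @ \oo --> (0 : Cplx R).
  by apply: cvg_series_cvg_0; apply/cvg_ex; eexists; exact: af ds.
rewrite cabs0 => /cvgrPdist_le /(_ 1 ltr01)[K _ hK].
have aK k : (K <= k)%N -> cabs (a k) * s ^+ k <= 1.
  move=> /hK /=; rewrite sub0r normrN ger0_norm ?cabs_ge0//.
  by rewrite cabsM cabsX cabs_real gtr0_norm.
have bnd k z : (K <= k)%N -> cabs z <= r -> cabs (a k * z ^+ k) <= q ^+ k.
  move=> Kk zr; rewrite cabsM cabsX.
  apply: (@le_trans _ _ (cabs (a k) * r ^+ k)).
    by rewrite ler_wpM2l ?cabs_ge0// lerXn2r ?nnegrE ?cabs_ge0// ltW.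
  have -> : r ^+ k = s ^+ k * q ^+ k.
    by rewrite -exprMn /q mulrC divfK// gt_eqF.
  by rewrite mulrA ler_piMl ?exprn_ge0 ?(ltW q0)// aK.
have geo m n : \sum_(m <= k < m + n) q ^+ k <= q ^+ m / (1 - q).
  have q10 : 0 < 1 - q by rewrite subr_gt0.
  rewrite -{1}(add0n m) big_addn addKn.
  under eq_bigr do rewrite exprD mulrC.
  rewrite -mulr_sumr ler_wpM2l ?exprn_ge0 ?(ltW q0)//.
  rewrite big_mkord -(ler_pM2l q10) mulfV ?gt_eqF//.
  by rewrite -opprB mulNr -subrX1 opprB gerBl exprn_ge0 ?ltW.
have qn : (fun n => q ^+ n) @ \oo --> (0 : R) by apply: cvg_expr; rewrite gtr0_norm.
have eq0 : 0 < e * (1 - q) by rewrite mulr_gt0// subr_gt0.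
have /cvgrPdist_le /(_ _ eq0)[M1 _ hM1] := qn.
exists (maxn K M1) => M z; rewrite geq_max => /andP[KM MM] zr.
(* The index [M2] depends on z, but only through the arbitrary slack [t]; the block from [M] to M +
   M2 is bounded uniformly. *)
apply/ler_addgt0Pr => t t0.
have /af : disc z by rewrite /disc/=; exact: le_lt_trans r1.
move=> /cvg_cabsP/cvgrPdist_le /(_ t t0)[M2 _ hM2].
have {hM2} := hM2 (M + M2)%N (leq_addl _ _).
rewrite sub0r normrN ger0_norm ?cabs_ge0// => hM2.
rewrite -(subrK (series (fun k => a k * z ^+ k) (M + M2)%N) (f z)) -addrA addrC.
apply: (le_trans (cabsD _ _)); apply: lerD => //.
rewrite /series/= (@big_cat_nat _ _ _ M)//= ?leq_addr//; rewrite addrC addKr.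
apply: (le_trans (cabs_sum _ _ _)).
apply: (@le_trans _ _ (\sum_(M <= k < M + M2) q ^+ k)).
  rewrite !big_nat; apply: ler_sum => k /andP[Mk _].
  by apply: bnd => //; exact: leq_trans Mk.
apply: (le_trans (geo _ _)); rewrite ler_pdivrMr ?subr_gt0//.
have := hM1 M MM; rewrite sub0r normrN ger0_norm//.
by rewrite exprn_ge0 ?ltW.
Qed.

End PowerSeries.

(** * The sub-mean value property *)

Section SubMean.
Context {R : realType}.
Notation leb := (@lebesgue_measure R).
Notation RR := (measurableTypeR R * measurableTypeR R)%type.
Implicit Types (a : (Cplx R)^nat) (f : Cplx R -> Cplx R) (z : Cplx R).

Definition cw (w : RR) : Cplx R := Complex (w.1 : R) (w.2 : R).

(** Componentwise, so that sums, products and pointwise limits reduce to measurability of real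
    functions. *)
Definition cmeas d (T : measurableType d) (D : set T) (F : T -> Cplx R) :=
  measurable_fun D (fun x => complex.Re (F x)) /\
  measurable_fun D (fun x => complex.Im (F x)).

Lemma cmeas_cw : cmeas setT cw.
Proof. by split; [exact: measurable_fst_RR|exact: measurable_snd_RR]. Qed.

Section Cmeas.
Context d (T : measurableType d) (D : set T).

Lemma cmeas_cst z : cmeas D (fun=> z).
Proof. by split; exact: measurable_cst. Qed.

Lemma cmeasD (F G : T -> Cplx R) : cmeas D F -> cmeas D G ->
  cmeas D (fun x => F x + G x).
Proof.
move=> [F1 F2] [G1 G2]; split.
  by under eq_fun do rewrite ReD; exact: measurable_funD.
by under eq_fun do rewrite ImD; exact: measurable_funD.
Qed.

Lemma cmeasM (F G : T -> Cplx R) : cmeas D F -> cmeas D G ->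
  cmeas D (fun x => F x * G x).
Proof.
move=> [F1 F2] [G1 G2]; split.
  by under eq_fun do rewrite ReM; apply: measurable_funB; exact: measurable_funM.
by under eq_fun do rewrite ImM; apply: measurable_funD; exact: measurable_funM.
Qed.

Lemma cmeas_series a (F : T -> Cplx R) n : cmeas D F ->
  cmeas D (fun x => series (fun k => a k * F x ^+ k) n).
Proof.
move=> mF; have mX k : cmeas D (fun x => F x ^+ k).
  elim: k => [|k IH]; first exact: (cmeas_cst 1).
  by under eq_fun do rewrite exprS; exact: cmeasM.
elim: n => [|n IH].
  by rewrite /series/=; under eq_fun do rewrite big_geq//; exact: cmeas_cst.
rewrite /series/=; under eq_fun do rewrite big_nat_recr//=.
by apply: cmeasD => //; apply: cmeasM => //; exact: cmeas_cst.
Qed.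

Lemma cmeas_power_series a f (F : T -> Cplx R) : cmeas D F ->
  (forall x, D x -> disc (F x)) -> power_series_on_disc a f ->
  cmeas D (fun x => f (F x)).
Proof.
move=> mF dF af; split.
  apply: (@measurable_fun_cvg _ _ _ _
    (fun n x => complex.Re (series (fun k => a k * F x ^+ k) n))).
    by move=> n; exact: (cmeas_series a n mF).1.
  by move=> x Dx; apply: cvg_Re; exact: (af _ (dF x Dx)).
apply: (@measurable_fun_cvg _ _ _ _
  (fun n x => complex.Im (series (fun k => a k * F x ^+ k) n))).
  by move=> n; exact: (cmeas_series a n mF).2.
by move=> x Dx; apply: cvg_Im; exact: (af _ (dF x Dx)).
Qed.

Lemma cmeas_cabs (F : T -> Cplx R) : cmeas D F ->
  measurable_fun D (fun x => cabs (F x)).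
Proof.
move=> [F1 F2].
have e x : cabs (F x) = (complex.Re (F x) ^+ 2 + complex.Im (F x) ^+ 2) `^ 2^-1.
  by rewrite cabsE powR12_sqrt// addr_ge0 ?sqr_ge0.
under eq_fun do rewrite e.
apply: (measurableT_comp (measurable_powR _)).
by apply: measurable_funD; exact: measurable_funX.
Qed.

Lemma cmeas_cabs_powR (F : T -> Cplx R) (p : R) : cmeas D F ->
  measurable_fun D (fun x => cabs (F x) `^ p).
Proof. by move=> mF; apply: (measurableT_comp (measurable_powR _)); exact: cmeas_cabs. Qed.

End Cmeas.

(** Young's inequality for x and c^(p - 1), multiplied by [p], is the tangent inequality of the
    convex power. *)
Lemma powR_tangent (p c x : R) : 1 < p -> 0 <= c -> 0 <= x ->
  c `^ p + p * c `^ (p - 1) * (x - c) <= x `^ p.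
Proof.
move=> p1 c0 x0; have p0 : 0 < p by exact: lt_trans p1.
have p10 : 0 < p - 1 by rewrite subr_gt0.
have := @conjugate_powR R x (c `^ (p - 1)) p (p / (p - 1)) x0 (powR_ge0 _ _) p0.
rewrite divr_gt0// => /(_ isT).
have -> : p^-1 + (p / (p - 1))^-1 = 1.
  by rewrite invf_div; field; rewrite (gt_eqF p0).
move=> /(_ erefl); rewrite -powRrM mulrC.
have -> : (p - 1) * (p / (p - 1)) = p by field; rewrite gt_eqF.
rewrite invf_div => h.
have cp : c * c `^ (p - 1) = c `^ p by exact: mulr_powRB1.
have {}h : p * (c `^ (p - 1) * x) <= p * (x `^ p / p + c `^ p * ((p - 1) / p)).
  by rewrite ler_pM2l.
have e : p * (x `^ p / p + c `^ p * ((p - 1) / p)) = x `^ p + c `^ p * (p - 1).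
  by field; rewrite gt_eqF.
rewrite e -cp in h; rewrite -cp; lra.
Qed.

Lemma integral_translation2 (c1 c2 : R) (f : RR -> \bar R) :
  measurable_fun [set: RR] f -> (forall x, 0 <= f x)%E ->
  (\int[leb \x leb]_w f ((w.1 + c1)%R, (w.2 + c2)%R) = \int[leb \x leb]_w f w)%E.
Proof.
move=> mf f0.
have mf1 : measurable_fun [set: RR] (fun w : RR => f (w.1, (w.2 + c2)%R)).
  apply: (measurableT_comp mf); apply: measurable_fun_pairR.
    exact: measurable_fst_RR.
  by apply: measurable_funD; first exact: measurable_snd_RR.
have mf2 : measurable_fun [set: RR] (fun w : RR => f ((w.1 + c1)%R, (w.2 + c2)%R)).
  apply: (measurableT_comp mf); apply: measurable_fun_pairR.
    by apply: measurable_funD; first exact: measurable_fst_RR.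
  by apply: measurable_funD; first exact: measurable_snd_RR.
transitivity (\int[leb \x leb]_w f (w.1, (w.2 + c2)%R))%E.
  rewrite (@fubini_tonelli2 _ _ _ _ _ _ _ (fun w : RR => f (w.1, (w.2 + c2)%R)))//.
  rewrite (@fubini_tonelli2 _ _ _ _ _ _ _ (fun w : RR => f ((w.1 + c1)%R, (w.2 + c2)%R)))//.
  apply: eq_integral => y _; rewrite /fubini_G/=.
  rewrite (@integral_translation _ c1 (fun x => f (x, (y + c2)%R)))//.
  exact: measurableT_comp mf (measurable_pair2 _).
rewrite (@fubini_tonelli1 _ _ _ _ _ _ _ (fun w : RR => f (w.1, (w.2 + c2)%R)))//.
rewrite (@fubini_tonelli1 _ _ _ _ _ _ _ f)//.
apply: eq_integral => x _; rewrite /fubini_F/=.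
rewrite (@integral_translation _ c2 (fun y => f (x, y)))//.
exact: measurableT_comp mf (measurable_pair1 _).
Qed.

Lemma measurable_cabs_lt (r : R) z :
  measurable [set w : RR | cabs (cw w - z) < r].
Proof.
rewrite -[X in measurable X]setTI.
apply: (@measurable_fun_ltr _ _ _ setT (fun w => cabs (cw w - z)) (cst r)) => //.
apply: cmeas_cabs; apply: cmeasD; [exact: cmeas_cw|exact: cmeas_cst].
Qed.

Lemma ge0_le_integral_subset d (T : measurableType d)
    (mu : {measure set T -> \bar R}) (A B : set T) (g h : T -> \bar R) :
  A `<=` B -> (forall x, A x -> 0 <= g x)%E -> (forall x, B x -> 0 <= h x)%E ->
  (forall x, A x -> g x <= h x)%E ->
  (\int[mu]_(x in A) g x <= \int[mu]_(x in B) h x)%E.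
Proof.
move=> AB g0 h0 gh; rewrite integral_mkcond [leRHS]integral_mkcond.
apply: ge0_le_integral_nonmeas => x _.
  by rewrite patchE; case: ifPn => // /set_mem /g0.
rewrite !patchE; case: ifPn => [/set_mem Ax|_].
  by rewrite mem_set ?gh//; exact: AB.
by case: ifPn => // /set_mem /h0.
Qed.

(* Averaging a polynomial over the vertices of a regular N-gon gives its value
   at the centre exactly once N exceeds the degree, so the Taylor polynomials
   yield the sub-mean value property without contour integrals. *)
Lemma sub_mean_roots a f (p k : R) z (r : R) : 1 < p ->
  power_series_on_disc a f -> 0 < r -> cabs z + r < 1 ->
  0 <= k -> k < cabs (f z) `^ p ->
  exists2 N : nat, (0 < N)%N & forall w, cabs w < r ->
    k *+ N <= \sum_(l < N) cabs (f (z + circle_pt (2 * pi / N%:R *+ l) * w)) `^ p.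
Proof.
move=> p1 af r0 zr k0 kc; set c := cabs (f z) in kc *.
have c0 : 0 < c.
  rewrite lt_neqAle cabs_ge0 andbT; apply/eqP => e.
  move: kc; rewrite -e powR0; first by rewrite ltNge k0.
  by rewrite gt_eqF// (lt_trans _ p1).
have p0 : 0 < p by exact: lt_trans p1.
(* The Taylor polynomial replaces [f] twice, at the centre and at the vertices. The resulting error
   2e, multiplied by the slope p c^(p - 1) of the tangent, uses up exactly the gap c^p - k. *)
pose e := (c `^ p - k) / (2 * (p * c `^ (p - 1))).
have pc0 : 0 < p * c `^ (p - 1) by rewrite mulr_gt0// powR_gt0.
have e0 : 0 < e by rewrite divr_gt0 ?subr_gt0// mulr_gt0.
have [M hM] := power_series_uniform af zr e0.
exists M.+1 => // w wr.
have zle : cabs z <= cabs z + r by rewrite lerDl ltW.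
pose om (l : nat) : Cplx R := circle_pt (2 * pi / M.+1%:R *+ l).
have := @mean_roots_poly R (\poly_(k < M) a k) M.+1 z w
  (leq_trans (size_poly _ _) (leqnSn M)) (ltn0Sn M).
under eq_bigr do rewrite -series_polyE.
rewrite -series_polyE => hS.
have zl (l : nat) : cabs (z + om l * w) <= cabs z + r.
  by rewrite (le_trans (cabsD _ _))// lerD2l cabsM cabs_circle_pt mul1r ltW.
pose S z := series (fun k => a k * z ^+ k) M.
have h1 : cabs (S z) *+ M.+1 <= \sum_(l < M.+1) (cabs (f (z + om l * w)) + e).
  have -> : cabs (S z) *+ M.+1 = cabs (S z *+ M.+1).
    by rewrite -[in RHS]mulr_natr cabsM cabs_nat mulr_natr.
  rewrite -hS; apply: (le_trans (cabs_sum _ _ _)); apply: ler_sum => l _.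
  have := hM M _ (leqnn M) (zl l); set A := f _; set B := series _ _ => h.
  have := cabsD (B - A) A; rewrite subrK cabs_distC; lra.
have h2 : c <= cabs (S z) + e.
  have := hM M _ (leqnn M) zle; rewrite -/(S z) => h.
  by have := cabsD (f z - S z) (S z); rewrite subrK -/c; lra.
rewrite big_split/= sumr_const card_ord in h1.
have h3 : c *+ M.+1 <= \sum_(l < M.+1) cabs (f (z + om l * w)) + e *+ 2 *+ M.+1.
  apply: (@le_trans _ _ ((cabs (S z) + e) *+ M.+1)).
    by rewrite lerMn2r h2 orbT.
  rewrite mulrnDl mulr2n mulrnDl addrA lerD2r//.
apply: (@le_trans _ _ (\sum_(l < M.+1) (c `^ p + p * c `^ (p - 1) *
   (cabs (f (z + om l * w)) - c)))); last first.
  by apply: ler_sum => l _; apply: powR_tangent; rewrite ?cabs_ge0// ltW.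
rewrite big_split/= sumr_const card_ord -mulr_sumr big_split/= sumrN sumr_const card_ord.
have -> : k = c `^ p - p * c `^ (p - 1) * (e *+ 2).
  rewrite /e -mulr_natr; move: pc0; set X := p * _ => X0.
  by field; rewrite gt_eqF.
rewrite mulrnBl lerD2l -mulrnAr -mulrN ler_pM2l//; lra.
Qed.

(** The discrete inequality is integrated over the disc. Each of the [N] rotated integrals equals
    the original one, so the factor [N] cancels, although [N] depends on the level [k] below
    |f(z)|^p. *)
Lemma sub_mean_value a f (p : R) z (r : R) : 1 < p ->
  power_series_on_disc a f -> 0 < r -> cabs z + r < 1 ->
  ((cabs (f z) `^ p * r ^+ 2)%:E <=
   \int[leb \x leb]_(w in [set w : RR | (cabs (cw w - z) < r)%R]) (cabs (f (cw w)) `^ p)%:E)%E.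
Proof.
move=> p1 af r0 zr.
pose D := [set w : RR | cabs (cw w) < r].
have mD : measurable D.
  by have := measurable_cabs_lt r 0; under eq_set do rewrite subr0.
pose F (w : RR) : \bar R := ((fun w => (cabs (f (z + cw w)) `^ p)%:E) \_ D) w.
have F0 w : (0 <= F w)%E.
  by rewrite /F patchE; case: ifPn => // _; rewrite lee_fin powR_ge0.
have mF : measurable_fun [set: RR] F.
  apply/(measurable_restrictT _ mD)/measurable_EFinP; apply: cmeas_cabs_powR.
  apply: (@cmeas_power_series _ _ _ a) => //.
    apply: cmeasD; first exact: cmeas_cst.
    by split; [have := cmeas_cw.1|have := cmeas_cw.2]; exact: measurable_funTS.
  move=> w Dw; rewrite /disc/=; apply: le_lt_trans zr.
  by rewrite (le_trans (cabsD _ _))// lerD2l ltW.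
have -> : (\int[leb \x leb]_(w in [set w : RR | (cabs (cw w - z) < r)%R])
    (cabs (f (cw w)) `^ p)%:E = \int[leb \x leb]_w F w)%E.
  rewrite integral_mkcond -(integral_translation2 (- complex.Re z) (- complex.Im z) mF F0).
  apply: eq_integral => w _; rewrite /F !patchE.
  have e : cw w - z = cw ((w.1 - complex.Re z)%R, (w.2 - complex.Im z)%R).
    have zE : z = Complex (complex.Re z) (complex.Im z) by case: (z).
    by rewrite {1}zE.
  have -> : (w \in [set w : RR | cabs (cw w - z) < r]) =
     (((w.1 - complex.Re z)%R, (w.2 - complex.Im z)%R) \in D).
    by apply/idP/idP => /set_mem/= h; apply/mem_set; rewrite /D/= -?e// e.
  by case: ifPn => // _; rewrite -e addrC subrK.
(* A square of side [r] inside the disc suffices; this is why the statement has r^2 instead of pi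
   r^2. *)
have area : ((r ^+ 2)%:E <= (leb \x leb)%E D)%E.
  pose J : set (measurableTypeR R) := `](- (r / 2)), (r / 2)]%classic.
  have muJ : leb J = r%:E.
    rewrite lebesgue_measure_itv/= lte_fin gtrN ?divr_gt0//.
    rewrite -EFinD; congr EFin.
    by rewrite opprK -splitr.
  have -> : (r ^+ 2)%:E = ((leb \x leb) (J `*` J))%E.
    have mJ : measurable J by exact: measurable_itv.
    rewrite expr2 EFinM -muJ; exact/esym/(product_measure1E leb leb mJ mJ).
  apply: le_measure; rewrite ?inE//.
    by apply: measurableX; exact: measurable_itv.
  move=> [x y] [] /=; rewrite /J/= !in_itv/= => /andP[x1 x2] /andP[y1 y2].
  rewrite /D/= -(@ltr_pXn2r _ 2)// ?nnegrE ?cabs_ge0 ?(ltW r0)// cabs_sqr/=.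
  have sq (u : R) : - (r / 2) < u -> u <= r / 2 -> u ^+ 2 <= r ^+ 2 / 4.
    move=> u1 u2; have -> : r ^+ 2 / 4 = (r / 2) ^+ 2 by field.
    by rewrite -subr_ge0 subr_sqr mulr_ge0//; lra.
  have r2 : 0 < r ^+ 2 by rewrite exprn_gt0.
  apply: (@le_lt_trans _ _ (r ^+ 2 / 4 + r ^+ 2 / 4)); last by lra.
  by apply: lerD; exact: sq.
have key (k : R) : 0 <= k -> k < cabs (f z) `^ p ->
    ((k * r ^+ 2)%:E <= \int[leb \x leb]_w F w)%E.
  move=> k0 kc; have [N N0 hN] := sub_mean_roots p1 af r0 zr k0 kc.
  pose om (l : nat) : R := 2 * pi / N%:R *+ l.
  have rotE l (w : RR) : circle_pt (om l) * cw w =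
      cw ((cos (om l) * w.1 - sin (om l) * w.2)%R, (sin (om l) * w.1 + cos (om l) * w.2)%R).
    by rewrite /cw/= /circle_pt; congr Complex; rewrite /= addrC.
  have hI (l : nat) : (\int[leb \x leb]_w F w = \int[leb \x leb]_w
      F ((cos (om l) * w.1 - sin (om l) * w.2)%R, (sin (om l) * w.1 + cos (om l) * w.2)%R))%E.
    by rewrite integral_rotation// cos2Dsin2.
  have mFl (l : nat) : measurable_fun [set: RR] (fun w : RR =>
      F ((cos (om l) * w.1 - sin (om l) * w.2)%R, (sin (om l) * w.1 + cos (om l) * w.2)%R)).
    apply: (measurableT_comp mF); apply: measurable_fun_pairR.
      by apply: measurable_funB; apply: measurable_funM.
    by apply: measurable_funD; apply: measurable_funM.
  have NR : (0 : R) < N%:R by rewrite ltr0n.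
  rewrite -(@lee_pmul2l _ N%:R%:E)// ?ltr0n//.
  have -> : (N%:R%:E * \int[leb \x leb]_w F w = \sum_(l < N) \int[leb \x leb]_w F w)%E.
    by rewrite sumr_const card_ord mule_natl.
  under [leRHS]eq_bigr => l _ do rewrite (hI l).
  rewrite -ge0_integral_sum//.
  apply: (@le_trans _ _ (\int[leb \x leb]_w ((k *+ N)%:E * (\1_D w)%:E))%E).
    rewrite ge0_integralZl//; last 2 first.
      by apply/measurable_EFinP; exact: measurable_indic.
      by rewrite lee_fin mulrn_wge0.
    rewrite integral_indic// setIT -EFinM mulrA -[N%:R * k]mulrC mulr_natr EFinM.
    by rewrite lee_wpmul2l// lee_fin mulrn_wge0.
  apply: ge0_le_integral_nonmeas => w _.
    by rewrite mule_ge0// lee_fin mulrn_wge0.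
  rewrite indicE; case: (boolP (w \in D)) => [/set_mem Dw|_]; last first.
    by rewrite mule0; apply: sume_ge0 => l _; exact: F0.
  rewrite mule1; apply: (@le_trans _ _ (\sum_(l < N)
     (cabs (f (z + circle_pt (om l) * cw w)) `^ p)%:E)%E).
    by rewrite sumEFin lee_fin; exact: hN.
  apply: lee_sum => l _; rewrite rotE /F patchE mem_set//.
  by rewrite /D/= -rotE cabsM cabs_circle_pt mul1r.
have r20 : 0 < r ^+ 2 by rewrite exprn_gt0.
rewrite leNgt; apply/negP => hlt.
have I0 : (0 <= \int[leb \x leb]_w F w)%E by apply: integral_ge0 => w _; exact: F0.
have Ifin : (\int[leb \x leb]_w F w)%E \is a fin_num.
  by rewrite ge0_fin_numE// (lt_trans hlt)// ltry.
move: key hlt I0; rewrite -(fineK Ifin); set i := fine _ => key.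
rewrite lte_fin lee_fin => hlt I0; set C := cabs (f z) `^ p in key hlt *.
have i1 : i / r ^+ 2 < C by rewrite ltr_pdivrMr.
have i2 : 0 <= i / r ^+ 2 by rewrite divr_ge0// ltW.
(* If the inequality failed, the midpoint of i/r^2 and [C] would be an admissible level that already
   exceeds i/r^2. *)
have := key ((C + i / r ^+ 2) / 2) ltac:(lra) ltac:(lra).
rewrite lee_fin; have -> : (C + i / r ^+ 2) / 2 * r ^+ 2 = (C * r ^+ 2 + i) / 2.
  by field; rewrite gt_eqF.
lra.
Qed.

End SubMean.

(** * Lower bounds for the norm *)

Section ConeLower.
Context {R : realType}.
Notation leb := (@lebesgue_measure R).
Notation RR := (measurableTypeR R * measurableTypeR R)%type.
Implicit Types (a : (Cplx R)^nat) (f : Cplx R -> Cplx R) (z xi : Cplx R) (p q : R).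

Lemma Gamma_half_disc xi z : cabs xi = 1 -> Gamma_half xi z -> cabs z < 1.
Proof.
move=> xi1 [[]//|[w [t [w2 t0 t1 ->]]]].
apply: (le_lt_trans (cabsD _ _)); rewrite !cabsM !cabs_real xi1 mulr1.
rewrite !ger0_norm ?subr_ge0 ?(ltW t1)//.
have : (1 - t) * cabs w < (1 - t) * 1.
  by rewrite ltr_pM2l ?subr_gt0//; have := @invf_lt1 R 2; lra.
lra.
Qed.

Lemma cone_integrand_ge0 p f z : cabs z < 1 ->
  0 <= cabs (f z) `^ p / (1 - cabs z ^+ 2).
Proof.
move=> z1; rewrite divr_ge0 ?powR_ge0// subr_ge0 expr_le1 ?cabs_ge0//.
exact: ltW.
Qed.

Lemma cone_integral_ge0 p f xi : cabs xi = 1 -> (0 <= cone_integral p f xi)%E.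
Proof.
move=> xi1; apply: integral_ge0 => w /= Gw; rewrite lee_fin.
exact/cone_integrand_ge0/(Gamma_half_disc xi1).
Qed.

(** Write z = t w + (1 - t) xi. The offset within the ball and the angular offset contribute at most
    t/4 each to t w, the first strictly, so |w| < 1/2. *)
Lemma ball_sub_Gamma_half (theta phi t : R) z : 0 < t -> t <= 1 ->
  `|theta - phi| <= t / 4 ->
  cabs (z - (1 - t)%:C%C * circle_pt phi) < t / 4 -> Gamma_half (circle_pt theta) z.
Proof.
move=> t0 t1 tp zt; right; set xi := circle_pt theta.
exists ((t^-1)%:C%C * (z - (1 - t)%:C%C * xi)), (1 - t).
have tn : (t%:C%C : Cplx R) * (t^-1)%:C%C = 1.
  by rewrite -rmorphM/= mulfV ?gt_eqF.
split; [|lra|lra|]; last first.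
  have -> : 1 - (1 - t) = t by ring.
  by rewrite mulrA tn mul1r subrK.
rewrite cabsM cabs_real gtr0_norm ?invr_gt0// ltr_pdivrMl//.
have -> : z - (1 - t)%:C%C * xi = (z - (1 - t)%:C%C * circle_pt phi) +
    (1 - t)%:C%C * (circle_pt phi - xi) by rewrite mulrBr; ring.
apply: (le_lt_trans (cabsD _ _)); rewrite cabsM cabs_real ger0_norm; last lra.
have h : cabs (circle_pt phi - xi) <= t / 4.
  by rewrite cabs_distC (le_trans (cabs_circle_ptB_le _ _)).
have : (1 - t) * cabs (circle_pt phi - xi) <= 1 * (t / 4).
  by rewrite ler_pM ?cabs_ge0//; lra.
lra.
Qed.

(** Product of 1/pi from the normalization of [dA], of (t/4)^2 from the sub-mean value property and
    of 2/(5t), divided by t. On the ball of radius t/4 around a point of modulus 1 - t, 1 - |w|^2 is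
    at most (5t/4) times 2, whence 2/(5t). *)
Definition cone_const : R := (40 * pi)^-1.

Lemma cone_const_gt0 : 0 < cone_const.
Proof. by rewrite invr_gt0 mulr_gt0 ?pi_gt0. Qed.

Lemma cone_lower p a f (theta phi t : R) : 1 < p -> power_series_on_disc a f ->
  0 < t -> t <= 1 -> `|theta - phi| <= t / 4 ->
  ((cone_const * t * cabs (f ((1 - t)%:C%C * circle_pt phi)) `^ p)%:E
    <= cone_integral p f (circle_pt theta))%E.
Proof.
move=> p1 af t0 t1 tp; set z0 := _ * circle_pt phi.
have z0E : cabs z0 = 1 - t.
  by rewrite cabsM cabs_circle_pt mulr1 cabs_real ger0_norm//; lra.
pose B := [set w : RR | cabs (cw w - z0) < t / 4].
have mB : measurable B by exact: measurable_cabs_lt.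
have Bin w : B w -> 1 - t - t / 4 < cabs (cw w) < 1.
  rewrite /B/= => h; have := cabs_dist (cw w) z0; rewrite z0E => h2.
  have := le_lt_trans h2 h; rewrite ltr_norml; lra.
have mF : measurable_fun B (fun w => (cabs (f (cw w)) `^ p)%:E).
  apply/measurable_EFinP; apply: cmeas_cabs_powR.
  apply: (@cmeas_power_series _ _ _ _ a) => //.
    by split; [have := (@cmeas_cw R).1|have := (@cmeas_cw R).2]; exact: measurable_funTS.
  by move=> w /Bin /andP[].
have t40 : 0 < t / 4 by rewrite divr_gt0.
have sm : cabs z0 + t / 4 < 1 by rewrite z0E; lra.
have h := sub_mean_value p1 af t40 sm.
pose k := 2 / (5 * t).
have k0 : 0 < k by rewrite divr_gt0// mulr_gt0.
pose c1 : {nonneg R} := NngNum (pi_inv_ge0 R).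
apply: (@le_trans _ _ (\int[@dA R]_(w in B) (k%:E * (cabs (f (cw w)) `^ p)%:E))%E).
  rewrite ge0_integralZl//; last 2 first.
    by move=> w _; rewrite lee_fin powR_ge0.
    by rewrite lee_fin ltW.
  rewrite /dA ge0_integral_mscale//; last first.
    by move=> w _; rewrite lee_fin powR_ge0.
  have -> : (cone_const * t * cabs (f z0) `^ p)%:E =
    (k%:E * ((pi : R)^-1%:E * (cabs (f z0) `^ p * (t / 4) ^+ 2)%:E))%E.
    rewrite -!EFinM /cone_const /k; congr EFin.
    move: (pi_gt0 R); move: (@pi R) => P P0; field.
    by rewrite !gt_eqF.
  rewrite lee_wpmul2l//; first by rewrite lee_fin ltW.
  by rewrite lee_wpmul2l//= lee_fin invr_ge0 pi_ge0.
apply: ge0_le_integral_subset.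
- by move=> w Bw; exact: (ball_sub_Gamma_half t0 t1 tp).
- by move=> w _; rewrite -EFinM lee_fin mulr_ge0 ?powR_ge0// ltW.
- move=> w /= Gw; rewrite lee_fin cone_integrand_ge0//.
  by apply: Gamma_half_disc Gw; exact: cabs_circle_pt.
- move=> w Bw; have /andP[h1 h2] := Bin w Bw.
  rewrite -EFinM lee_fin mulrC ler_wpM2l ?powR_ge0//.
  have c0 := cabs_ge0 (cw w).
  have d0 : 0 < 1 - cabs (cw w) ^+ 2.
    by rewrite subr_gt0 expr_lt1.
  rewrite /k -[leLHS]invrK lef_pV2 ?posrE ?invr_gt0// invf_div.
  rewrite ler_pdivlMr// (_ : 1 - _ = (1 - cabs (cw w)) * (1 + cabs (cw w))); last by ring.
  have : (1 - cabs (cw w)) * (1 + cabs (cw w)) <= (t + t / 4) * 2.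
    by rewrite ler_pM//; lra.
  lra.
Qed.

Lemma ge0_le_poweR (x y : \bar R) (r : R) : 0 <= r ->
  (0 <= x -> x <= y -> x `^ r <= y `^ r)%E.
Proof.
move=> r0 x0 xy; apply: gt0_ler_poweR => //; rewrite in_itv/= leey andbT//.
exact: le_trans xy.
Qed.

Definition AT_int p q f : \bar R :=
  (\int[leb]_(theta in `[0%R, (2 * pi)%R])
     (cone_integral p f (circle_pt theta) `^ (q / p)))%E.

Lemma AT_int_ge0 p q f : (0 <= AT_int p q f)%E.
Proof. by apply: integral_ge0 => *; exact: poweR_ge0. Qed.

Lemma AT_normE p q f : AT_norm p q f = (AT_int p q f `^ q^-1)%E.
Proof. by []. Qed.

Lemma AT_norm_ge0 p q f : (0 <= AT_norm p q f)%E.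
Proof. exact: poweR_ge0. Qed.

Lemma AT_intE p q f : 0 < q -> AT_int p q f = (AT_norm p q f `^ q)%E.
Proof.
by move=> q0; rewrite AT_normE -poweRrM mulVf ?gt_eqF// poweRe1// AT_int_ge0.
Qed.

Lemma AT_norm_lty p q f : 0 < q ->
  (AT_norm p q f < +oo)%E <-> (AT_int p q f < +oo)%E.
Proof.
move=> q0; split; last by move=> h; rewrite AT_normE poweR_lty.
by move=> h; rewrite AT_intE// poweR_lty.
Qed.

Lemma AT_norm_le p q f g (C : R) : 0 < q -> 0 <= C ->
  (AT_int p q f <= C%:E * AT_int p q g)%E ->
  (AT_norm p q f <= (C `^ q^-1)%:E * AT_norm p q g)%E.
Proof.
move=> q0 C0 h; rewrite !AT_normE -poweR_EFin -poweRM ?lee_fin ?AT_int_ge0//.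
by apply: ge0_le_poweR => //; rewrite ?invr_ge0 ?(ltW q0)// AT_int_ge0.
Qed.

(** On each arc the cone integral is bounded below by a constant, and non-overlapping arcs add up.
    One arc gives the growth estimate; a partition of the circle into [N] arcs gives the q-means
    over roots of unity. *)
Lemma AT_int_lower p q a f (n : nat) (x y phi t : 'I_n -> R) : 1 < p -> 0 < q ->
  power_series_on_disc a f ->
  (forall i, [/\ 0 <= x i, x i <= y i & y i <= 2 * pi]) ->
  (forall i, 0 < t i <= 1) ->
  (forall i theta, x i <= theta -> theta <= y i -> `|theta - phi i| <= t i / 4) ->
  (forall i j : 'I_n, (i < j)%N -> y i <= x j) ->
  ((\sum_(i < n) (y i - x i) * (cone_const `^ (q / p) * t i `^ (q / p) *
     cabs (f ((1 - t i)%:C%C * circle_pt (phi i))) `^ q))%:E <= AT_int p q f)%E.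
Proof.
move=> p1 q0 af hxy ht hphi hdisj.
have p0 : 0 < p by exact: lt_trans p1.
pose v i := cone_const `^ (q / p) * t i `^ (q / p) *
  cabs (f ((1 - t i)%:C%C * circle_pt (phi i))) `^ q.
have v0 i : 0 <= v i by rewrite !mulr_ge0 ?powR_ge0.
(* Consecutive closed arcs may share an endpoint; half-open ones leave at most one nonzero indicator
   at each angle. *)
pose J i : set (measurableTypeR R) := `[x i, y i[%classic.
have mJ i : measurable (J i) by exact: measurable_itv.
have cone i theta : x i <= theta -> theta <= y i ->
    ((v i)%:E <= cone_integral p f (circle_pt theta) `^ (q / p))%E.
  move=> h1 h2; have /andP[t0 t1] := ht i.
  have h := cone_lower p1 af t0 t1 (hphi i theta h1 h2).
  have -> : (v i)%:E = ((cone_const * t i *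
     cabs (f ((1 - t i)%:C%C * circle_pt (phi i))) `^ p)%:E `^ (q / p))%E.
    rewrite poweR_EFin !powRM ?mulr_ge0 ?powR_ge0 ?(ltW t0) ?(ltW cone_const_gt0)//.
    by rewrite -powRrM /v; congr (_ * _ `^ _)%:E; field; rewrite gt_eqF.
  apply: ge0_le_poweR => //; first by rewrite divr_ge0// ltW.
  by rewrite lee_fin !mulr_ge0 ?powR_ge0 ?(ltW t0) ?(ltW cone_const_gt0).
have -> : (\sum_(i < n) (y i - x i) * v i)%:E =
    (\int[leb]_(theta in setT) (\sum_(i < n) (v i)%:E * (\1_(J i) theta)%:E))%E.
  rewrite ge0_integral_sum//; last 2 first.
  - by move=> i; apply/measurable_EFinP; apply: measurable_funM.
  - by move=> i th _; rewrite -EFinM lee_fin mulr_ge0.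
  rewrite -sumEFin; apply: eq_bigr => i _.
  rewrite ge0_integralZl//; last 2 first.
  - by apply/measurable_EFinP; exact: measurable_indic.
  - by rewrite lee_fin.
  transitivity ((v i)%:E * leb (J i))%E; last by rewrite integral_indic// setIT.
  rewrite /J lebesgue_measure_itv/= lte_fin.
  have [_ xy _] := hxy i.
  case: ltgtP xy => // [xy _|-> _]; last by rewrite subrr mul0r mule0.
  by rewrite -EFinD -EFinM mulrC.
rewrite [leRHS]integral_mkcond; apply: ge0_le_integral_nonmeas => th _.
  by apply: sume_ge0 => i _; rewrite -EFinM lee_fin mulr_ge0.
have [[i /= Ji]|nJ] := pselect (exists i, J i th); last first.
  rewrite big1 => [|i _].
    by rewrite patchE; case: ifPn => // _; exact: poweR_ge0.
  rewrite indicE; case: (boolP (th \in J i)) => [/set_mem Jth|_]; last by rewrite mule0.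
  by exfalso; apply: nJ; exists i.
have [x0 xy y2] := hxy i; move: (Ji); rewrite /J/= in_itv/= => /andP[h1 h2].
rewrite patchE mem_set; last first.
  by rewrite /= in_itv/= (le_trans x0 h1) (le_trans (ltW h2)).
rewrite (bigD1 i)//= big1 ?adde0; last first.
  move=> j ji; rewrite indicE; case: (boolP (th \in J j)) => [/set_mem|_]; last by rewrite mule0.
  rewrite /J/= in_itv/= => /andP[h3 h4]; exfalso.
  have [/hdisj|/hdisj|/val_inj e] := ltngtP i j.
  - by move=> /(le_trans) /(_ h3); rewrite leNgt h2.
  - by move=> /(le_trans) /(_ h1); rewrite leNgt h4.
  - by rewrite e eqxx in ji.
rewrite indicE mem_set// mule1; apply: cone => //; exact: ltW.
Qed.

Lemma arc_near (P phi t : R) : 1 <= P -> 0 < t -> t <= 1 -> 0 <= phi ->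
  phi <= 2 * P ->
  exists x, [/\ 0 <= x, x + t / 4 <= 2 * P, x <= phi & phi <= x + t / 4].
Proof.
move=> P1 t0 t1 phi0 phi2; have [h|h] := leP phi P.
  by exists phi; split; lra.
by exists (phi - t / 4); split; lra.
Qed.

(** As 1 + q/p = s q, taking q-th roots gives the growth exponent s. *)
Lemma AT_growth p q a f (phi t : R) : 1 < p -> 0 < q ->
  power_series_on_disc a f -> 0 < t -> t <= 1 -> 0 <= phi -> phi <= 2 * pi ->
  ((t / 4 * (cone_const `^ (q / p) * t `^ (q / p) *
     cabs (f ((1 - t)%:C%C * circle_pt phi)) `^ q))%:E <= AT_int p q f)%E.
Proof.
move=> p1 q0 af t0 t1 phi0 phi2.
have pi1 : (1 : R) <= pi by apply: le_trans (pi_ge2 R); rewrite ler1n.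
have [x [x0 x2 x3 x4]] := arc_near pi1 t0 t1 phi0 phi2.
have -> : (t / 4 * (cone_const `^ (q / p) * t `^ (q / p) *
     cabs (f ((1 - t)%:C%C * circle_pt phi)) `^ q)) =
  \sum_(i < 1) ((fun=> x + t / 4) i - (fun=> x) i) * (cone_const `^ (q / p) * t `^ (q / p) *
     cabs (f ((1 - t)%:C%C * circle_pt phi)) `^ q).
  by rewrite big_ord1 addrAC subrr add0r.
apply: (@AT_int_lower p q a f 1 (fun=> x) (fun=> x + t / 4) (fun=> phi) (fun=> t)) => //.
- by move=> _; split => //; rewrite lerDl divr_ge0// ltW.
- by move=> _; rewrite t0 t1.
- by clear x2 phi2 => _ th h1 h2; rewrite ler_norml; apply/andP; split; lra.
- by move=> i j; rewrite !ord1.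
Qed.

(** For 0 < theta < 1/4 the point 1 - 4 theta of the radius is at depth t = 4 theta, and the angle
    theta is within t/4 of 0, so the cone at theta sees it. Hence the angular integral over ]0, 1/4[
    controls the radial one after the substitution x = 1 - 4 theta, whose Jacobian is the factor
    4. *)
Lemma AT_weighted_real p q a f : 1 < p -> 0 < q -> power_series_on_disc a f ->
  (\int[leb]_(x in `]0%R, 1%R[) (((1 - x) `^ (q / p) * cabs (f x%:C%C) `^ q)%:E)
   <= (4 * (cone_const `^ (q / p))^-1)%:E * AT_int p q f)%E.
Proof.
move=> p1 q0 af; have p0 : 0 < p by exact: lt_trans p1.
pose D : set (measurableTypeR R) := `]0, 1[%classic.
have mD : measurable D by exact: measurable_itv.
pose G (x : R) : \bar R := ((1 - x) `^ (q / p) * cabs (f x%:C%C) `^ q)%:E.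
have G0 x : (0 <= G x)%E by rewrite lee_fin mulr_ge0 ?powR_ge0.
have mG : measurable_fun D (G : measurableTypeR R -> _).
  apply/measurable_EFinP; apply: measurable_funM.
    apply: (measurableT_comp (measurable_powR _)).
    by apply: measurable_funB.
  apply: cmeas_cabs_powR; apply: (@cmeas_power_series _ _ _ _ a) => //.
    by split => /=; [exact: measurable_id|exact: measurable_cst].
  move=> x; rewrite /D/= in_itv/= => /andP[x0 x1].
  by rewrite /disc/= cabs_real gtr0_norm.
have k0 : (-4 : R) != 0 by rewrite oppr_eq0.
have := @ge0_integral_affine _ (-4) 1 D G k0 mD mG (fun x _ => G0 x).
rewrite -[leLHS]/(\int[leb]_(x in D) G x)%E => <-.
rewrite normrN normr_nat EFinM -muleA lee_wpmul2l ?lee_fin//.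
have cc : 0 < cone_const `^ (q / p) by rewrite powR_gt0 ?cone_const_gt0.
rewrite -(@lee_pmul2l _ (cone_const `^ (q / p))%:E)// ?lte_fin//.
rewrite muleA -EFinM mulfV ?gt_eqF// mul1e.
have -> : [set x : R | D (-4 * x + 1)] = `]0, 4^-1[%classic.
  by apply/seteqP; split => x; rewrite /D/= !in_itv/= => /andP[h1 h2]; apply/andP; split; lra.
rewrite -ge0_integralZl//; last 2 first.
- pose E : set (measurableTypeR R) := `]0, 4^-1[%classic.
  pose g (x : measurableTypeR R) : measurableTypeR R := -4 * x + 1.
  have gE : g @` E `<=` D.
    have aux (x : R) : 0 < x < 4^-1 -> 0 < -4 * x + 1 < 1.
      by move=> /andP[h1 h2]; apply/andP; split; lra.
    by move=> _ [x /= + <-]; rewrite /D/g/= !in_itv/=; exact: aux.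
  by apply: (measurable_comp mD gE mG); apply: measurable_funTS; exact: measurable_affine.
- by rewrite lee_fin ltW.
have pi1 : (1 : R) <= pi by apply: le_trans (pi_ge2 R); rewrite ler1n.
apply: ge0_le_integral_subset.
- by move=> x /=; rewrite !in_itv/= => /andP[h1 h2]; apply/andP; split; lra.
- by move=> x _; apply: mule_ge0; [rewrite lee_fin ltW|exact: G0].
- by move=> x _; exact: poweR_ge0.
move=> x /=; rewrite in_itv/= => /andP[x0 x1].
have h : `|x - 0| <= (4 * x) / 4 by rewrite subr0 gtr0_norm//; lra.
have := @cone_lower p a f x 0 (4 * x) p1 af ltac:(lra) ltac:(lra) h.
rewrite circle_pt0 mulr1 => hc.
have -> : ((cone_const `^ (q / p))%:E * G (-4 * (x : R) + 1)%R =
   (cone_const * (4 * x) * cabs (f (1 - 4 * x)%:C%C) `^ p)%:E `^ (q / p))%E.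
  rewrite poweR_EFin !powRM ?mulr_ge0 ?powR_ge0 ?(ltW x0) ?(ltW cone_const_gt0)//.
  rewrite /G -EFinM -powRrM; congr EFin.
  have -> : -4 * x + 1 = 1 - 4 * x by ring.
  have -> : 1 - (1 - 4 * x) = 4 * x by ring.
  rewrite powRM ?(ltW x0)// -!mulrA; congr (_ * (_ * (_ * _ `^ _))).
  by field; rewrite gt_eqF.
apply: ge0_le_poweR => //; first by rewrite divr_ge0// ltW.
by rewrite lee_fin !mulr_ge0 ?powR_ge0 ?(ltW x0) ?(ltW cone_const_gt0).
Qed.

End ConeLower.

(** * Summability of the coefficients *)

Section CoefficientSums.
Context {R : realType}.
Implicit Types (a : (Cplx R)^nat) (f : Cplx R -> Cplx R) (z : Cplx R) (p q : R).

Lemma geometric_sum_le (x : R) n : 0 <= x -> x < 1 ->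
  \sum_(k < n) x ^+ k <= (1 - x)^-1.
Proof.
move=> x0 x1; have x10 : 0 < 1 - x by rewrite subr_gt0.
rewrite -(ler_pM2l x10) mulfV ?gt_eqF//.
by rewrite -opprB mulNr -subrX1 opprB gerBl exprn_ge0.
Qed.

(** Parseval is applied to a Taylor polynomial of the dilated function that keeps the first [K]
    coefficients and is within 1 of [f] on the circle; then |S|^2 <= 2 |f|^2 + 2 accounts for 2B +
    2. *)
Lemma bessel_roots a f (r B : R) : power_series_on_disc a f -> 0 < r -> r < 1 ->
  (exists N0, forall N, (N0 <= N)%N -> (0 < N)%N ->
    \sum_(l < N) cabs (f (r%:C%C * circle_pt (2 * pi / N%:R *+ l))) ^+ 2 <= B * N%:R) ->
  forall K, \sum_(k < K) cabs (a k) ^+ 2 * r ^+ (2 * k) <= 2 * B + 2.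
Proof.
move=> af r0 r1 [N0 hN0] K.
have [M0 hM0] := power_series_uniform af r1 ltr01.
pose M := maxn K (maxn M0 N0); pose N := M.+1.
have KM : (K <= M)%N by rewrite leq_max leqnn.
have M0M : (M0 <= M)%N by rewrite !leq_max leqnn orbT.
have N0N : (N0 <= N)%N by rewrite leqW// !leq_max leqnn !orbT.
have NR : (0 : R) < N%:R by rewrite ltr0n.
pose P : {poly Cplx R} := \poly_(k < M) (a k * (r%:C%C) ^+ k).
have := @parseval_roots R P N (leq_trans (size_poly _ _) (leqnSn M)) (ltn0Sn M).
have PE w : P.[w] = series (fun k => a k * (r%:C%C * w) ^+ k) M.
  rewrite /P horner_poly /series/= big_mkord; apply: eq_bigr => k _.
  by rewrite exprMn mulrA.
have rl (l : nat) : cabs (r%:C%C * circle_pt (2 * pi / N%:R *+ l)) <= r.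
  by rewrite cabsM cabs_circle_pt cabs_real mulr1 gtr0_norm.
have h1 : \sum_(l < N) cabs (P.[circle_pt (2 * pi / N%:R *+ l)]) ^+ 2 <=
   (2 * B + 2) * N%:R.
  apply: (@le_trans _ _ (\sum_(l < N)
     (2 * cabs (f (r%:C%C * circle_pt (2 * pi / N%:R *+ l))) ^+ 2 + 2))).
    apply: ler_sum => l _; rewrite PE.
    have := hM0 M _ M0M (rl l); set A := f _; set S := series _ _ => h.
    have := cabsD (S - A) A; rewrite subrK cabs_distC => h3.
    have := cabs_ge0 S; have := cabs_ge0 A; have := cabs_ge0 (A - S).
    have h4 : cabs S <= cabs A + 1 by lra.
    move=> _ A0 S0.
    have : cabs S ^+ 2 <= (cabs A + 1) ^+ 2.
      by rewrite lerXn2r ?nnegrE// addr_ge0.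
    have : 0 <= (cabs A - 1) ^+ 2 by exact: sqr_ge0.
    rewrite !expr2; lra.
  rewrite big_split/= sumr_const card_ord -mulr_sumr -[2 *+ N]mulr_natr.
  have := hN0 N N0N (ltn0Sn M); lra.
move=> e; move: h1; rewrite e -mulr_natr ler_pM2r//; apply: le_trans.
rewrite (big_ord_widen N (fun k => cabs (a k) ^+ 2 * r ^+ (2 * k)))//; last exact: leqW.
rewrite big_mkcond/=; apply: ler_sum => k _; case: ifPn => kK; last by rewrite sqr_ge0.
rewrite coef_poly (leq_trans kK KM) cabsM cabsX cabs_real gtr0_norm// exprMn.
by rewrite -exprM mulnC.
Qed.

Lemma AT_int_fine p q f : (AT_int p q f < +oo)%E ->
  AT_int p q f = (fine (AT_int p q f))%:E /\ 0 <= fine (AT_int p q f).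
Proof.
move=> h; rewrite fineK ?ge0_fin_numE ?AT_int_ge0//; split => //.
by rewrite fine_ge0// AT_int_ge0.
Qed.

(** The condition on [N] says that each of the [N] equal arcs has length 2 pi/N at most t/4, so one
    cone estimate covers the whole arc. *)
Lemma roots_q_mean p q a f (t : R) (N : nat) : 1 < p -> 0 < q ->
  power_series_on_disc a f -> (AT_int p q f < +oo)%E ->
  0 < t -> t <= 1 -> (0 < N)%N -> 8 * pi <= t * N%:R ->
  \sum_(l < N) cabs (f ((1 - t)%:C%C * circle_pt (2 * pi / N%:R *+ l))) `^ q
   <= (fine (AT_int p q f) / cone_const `^ (q / p)) * t `^ (- (q / p)) * N%:R.
Proof.
move=> p1 q0 af /AT_int_fine[If I0] t0 t1 N0 Nt.
have NR : (0 : R) < N%:R by rewrite ltr0n.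
have p2 : 0 < 2 * pi / N%:R :> R by rewrite !mulr_gt0 ?pi_gt0 ?invr_gt0.
pose h : R := 2 * pi / N%:R.
have hN : h * N%:R = 2 * pi by rewrite divfK// gt_eqF.
have ht : h <= t / 4.
  by rewrite /h ler_pdivrMr//; move: Nt; lra.
have H := @AT_int_lower R p q a f N (fun l => h *+ l) (fun l => h *+ l.+1)
  (fun l => h *+ l) (fun=> t) p1 q0 af.
rewrite {}If lee_fin in H.
have {}H : \sum_(i < N) (h *+ i.+1 - h *+ i) * (cone_const `^ (q / p) * t `^ (q / p) *
    cabs (f ((1 - t)%:C%C * circle_pt (h *+ i))) `^ q) <= fine (AT_int p q f).
  apply: H.
  - move=> i; split.
    + by rewrite mulrn_wge0// ltW.
    + by rewrite mulrS lerDr ltW.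
    + by rewrite -hN mulr_natr ler_wpMn2l// ltW.
  - by move=> _; rewrite t0 t1.
  - move=> i th; rewrite mulrS => h1 h2; rewrite ger0_norm ?subr_ge0//; lra.
  - by move=> i j ij; rewrite ler_wpMn2l// ltW.
have pi1 : (1 : R) <= pi by apply: le_trans (pi_ge2 R); rewrite ler1n.
have c0 : 0 < cone_const `^ (q / p) :> R by rewrite powR_gt0 ?cone_const_gt0.
have tp : 0 < t `^ (q / p) by rewrite powR_gt0.
set S := \sum_(l < N) _.
have S0 : 0 <= S by apply: sumr_ge0 => l _; exact: powR_ge0.
have {}H : h * (cone_const `^ (q / p) * t `^ (q / p) * S) <= fine (AT_int p q f).
  apply: le_trans H; rewrite !mulr_sumr le_eqVlt; apply/orP; left; apply/eqP.
  by apply: eq_bigr => i _; rewrite [h *+ i.+1]mulrS addrK.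
have {}H : cone_const `^ (q / p) * t `^ (q / p) * S <= fine (AT_int p q f) * N%:R.
  rewrite -(ler_pM2l p2) -/h (le_trans H)// mulrCA hN ler_peMr//; lra.
rewrite powRN -(ler_pM2l (mulr_gt0 c0 tp)).
move: c0 tp H; set cc := cone_const `^ _; set tt := t `^ _ => c0 tp H.
have -> : cc * tt * (fine (AT_int p q f) / cc / tt * N%:R) = fine (AT_int p q f) * N%:R.
  by field; rewrite !gt_eqF.
exact: H.
Qed.

(** For q >= 2, put y = x t^(1/p): then y^2 <= 1 + y^q, and the exponent is 2/p, which is below 1
    because p > 2. For q < 2, write x^2 as x^(2 - q) x^q and bound the first factor by the growth
    estimate; the exponent is then 2s - 1, below 1 because s < 1. *)
Lemma roots_sq_mean p q a f : 2 < p -> 1 < q -> p^-1 + q^-1 < 1 ->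
  power_series_on_disc a f -> (AT_int p q f < +oo)%E ->
  exists d C : R, [/\ 0 <= d, d < 1, 0 <= C &
   forall t, 0 < t -> t < 1 -> exists N0, forall N, (N0 <= N)%N -> (0 < N)%N ->
   \sum_(l < N) cabs (f ((1 - t)%:C%C * circle_pt (2 * pi / N%:R *+ l))) ^+ 2
   <= (C * t `^ (- d)) * N%:R].
Proof.
move=> p2 q1 pq af If.
have p1 : 1 < p by apply: lt_trans p2; rewrite ltr1n.
have p0 : 0 < p by exact: lt_trans p1.
have q0 : 0 < q by exact: lt_trans q1.
have [IE I0] := AT_int_fine If.
have c0 : 0 < cone_const `^ (q / p) :> R by rewrite powR_gt0 ?cone_const_gt0.
pose A := fine (AT_int p q f) / cone_const `^ (q / p).
have A0 : 0 <= A by rewrite divr_ge0// ltW.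
have exN (t : R) : 0 < t -> exists N0, forall N, (N0 <= N)%N -> 8 * pi <= t * N%:R.
  move=> t0; exists (Num.truncn (8 * pi / t)).+1 => N hN.
  rewrite -ler_pdivrMl// mulrC (le_trans (ltW (truncnS_gt _)))//.
  by rewrite ler_nat.
have [q2|q2] := leP 2 q.
  exists (2 / p), (1 + A); split.
  - by rewrite divr_ge0// ltW.
  - by rewrite ltr_pdivrMr// mul1r.
  - by rewrite addr_ge0.
  move=> t t0 t1; have [N0 hN0] := exN t t0; exists N0 => N hN NN.
  have H := roots_q_mean p1 q0 af If t0 (ltW t1) NN (hN0 N hN).
  have pt (x : R) : 0 <= x -> x ^+ 2 <= t `^ (- (2 / p)) +
       t `^ (- (2 / p)) * t `^ (q / p) * x `^ q.
    move=> x0; pose y := x * t `^ (p^-1).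
    have y0 : 0 <= y by rewrite mulr_ge0 ?powR_ge0.
    have yq : y `^ q = t `^ (q / p) * x `^ q.
      by rewrite powRM ?powR_ge0// -powRrM mulrC [p^-1 * q]mulrC.
    have y2 : x ^+ 2 = t `^ (- (2 / p)) * y ^+ 2.
      rewrite exprMn -(@powR_mulrn _ (t `^ _)) ?powR_ge0// -powRrM mulrCA -gt0_powRD//.
      have -> : - (2 / p) + p^-1 * 2%:R = 0 by rewrite mulrC; ring.
      by rewrite powRr0 mulr1.
    rewrite y2 -mulrA -yq -[X in _ <= X + _]mulr1 -mulrDr ler_wpM2l ?powR_ge0//.
    have [y1|y1] := leP y 1.
      by rewrite -[leLHS]addr0 lerD ?powR_ge0// expr_le1.
    rewrite -[leLHS]add0r lerD// -powR_mulrn//; apply: ler_powR => //; exact: ltW.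
  apply: (@le_trans _ _ (\sum_(l < N) (t `^ (- (2 / p)) + t `^ (- (2 / p)) * t `^ (q / p) *
     cabs (f ((1 - t)%:C%C * circle_pt (2 * pi / N%:R *+ l))) `^ q))).
    by apply: ler_sum => l _; apply: pt; exact: cabs_ge0.
  rewrite big_split/= sumr_const card_ord -mulr_sumr -[X in X + _]mulr_natr.
  set X := t `^ (- (2 / p)); set S := \sum_(l < N) _ in H *.
  have X0 : 0 <= X by exact: powR_ge0.
  have H2 : t `^ (q / p) * S <= A * N%:R.
    have := ler_wpM2l (powR_ge0 t (q / p)) H; rewrite -/A powRN.
    have tp : t `^ (q / p) != 0 by rewrite gt_eqF// powR_gt0.
    by rewrite [X in _ <= X -> _](_ : _ = A * N%:R)//; field.
  rewrite [(1 + A) * X]mulrC -[leRHS]mulrA mulrDl mul1r mulrDr lerD2l.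
  by rewrite -mulrA ler_wpM2l.
pose s := p^-1 + q^-1.
(* This is s (2 - q) + q/p: the growth estimate raised to the power 2 - q, times the q-mean, with s
   q = 1 + q/p. *)
pose e := 2 * s - 1.
exists (Num.max 0 e), ((4 * A) `^ ((2 - q) / q) * A); split.
- by rewrite le_max lexx.
- by rewrite gt_max ltr01/= /e /s; lra.
- by rewrite mulr_ge0 ?powR_ge0.
move=> t t0 t1; have [N0 hN0] := exN t t0; exists N0 => N hN NN.
have H := roots_q_mean p1 q0 af If t0 (ltW t1) NN (hN0 N hN).
have NR : (0 : R) < N%:R by rewrite ltr0n.
have G (l : nat) : (l < N)%N ->
  cabs (f ((1 - t)%:C%C * circle_pt (2 * pi / N%:R *+ l))) <=
  (4 * A) `^ (q^-1) * t `^ (- s).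
  move=> lN; have h0 : 0 <= 2 * pi / N%:R :> R.
    by rewrite !mulr_ge0 ?pi_ge0 ?invr_ge0 ?(ltW NR).
  have := AT_growth p1 q0 af t0 (ltW t1) (mulrn_wge0 l h0).
  have -> : 2 * pi / N%:R *+ l <= 2 * pi :> R.
    rewrite -mulr_natr mulrAC ler_pdivrMr// ler_wpM2l ?mulr_ge0 ?pi_ge0//.
    by rewrite ler_nat ltnW.
  move=> /(_ isT); rewrite IE lee_fin; set x := cabs _ => h.
  have x0 : 0 <= x by exact: cabs_ge0.
  have xq : x `^ q <= 4 * A * t `^ (- (s * q)).
    have -> : s * q = 1 + q / p by rewrite /s mulrDl mulVf ?gt_eqF// addrC mulrC.
    rewrite powRN gt0_powRD// powRr1 ?(ltW t0)// ler_pdivlMr ?mulr_gt0 ?powR_gt0//.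
    rewrite /A mulrA ler_pdivlMr//.
    by move: h; set cc := cone_const `^ _; set tt := t `^ _; lra.
  have -> : x = (x `^ q) `^ q^-1 by rewrite -powRrM mulfV ?gt_eqF// powRr1.
  have -> : (4 * A) `^ q^-1 * t `^ (- s) = (4 * A * t `^ (- (s * q))) `^ q^-1.
    have e1 : (t `^ (- (s * q))) `^ q^-1 = t `^ (- s).
      by rewrite -powRrM mulNr mulfK// gt_eqF.
    by rewrite -e1 [RHS]powRM ?powR_ge0// mulr_ge0.
  rewrite ge0_ler_powR ?invr_ge0 ?(ltW q0) ?nnegrE ?powR_ge0//.
  by rewrite (mulr_ge0 (mulr_ge0 _ A0)) ?powR_ge0.
have q20 : 0 <= 2 - q by rewrite subr_ge0 ltW.
apply: (@le_trans _ _ (\sum_(l < N) ((4 * A) `^ ((2 - q) / q) * t `^ (- (s * (2 - q)))) *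
     cabs (f ((1 - t)%:C%C * circle_pt (2 * pi / N%:R *+ l))) `^ q)).
  apply: ler_sum => l _; have := G l (ltn_ord l); set x := cabs _ => xG.
  have x0 : 0 <= x by exact: cabs_ge0.
  have [->|xn] := eqVneq x 0.
    by rewrite expr0n/= !mulr_ge0 ?powR_ge0.
  have xp : 0 < x by rewrite lt_neqAle eq_sym xn.
  have -> : x ^+ 2 = x `^ (2 - q) * x `^ q.
    by rewrite -gt0_powRD// subrK powR_mulrn.
  rewrite ler_wpM2r ?powR_ge0//.
  have -> : (4 * A) `^ ((2 - q) / q) * t `^ (- (s * (2 - q))) =
      ((4 * A) `^ q^-1 * t `^ (- s)) `^ (2 - q).
    have -> : (2 - q) / q = q^-1 * (2 - q) by rewrite mulrC.
    by rewrite [RHS]powRM ?powR_ge0// -mulNr -!powRrM.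
  by rewrite ge0_ler_powR ?nnegrE// mulr_ge0 ?powR_ge0.
rewrite -mulr_sumr.
apply: (@le_trans _ _ ((4 * A) `^ ((2 - q) / q) * t `^ (- (s * (2 - q))) *
   (A * t `^ (- (q / p)) * N%:R))).
  by rewrite ler_wpM2l// mulr_ge0 ?powR_ge0.
have -> : (4 * A) `^ ((2 - q) / q) * t `^ (- (s * (2 - q))) *
   (A * t `^ (- (q / p)) * N%:R) = (4 * A) `^ ((2 - q) / q) * A *
   (t `^ (- (s * (2 - q))) * t `^ (- (q / p))) * N%:R by ring.
rewrite -gt0_powRD// ler_wpM2r ?(ltW NR)// ler_wpM2l ?(mulr_ge0 _ A0) ?powR_ge0//.
have -> : - (s * (2 - q)) + - (q / p) = - e.
  by rewrite /e /s; field; rewrite (gt_eqF p0) (gt_eqF q0).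
apply: ger_powR; first by rewrite t0 ltW.
by rewrite lerN2 le_max lexx orbT.
Qed.

(** On a dyadic block, 2b <= mu b^2 + 1/mu plays the role of Cauchy-Schwarz. With x^2 = 2^(d - 1)
    and mu = x^(-j), both halves are multiples of x^j, and x < 1 because d < 1. *)
Lemma dyadic_l2_summable (b : nat -> R) (d C : R) : 0 <= d -> d < 1 -> 0 <= C ->
  (forall k, 0 <= b k) ->
  (forall j : nat, \sum_(k < 2 ^ j.+1) b k ^+ 2 <= C * (2 `^ d) ^+ j) ->
  exists M, forall n, series (fun k => b k / k.+1%:R) n <= M.
Proof.
move=> d0 d1 C0 b0 hb.
pose x : R := 2 `^ (- ((1 - d) / 2)).
have x0 : 0 < x by rewrite powR_gt0.
have x1 : x < 1 by apply: powR2_lt1; rewrite oppr_lt0 divr_gt0// subr_gt0.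
have x2 : x * x * 2 = 2 `^ d.
  rewrite /x -gt0_powRD// -[X in _ * X]powRr1// -gt0_powRD//; congr (_ `^ _).
  by field.
pose c := (C + 1) / 2.
have c0 : 0 <= c by rewrite /c; lra.
have s0 n : 0 <= series (fun k => b k / k.+1%:R) n.
  by rewrite /series/= sumr_ge0// => k _; rewrite divr_ge0.
have block (j : nat) : \sum_(2 ^ j <= k < 2 ^ j.+1) b k / k.+1%:R <= c * x ^+ j.
  pose mu := x ^- j.
  have mu0 : 0 < mu by rewrite invr_gt0 exprn_gt0.
  have j0 : (0 : R) < 2 ^+ j by rewrite exprn_gt0.
  apply: (@le_trans _ _ (\sum_(2 ^ j <= k < 2 ^ j.+1)
     (2 ^- j * 2^-1 * mu * b k ^+ 2 + 2 ^- j * 2^-1 * mu^-1))).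
    rewrite !big_nat; apply: ler_sum => k /andP[k1 _].
    apply: (@le_trans _ _ (2 ^- j * b k)).
      rewrite mulrC ler_wpM2r// lef_pV2 ?posrE ?ltr0n//.
      by rewrite -natrX ler_nat leqW.
    rewrite -!mulrA -mulrDr ler_wpM2l ?invr_ge0 ?(ltW j0)//.
    rewrite -mulrDr mulrC ler_pdivlMr//.
    have : 0 <= mu * (b k - mu^-1) ^+ 2 by rewrite mulr_ge0 ?sqr_ge0// ltW.
    have -> : mu * (b k - mu^-1) ^+ 2 = mu * b k ^+ 2 - 2 * b k + mu^-1.
      by field; rewrite gt_eqF.
    lra.
  rewrite big_split/= -mulr_sumr sumr_const_nat.
  have h1 : \sum_(2 ^ j <= k < 2 ^ j.+1) b k ^+ 2 <= C * (2 `^ d) ^+ j.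
    apply: le_trans (hb j); rewrite -(big_mkord predT (fun k => b k ^+ 2)).
    rewrite [leRHS](@big_cat_nat _ _ _ (2 ^ j))//=; last by rewrite leq_exp2l.
    by rewrite lerDr sumr_ge0// => k _; rewrite sqr_ge0.
  have h2 : (2 ^ j.+1 - 2 ^ j = 2 ^ j)%N by rewrite expnS mul2n -addnn addnK.
  rewrite h2 -[X in _ + X]mulr_natr natrX.
  apply: (@le_trans _ _ (2 ^- j * 2^-1 * mu * (C * (2 `^ d) ^+ j) +
     2 ^- j * 2^-1 * mu^-1 * 2 ^+ j)).
    by rewrite lerD2r ler_wpM2l// !mulr_ge0 ?invr_ge0 ?(ltW j0) ?exprn_ge0 ?(ltW x0).
  rewrite -x2 /c /mu !exprMn le_eqVlt; apply/orP; left; apply/eqP.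
  by field; rewrite !expf_neq0 ?gt_eqF.
exists (b 0%N + c / (1 - x)) => n.
have dy (J : nat) : series (fun k => b k / k.+1%:R) (2 ^ J)%N <= b 0%N + c * \sum_(j < J) x ^+ j.
  elim: J => [|J IH].
    by rewrite big_ord0 mulr0 addr0 expn0 /series/= big_nat1 divr1.
  rewrite /series/= (@big_cat_nat _ _ _ (2 ^ J))//=; last by rewrite leq_exp2l.
  by rewrite big_ord_recr/= mulrDr addrA lerD.
apply: (@le_trans _ _ (series (fun k => b k / k.+1%:R) (2 ^ n)%N)).
  rewrite /series/= (@big_cat_nat _ _ _ n 0 (2 ^ n))//=; last by rewrite ltnW// ltn_expl.
  by rewrite lerDl sumr_ge0// => k _; rewrite divr_ge0.
apply: (le_trans (dy n)); rewrite lerD2l ler_wpM2l//.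
by apply: geometric_sum_le => //; exact: ltW.
Qed.

Lemma bernoulli_le (t : R) n : 0 <= t -> t <= 1 -> 1 - n%:R * t <= (1 - t) ^+ n.
Proof.
move=> t0 t1; elim: n => [|n IH]; first by rewrite mul0r subr0 expr0.
rewrite exprS; apply: (@le_trans _ _ ((1 - t) * (1 - n%:R * t))).
  rewrite -addn1 natrD.
  have : 0 <= n%:R * t * t by rewrite !mulr_ge0.
  lra.
by rewrite ler_wpM2l// subr_ge0.
Qed.

Lemma AT_coef_summable p q a f : 2 < p -> 1 < q -> p^-1 + q^-1 < 1 ->
  power_series_on_disc a f -> (AT_int p q f < +oo)%E ->
  cvgn (series (fun k => cabs (a k) / k.+1%:R)).
Proof.
move=> p2 q1 pq af If.
have [d [C [d0 d1 C0 H]]] := roots_sq_mean p2 q1 pq af If.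
suff [M hM] : exists M, forall n, series (fun k => cabs (a k) / k.+1%:R) n <= M.
  by apply: nonneg_bounded_series_cvg hM => k; rewrite divr_ge0 ?cabs_ge0.
have C20 : 0 <= 2 * (2 * C + 2) * 8 `^ d by rewrite !mulr_ge0 ?powR_ge0//; lra.
apply: (dyadic_l2_summable d0 d1 C20) => [k|j]; first exact: cabs_ge0.
(* With this [t] and k < 2^(j + 1), Bernoulli's inequality gives (1 - t)^(2k) >= 1/2, so the
   dilation costs only a factor 2. *)
pose t : R := 8^-1 * 2 ^- j.
have t0 : 0 < t by rewrite mulr_gt0 ?invr_gt0 ?exprn_gt0.
have j1 : 2 ^- j <= 1 :> R by rewrite invf_le1 ?exprn_gt0// exprn_ege1// ler1n.
have t1 : t < 1 by rewrite /t; lra.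
have r0 : 0 < 1 - t by rewrite subr_gt0.
have r1 : 1 - t < 1 by lra.
have B := bessel_roots af r0 r1 (H t t0 t1) (2 ^ j.+1).
have td : t `^ (- d) = 8 `^ d * (2 `^ d) ^+ j.
  rewrite /t powRM ?invr_ge0 ?exprn_ge0// powR_2Xn opprK.
  by rewrite -(powR_inv1 (ler0n _ 8)) -powRrM mulN1r opprK.
have td1 : 1 <= t `^ (- d).
  by rewrite -(powRr0 t); apply: ger_powR; rewrite ?t0 ?(ltW t1)// oppr_le0.
apply: (@le_trans _ _ (2 * \sum_(k < 2 ^ j.+1) cabs (a k) ^+ 2 * (1 - t) ^+ (2 * k))).
  rewrite mulr_sumr; apply: ler_sum => k _.
  rewrite mulrCA ler_peMr ?sqr_ge0//.
  have : 2^-1 <= (1 - t) ^+ (2 * k).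
    apply: le_trans (bernoulli_le _ (ltW t0) (ltW t1)).
    have : (2 * k)%:R * t <= 2^-1.
      apply: (@le_trans _ _ ((2 * 2 ^ j.+1)%:R * t)).
        by rewrite ler_wpM2r ?(ltW t0)// ler_nat leq_mul2l ltnW ?orbT.
      rewrite /t natrM natrX exprS le_eqVlt; apply/orP; left; apply/eqP.
      by field; rewrite expf_neq0.
    lra.
  lra.
rewrite -!mulrA ler_pM2l// -td (le_trans B)//.
rewrite mulrDl; have : 2 * (C * t `^ (- d)) = 2 * C * t `^ (- d) by rewrite mulrA.
lra.
Qed.

End CoefficientSums.

(** * Integral representation of the Hilbert operator *)

Section HilbertIntegral.
Context {R : realType}.
Notation leb := (@lebesgue_measure R).
Implicit Types (a : (Cplx R)^nat) (f : Cplx R -> Cplx R) (z : Cplx R).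
Let I01 : set (measurableTypeR R) := `]0, 1[%classic.

Lemma integral_exprn01 (m : nat) :
  (\int[leb]_(x in `]0%R, 1%R[) (x ^+ m)%:E = (m.+1%:R^-1)%:E)%E.
Proof.
have m0 : (m.+1%:R : R) != 0 by rewrite pnatr_eq0.
have cX k : continuous (fun x : R => x ^+ k) by move=> x; exact: exprn_continuous.
pose F (x : R) := m.+1%:R^-1 * x ^+ m.+1.
have cF : continuous F.
  by move=> x; apply: cvgM; [exact: cvg_cst|exact: cX].
have dF (x : R) : is_derive x 1 F (x ^+ m).
  have d1 : is_derive x 1 (fun y : R => y ^+ m.+1) (m.+1%:R * x ^+ m).
    apply: DeriveDef; first exact: exprn_derivable.
    by rewrite -derive1E exp_derive1.
  apply: is_derive_eq (is_deriveZ m.+1%:R^-1 d1) _.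
  by rewrite /GRing.scale/= mulrA mulVf// mul1r.
have dF01 : derivable_oo_LRcontinuous F 0 1.
  split; first by move=> x _; have [] := dF x.
  - by apply: cvg_at_right_filter; exact: cF.
  - by apply: cvg_at_left_filter; exact: cF.
have := @continuous_FTC2 R (fun x => x ^+ m) F 0 1 ltr01 _ dF01 _.
rewrite /F expr1n mulr1 expr0n/= mulr0 sube0 => H.
rewrite -H; last 2 first.
  exact/continuous_subspaceT/cX.
  by move=> x _; rewrite derive1E; have [_ ->] := dF x.
apply/esym/integral_itv_bndoo/measurable_EFinP; exact: exprn_measurable.
Qed.

Lemma integral_poly01 (N : nat) (c : nat -> R) (e : nat -> nat) :
  (\int[leb]_(x in `]0%R, 1%R[) (\sum_(i < N) c i * x ^+ e i)%:E
    = (\sum_(i < N) c i / (e i).+1%:R)%:E)%E /\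
  leb.-integrable `]0%R, 1%R[ (fun x => (\sum_(i < N) c i * x ^+ e i)%:E).
Proof.
have m01 : measurable I01 by exact: measurable_itv.
have iX k : leb.-integrable I01 (fun x : R => (x ^+ k)%:E).
  apply/integrableP; split; first by apply/measurable_EFinP; exact: exprn_measurable.
  under eq_integral.
    move=> x /set_mem; rewrite /I01/= in_itv/= => /andP[x0 _].
    rewrite ger0_norm ?exprn_ge0 ?(ltW x0)//; over.
  by rewrite integral_exprn01 ltry.
have iZ i : leb.-integrable I01 (fun x : R => (c i * x ^+ e i)%:E).
  rewrite (_ : (fun x => _) = (fun x => (c i)%:E * (x ^+ e i)%:E)%E).
    exact: integrableZl.
  by apply/funext => x; rewrite EFinM.
split.
  under eq_integral do rewrite -sumEFin.
  rewrite integral_sum// -sumEFin; apply: eq_bigr => i _.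
  under eq_integral do rewrite EFinM.
  by rewrite integralZl// integral_exprn01.
rewrite (_ : (fun x => _) = (fun x => \sum_(i < N) (c i * x ^+ e i)%:E)%E).
  exact: integrable_sum.
by apply/funext => x; rewrite sumEFin.
Qed.

Lemma cmeas_restrict_real (a : (Cplx R)^nat) f : power_series_on_disc a f ->
  cmeas I01 (fun x : measurableTypeR R => f (x : R)%:C%C).
Proof.
move=> af; apply: (@cmeas_power_series _ _ _ _ a) => //.
  by split => /=; [exact: measurable_id|exact: measurable_cst].
by move=> x; rewrite /I01/= in_itv/= => /andP[x0 x1]; rewrite /disc/= cabs_real gtr0_norm.
Qed.

Variables (a : (Cplx R)^nat) (f : Cplx R -> Cplx R).
Hypothesis af : power_series_on_disc a f.
Hypothesis ha : cvgn (series (fun k => cabs (a k) / k.+1%:R)).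

Let disc_real (x : R) : I01 x -> disc (x%:C%C : Cplx R).
Proof.
by rewrite /I01/= in_itv/= => /andP[x0 x1]; rewrite /disc/= cabs_real gtr0_norm.
Qed.

Lemma hilbert_coef_term_le n k :
  cabs (a k / (n + k + 1)%:R) <= cabs (a k) / k.+1%:R.
Proof.
rewrite cabsM cabsV cabs_nat ler_wpM2l ?cabs_ge0//.
by rewrite lef_pV2 ?posrE ?ltr0n ?addn1// ler_nat ltnS leq_addl.
Qed.

Lemma hilbert_coef_cvg n : hilbert_coef_series a n @ \oo --> hilbert_coef a n.
Proof.
have : cvgn (hilbert_coef_series a n).
  apply: cabs_summable_cvg; apply: series_le_cvg ha => k.
  - exact: cabs_ge0.
  - by rewrite divr_ge0 ?cabs_ge0.
  - exact: hilbert_coef_term_le.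
by [].
Qed.

Lemma cabs_cvg_le (u : (Cplx R)^nat) (l : Cplx R) (X : \bar R) :
  u @ \oo --> l -> (forall n, ((cabs (u n))%:E <= X)%E) -> ((cabs l)%:E <= X)%E.
Proof.
move=> /cvg_cabs ul; case: X => [x| |] hX; last 2 first.
- exact: leey.
- by have := hX 0%N; rewrite leeNy_eq.
rewrite lee_fin -(cvg_lim _ ul)//; apply: limr_le; first exact: cvgP ul.
by apply: nearW => n; have := hX n; rewrite lee_fin.
Qed.

Lemma hilbert_coef_le n :
  cabs (hilbert_coef a n) <= limn (series (fun k => cabs (a k) / k.+1%:R)).
Proof.
rewrite -lee_fin; apply: (cabs_cvg_le (@hilbert_coef_cvg n)) => K.
rewrite lee_fin; apply: (@le_trans _ _ (series (fun k => cabs (a k) / k.+1%:R) K)).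
  rewrite /hilbert_coef_series /series/=; apply: (le_trans (cabs_sum _ _ _)).
  by apply: ler_sum => k _; exact: hilbert_coef_term_le.
apply: nondecreasing_cvgn_le => //.
apply/nondecreasing_seqP => m; rewrite /series/= big_nat_recr//= lerDl.
by rewrite divr_ge0 ?cabs_ge0.
Qed.

Lemma hilbert_coef_power_cvg z : disc z ->
  cvgn (series (fun n => hilbert_coef a n * z ^+ n)).
Proof.
move=> z1; apply: cabs_summable_cvg.
set H := limn (series (fun k => cabs (a k) / k.+1%:R)).
have H0 : 0 <= H by apply: le_trans (hilbert_coef_le 0); exact: cabs_ge0.
apply: (@series_le_cvg _ _ (geometric H (cabs z))).
- by move=> k; exact: cabs_ge0.
- by move=> k; rewrite /= mulr_ge0 ?exprn_ge0 ?cabs_ge0.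
- by move=> k; rewrite /= cabsM cabsX ler_wpM2r ?exprn_ge0 ?cabs_ge0 ?hilbert_coef_le.
- by apply: is_cvg_geometric_series; rewrite ger0_norm ?cabs_ge0.
Qed.

(** The identity 1/(n + k + 1) = int_0^1 x^(n + k) dx turns sums into integrals. Dominated
    convergence applies with the majorant B sum |a_k| x^k, whose integral is B sum |a_k| / (k + 1).
    Real parts are taken because integrals are real-valued. The identity serves both the upper bound
    and the lower bound for test functions. *)
Lemma hilbert_poly_integral (N : nat) (d : nat -> Cplx R) :
  (\int[leb]_(x in `]0%R, 1%R[)
     (complex.Re ((\sum_(n < N) d n * x%:C%C ^+ n) * f x%:C%C))%:E
   = (complex.Re (\sum_(n < N) d n * hilbert_coef a n))%:E)%E.
Proof.
have m01 : measurable I01 by exact: measurable_itv.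
pose Q (x : R) : Cplx R := \sum_(n < N) d n * x%:C%C ^+ n.
pose S K (x : R) : Cplx R := series (fun k => a k * x%:C%C ^+ k) K.
pose B := \sum_(n < N) cabs (d n).
have B0 : 0 <= B by apply: sumr_ge0 => n _; exact: cabs_ge0.
have QB x : I01 x -> cabs (Q x) <= B.
  rewrite /I01/= in_itv/= => /andP[x0 x1]; apply: (le_trans (cabs_sum _ _ _)).
  apply: ler_sum => n _; rewrite cabsM cabsX cabs_real gtr0_norm//.
  by rewrite ler_piMr ?cabs_ge0// exprn_ile1// ltW.
pose g (K : nat) (x : measurableTypeR R) : \bar R := (complex.Re (Q x * S K x))%:E.
pose G (x : measurableTypeR R) : \bar R :=
  (\sum_(0 <= k <oo) (B * cabs (a k) * (x : R) ^+ k)%:E)%E.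
have Gk0 x k : I01 x -> (0 <= (B * cabs (a k) * (x : R) ^+ k)%:E)%E.
  rewrite /I01/= in_itv/= => /andP[x0 x1].
  by rewrite lee_fin !mulr_ge0 ?cabs_ge0 ?exprn_ge0// ltW.
have cid : cmeas I01 (fun x : measurableTypeR R => (x : R)%:C%C).
  by split => /=; [exact: measurable_id|exact: measurable_cst].
have cQ : cmeas I01 Q.
  rewrite /Q (_ : (fun x => _) = (fun x => series (fun k => d k * (x : R)%:C%C ^+ k) N)).
    exact: cmeas_series.
  by apply/funext => x; rewrite /series/= big_mkord.
have ReZ (w : Cplx R) (y : R) : complex.Re (w * y%:C%C) = complex.Re w * y.
  by rewrite ReM/= mulr0 subr0.
have gE K (x : R) : g K x = (\sum_(n < N) (\sum_(k < K) complex.Re (d n * a k) * x ^+ (n + k))%:E)%E.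
  rewrite sumEFin /g /Q /S /series/= big_mkord mulr_suml Re_sum; congr EFin.
  apply: eq_bigr => n _; rewrite mulr_sumr Re_sum; apply: eq_bigr => k _.
  by rewrite -ReZ mulrACA -exprD rmorphXn.
have mg K : measurable_fun I01 (g K).
  apply/measurable_EFinP.
  have /(_ K) cS : forall K, cmeas I01 (S K) by move=> K'; exact: cmeas_series.
  exact: (cmeasM cQ cS).1.
have Ig K : (\int[leb]_(x in I01) g K x =
   (complex.Re (\sum_(n < N) d n * hilbert_coef_series a n K))%:E)%E.
  under eq_integral do rewrite gE.
  rewrite integral_sum//; last first.
    by move=> n; have [] := integral_poly01 K (fun k => complex.Re (d n * a k)) (addn n).
  rewrite Re_sum -sumEFin; apply: eq_bigr => n _.
  have [-> _] := integral_poly01 K (fun k => complex.Re (d n * a k)) (addn n).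
  rewrite /hilbert_coef_series /series/= big_mkord mulr_sumr Re_sum; congr EFin.
  apply: eq_bigr => k _; rewrite mulrA addn1 -ReZ; congr (complex.Re (_ * _)).
  by rewrite fmorphV rmorph_nat.
have cvgI : (fun K => (\int[leb]_(x in I01) g K x)%E) @ \oo -->
    (complex.Re (\sum_(n < N) d n * hilbert_coef a n))%:E.
  rewrite (_ : (fun K => _) = EFin \o (fun K => \sum_(n < N)
      complex.Re (d n * hilbert_coef_series a n K))); last first.
    by apply/funext => K; rewrite Ig Re_sum.
  rewrite Re_sum; apply: cvg_EFin; first exact: nearW.
  rewrite (_ : fine \o _ = (fun K => \sum_(n < N)
      complex.Re (d n * hilbert_coef_series a n K)))//.
  have cvgn_ n : (fun K => complex.Re (d n * hilbert_coef_series a n K)) @ \oo -->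
      complex.Re (d n * hilbert_coef a n).
    rewrite ReM; under eq_fun do rewrite ReM.
    apply: cvgB; apply: cvgM; try exact: cvg_cst.
      exact: cvg_Re (@hilbert_coef_cvg n).
    exact: cvg_Im (@hilbert_coef_cvg n).
  elim: (N) => [|m IH].
    by rewrite big_ord0; under eq_fun do rewrite big_ord0; exact: cvg_cst.
  rewrite big_ord_recr/=; under eq_fun do rewrite big_ord_recr/=.
  exact: cvgD.
have mG k : measurable_fun I01 (fun x : measurableTypeR R => (B * cabs (a k) * (x : R) ^+ k)%:E).
  by apply/measurable_EFinP; apply: measurable_funM => //; exact: exprn_measurable.
have iG : leb.-integrable I01 G.
  apply/integrableP; split.
    rewrite /G; apply: ge0_emeasurable_sum => // k x Ix _; exact: Gk0.
  under eq_integral.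
    move=> x /set_mem Ix; rewrite gee0_abs; last first.
      by apply: nneseries_ge0 => k _ _; exact: Gk0.
    over.
  rewrite integral_nneseries//; last by move=> k x Ix; exact: Gk0.
  have e k : (\int[leb]_(x in I01) (B * cabs (a k) * (x : R) ^+ k)%:E =
      (B%:E * (cabs (a k) / k.+1%:R)%:E))%E.
    under eq_integral do rewrite EFinM.
    rewrite ge0_integralZl//.
    - by rewrite integral_exprn01 -!EFinM mulrA.
    - by apply/measurable_EFinP; exact: exprn_measurable.
    - move=> x; rewrite /I01/= in_itv/= => /andP[x0 _].
      by rewrite lee_fin exprn_ge0// ltW.
    - by rewrite lee_fin mulr_ge0 ?cabs_ge0.
  under eq_eseriesr do rewrite e.
  rewrite nneseriesZl; last by move=> k _; rewrite lee_fin divr_ge0 ?cabs_ge0.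
  rewrite lte_mul_pinfty ?lee_fin//.
  have -> : (\sum_(0 <= k <oo) (cabs (a k) / k.+1%:R)%:E =
     (limn (series (fun k => cabs (a k) / k.+1%:R)))%:E)%E.
    rewrite -EFin_lim//; congr (limn _); apply/funext => n.
    by rewrite /= /series/= sumEFin.
  by rewrite ltry.
have [_ _ cvgD'] := @dominated_convergence _ _ _ leb I01 m01 g
  (fun x : measurableTypeR R => (complex.Re (Q x * f (x : R)%:C%C))%:E) G mg
  ltac:(apply/measurable_EFinP; exact: (cmeasM cQ (cmeas_restrict_real af)).1)
  ltac:(apply: aeW => x Ix; apply: cvg_EFin; [exact: nearW|]; apply: cvg_Re;
        apply: cvgMr; exact: (af (disc_real Ix)))
  iG
  ltac:(apply: aeW => x n Ix; apply: le_trans (nneseries_lim_ge n _);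
    [rewrite /g abse_EFin sumEFin lee_fin; apply: (le_trans (cabs_ge_Re _));
     rewrite cabsM (le_trans (ler_wpM2r (cabs_ge0 _) (QB x Ix)))//;
     under eq_bigr do rewrite -mulrA; rewrite -mulr_sumr ler_wpM2l//;
     apply: (le_trans (cabs_sum _ _ _)); apply: ler_sum => k _;
     rewrite cabsM cabsX cabs_real ger0_norm//;
     by move: Ix; rewrite /I01/= in_itv/= => /andP[/ltW]
    | by move=> k _ _; exact: Gk0]).
exact: (cvg_unique _ cvgD' cvgI).
Qed.

End HilbertIntegral.

(** * Kernel estimate and Schur test *)

Section HilbertBound.
Context {R : realType}.
Notation leb := (@lebesgue_measure R).
Implicit Types (a : (Cplx R)^nat) (f : Cplx R -> Cplx R) (z : Cplx R).

Lemma measurable_I01 : measurable (`]0, 1[%classic : set (measurableTypeR R)).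
Proof. exact: measurable_itv. Qed.

Lemma hilbert_poly_bound a f (N : nat) (d : nat -> Cplx R) :
  power_series_on_disc a f -> cvgn (series (fun k => cabs (a k) / k.+1%:R)) ->
  ((cabs (\sum_(n < N) d n * hilbert_coef a n))%:E <=
   \int[leb]_(x in `]0%R, 1%R[)
     (cabs (\sum_(n < N) d n * x%:C%C ^+ n) * cabs (f x%:C%C))%:E)%E.
Proof.
move=> af ha; set w := \sum_(n < N) _ * hilbert_coef a _.
have [w0|w0] := eqVneq (cabs w) 0.
  by rewrite w0; apply: integral_ge0 => x _; rewrite lee_fin mulr_ge0 ?cabs_ge0.
(* The unimodular factor [l] turns [w] into its modulus, so the identity for real parts bounds the
   full modulus. *)
pose l : Cplx R := (cabs w)^-1%:C%C * w^*%C.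
have lw : l * w = (cabs w)%:C%C.
  by rewrite /l -mulrA [_ * w]mulrC -sqr_cabs_conj -rmorphM/= expr2 mulKf.
have l1 : cabs l = 1.
  have h : cabs l * cabs w = cabs w.
    by rewrite -cabsM lw cabs_real ger0_norm// cabs_ge0.
  by apply: (mulIf w0); rewrite h mul1r.
have e1 : \sum_(n < N) (l * d n) * hilbert_coef a n = (cabs w)%:C%C.
  by rewrite -lw /w mulr_sumr; apply: eq_bigr => n _; rewrite mulrA.
have := hilbert_poly_integral af ha N (fun n => l * d n); rewrite e1/= => H.
have mg : measurable_fun (`]0, 1[%classic : set (measurableTypeR R))
  (fun x : measurableTypeR R => (complex.Re ((\sum_(n < N) l * d n * (x : R)%:C%C ^+ n) * f (x : R)%:C%C))%:E).
  apply/measurable_EFinP; apply: (cmeasM _ (cmeas_restrict_real af)).1.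
  rewrite (_ : (fun x => _) = (fun x : measurableTypeR R =>
      series (fun k => (l * d k) * (x : R)%:C%C ^+ k) N)).
    by apply: cmeas_series; split => /=; [exact: measurable_id|exact: measurable_cst].
  by apply/funext => x; rewrite /series/= big_mkord.
have := le_abse_integral leb measurable_I01 mg; rewrite H abse_EFin ger0_norm ?cabs_ge0//.
move=> /le_trans; apply; apply: ge0_le_integral_nonmeas => x _; first exact: abse_ge0.
rewrite abse_EFin lee_fin (le_trans (cabs_ge_Re _))// cabsM ler_wpM2r ?cabs_ge0//.
have -> : \sum_(n < N) l * d n * x%:C%C ^+ n = l * \sum_(n < N) d n * x%:C%C ^+ n.
  by rewrite mulr_sumr; apply: eq_bigr => n _; rewrite mulrA.
by rewrite cabsM l1 mul1r.
Qed.

(** Put A = |1 - tz|. Then 1 - t <= A, and |1 - z| <= A + (1 - t) <= 2A. *)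
Lemma cabs_one_sub_real z (t : R) : disc z -> 0 < t -> t < 1 ->
  (1 - t) + cabs (1 - z) <= 3 * cabs (1 - t%:C%C * z).
Proof.
move=> z1 t0 t1; rewrite /disc/= in z1.
have h1 : 1 - t <= cabs (1 - t%:C%C * z).
  have := cabsD (1 - t%:C%C * z) (t%:C%C * z); rewrite subrK cabs1 cabsM cabs_real gtr0_norm//.
  have : t * cabs z <= t by rewrite ler_piMr// ltW.
  lra.
have h2 : cabs (1 - z) <= cabs (1 - t%:C%C * z) + (1 - t).
  have -> : 1 - z = (1 - t%:C%C * z) + (t - 1)%:C%C * z by rewrite rmorphB/= rmorph1; ring.
  apply: (le_trans (cabsD _ _)); rewrite lerD2l cabsM cabs_real distrC.
  rewrite ger0_norm; last by rewrite subr_ge0 ltW.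
  by apply: ler_piMr; [rewrite subr_ge0 ltW|exact: ltW].
lra.
Qed.

(** The kernel of a partial sum is a geometric sum (1 - (xz)^N) / (1 - xz). Its numerator is at most
    2 and its denominator at least a third of (1 - x) + |1 - z|, which gives 6 uniformly in [N]. *)
Lemma hilbert_bound a f z : disc z ->
  power_series_on_disc a f -> cvgn (series (fun k => cabs (a k) / k.+1%:R)) ->
  ((cabs (limn (series (fun n => hilbert_coef a n * z ^+ n))))%:E <=
   \int[leb]_(x in `]0%R, 1%R[)
     (6%:E * (cabs (f x%:C%C) / ((1 - x) + cabs (1 - z)))%:E))%E.
Proof.
move=> z1 af ha; apply: (cabs_cvg_le (hilbert_coef_power_cvg ha z1)) => N.
have -> : series (fun n => hilbert_coef a n * z ^+ n) N = \sum_(n < N) z ^+ n * hilbert_coef a n.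
  by rewrite /series/= big_mkord; apply: eq_bigr => n _; rewrite mulrC.
apply: (le_trans (hilbert_poly_bound N (fun n => z ^+ n) af ha)).
apply: ge0_le_integral_nonmeas => x /=; rewrite in_itv/= => /andP[x0 x1].
  by rewrite lee_fin mulr_ge0 ?cabs_ge0.
rewrite -EFinM lee_fin mulrCA mulrC ler_wpM2l ?cabs_ge0//.
under eq_bigr do rewrite -exprMn mulrC.
have h := cabs_one_sub_real z1 x0 x1.
have pos : 0 < (1 - x) + cabs (1 - z) by rewrite ltr_wpDr ?cabs_ge0 ?subr_gt0.
rewrite ler_pdivlMr//.
apply: (@le_trans _ _ (cabs (\sum_(n < N) (x%:C%C * z) ^+ n) * (3 * cabs (1 - x%:C%C * z)))).
  by rewrite ler_wpM2l ?cabs_ge0.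
rewrite mulrCA -cabsM mulrC -[X in cabs X * _]opprK -[- (_ * _)]mulrN opprB.
rewrite [_ * (_ - 1)]mulrC -subrX1 cabsN.
have : cabs ((x%:C%C * z) ^+ N - 1) <= 2.
  apply: (le_trans (cabsB _ _)); rewrite cabs1 cabsX cabsM cabs_real gtr0_norm//.
  have : (x * cabs z) ^+ N <= 1.
    rewrite exprn_ile1 ?mulr_ge0 ?cabs_ge0 ?(ltW x0)//.
    by rewrite mulr_ile1 ?cabs_ge0 ?(ltW x0) ?(ltW x1)// ltW.
  lra.
lra.
Qed.

(* The function h is either below the threshold [L * r `^ (- k)] or dominated
   by its q-th power; with [L] optimized after integration this replaces
   Hoelder's inequality. *)
Lemma schur_split (L r h k q : R) : 0 < L -> 0 < r -> 0 <= h -> 1 < q ->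
  h <= L * r `^ (- k) + L `^ (1 - q) * (h `^ q * r `^ (k * (q - 1))).
Proof.
move=> L0 r0 h0 q1; pose u := L * r `^ (- k).
have u0 : 0 < u by rewrite mulr_gt0 ?powR_gt0.
have [hu|hu] := leP h u.
  by rewrite (le_trans hu)// lerDl !mulr_ge0 ?powR_ge0.
have h1 : 0 < h by exact: lt_trans hu.
rewrite -[leLHS]add0r lerD ?(ltW u0)//.
have -> : L `^ (1 - q) * (h `^ q * r `^ (k * (q - 1))) = h `^ q * u `^ (1 - q).
  rewrite /u powRM ?powR_ge0 ?(ltW L0)// -powRrM mulrCA; congr (_ * (_ * _ `^ _)); ring.
have -> : h = h `^ q * h `^ (1 - q) by rewrite -gt0_powRD// addrC subrK powRr1// ltW.
rewrite -[in leRHS](_ : h = h `^ q * h `^ (1 - q)); last first.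
  by rewrite -gt0_powRD// addrC subrK powRr1// ltW.
rewrite ler_wpM2l ?powR_ge0// powR_le_neg ?(ltW hu)//; lra.
Qed.

Lemma lebesgue_near_one (r : R) : 0 < r ->
  (leb ((`]0%R, 1%R[%classic : set (measurableTypeR R)) `&` [set x : measurableTypeR R | (1 - (x : R) < r)%R]) <= (1 * r `^ 1)%:E)%E.
Proof.
move=> r0; rewrite mul1r powRr1 ?(ltW r0)//.
apply: (@le_trans _ _ (leb (`](1 - r)%R, 1%R[%classic : set (measurableTypeR R)))).
  apply: le_measure; rewrite ?inE.
  - apply: measurableI; first exact: measurable_I01.
    rewrite -[X in measurable X]setTI.
    apply: (@measurable_fun_ltr _ (measurableTypeR R) _ setT (fun x => 1 - x) (cst r)) => //.
    exact: measurable_funB.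
  - exact: measurable_itv.
  - by move=> x [/=]; rewrite !in_itv/= => /andP[x0 x1] xr; rewrite x1 andbT; lra.
rewrite lebesgue_measure_itv/= lte_fin; case: ifPn => h; last by rewrite lee_fin ltW.
by rewrite -EFinD lee_fin; lra.
Qed.

Lemma measurable_rho : measurable_fun [set: measurableTypeR R] (fun x : measurableTypeR R => (1 - x : R)).
Proof. exact: measurable_funB. Qed.

(** The splitting exponent k = al/(q - 1) makes the weight in the q-th power term (1 - t)^al. The
    condition on [al] says k < 1, so that the other term, the integral of (1 - t)^(-k) / ((1 - t) +
    x), is of order x^(-k). *)
Lemma schur_test (q al : R) : 1 < q -> 0 < al -> al < q - 1 ->
  exists2 C : R, 0 <= C & forall (h : R -> R) (x K : R),
    measurable_fun (`]0, 1[%classic : set (measurableTypeR R)) (h : measurableTypeR R -> R) ->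
    (forall t, 0 <= h t) -> 0 < x -> 0 <= K ->
    (\int[leb]_(t in `]0%R, 1%R[) (h t `^ q * (1 - t) `^ al / ((1 - t) + x))%:E = K%:E)%E ->
    exists F : R, [/\ 0 <= F,
      (\int[leb]_(t in `]0%R, 1%R[) (h t / ((1 - t) + x))%:E = F%:E)%E &
      F `^ q <= C * (x `^ (- al) * K)].
Proof.
move=> q1 al0 alq.
pose k := al / (q - 1).
have q10 : 0 < q - 1 by rewrite subr_gt0.
have q0 : 0 < q by exact: lt_trans q1.
have k0 : 0 < k by rewrite divr_gt0.
have k1 : k < 1 by rewrite ltr_pdivrMr// mul1r.
have kq : k * (q - 1) = al by rewrite divfK// gt_eqF.
have [C1 C10 hC1] := @singular_power_integral R 1 1 k 1 ler01 k0 ler01 k1 ltac:(lra).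
pose c := C1 + 1.
have c0 : 0 < c by rewrite /c; lra.
exists (2 * (2 * c) `^ (q - 1)); first by rewrite mulr_ge0 ?powR_ge0.
move=> h x K mh h0 x0 K0 hK.
pose I : set (measurableTypeR R) := `]0, 1[%classic.
have rho t : I t -> 0 < 1 - t by rewrite /I/= in_itv/= subr_gt0 => /andP[].
have P1 : (\int[leb]_(t in I) ((1 - t) `^ (- k) / ((1 - t) + x))%:E <= (c * x `^ (- k))%:E)%E.
  have := hC1 _ _ leb I (fun t : measurableTypeR R => (1 - t : R)) measurable_I01 measurable_rho
    (fun t It => ltW (rho t It)) lebesgue_near_one x x0.
  have -> : 1 - k - 1 = - k by ring.
  move=> H; apply: (le_trans _ (le_trans H _)).
    apply: ge0_le_integral_nonmeas => t It.
      by rewrite lee_fin divr_ge0 ?powR_ge0// addr_ge0 ?(ltW x0)// ltW// rho.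
    by rewrite lee_fin [(1 - t) + x]addrC powR_inv1// addr_ge0 ?(ltW x0)// ltW// rho.
  by rewrite lee_fin ler_wpM2r ?powR_ge0// /c lerDl.
have minv : measurable_fun I (fun t : measurableTypeR R => ((1 - t) + x)^-1).
  apply: (eq_measurable_fun (fun t : measurableTypeR R => ((1 - t) + x) `^ (-1))).
    by move=> t /set_mem /rho tr; rewrite powR_inv1//; lra.
  apply: (measurableT_comp (measurable_powR _)); apply: measurable_funD => //.
  exact: measurable_funTS measurable_rho.
have mint (g : R -> R) : measurable_fun I (g : measurableTypeR R -> R) ->
    measurable_fun I (fun t : measurableTypeR R => (g t / ((1 - t) + x))%:E).
  by move=> mg; apply/measurable_EFinP; exact: measurable_funM.
have split_le (L : R) : 0 < L ->
    (\int[leb]_(t in I) (h t / ((1 - t) + x))%:E <= (L * (c * x `^ (- k)) + L `^ (1 - q) * K)%:E)%E.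
  move=> L0.
  have pos t : I t -> 0 < (1 - t) + x by move=> /rho; lra.
  apply: (@le_trans _ _ (\int[leb]_(t in I) (L%:E * ((1 - t) `^ (- k) / ((1 - t) + x))%:E +
     (L `^ (1 - q))%:E * (h t `^ q * (1 - t) `^ al / ((1 - t) + x))%:E))%E).
    apply: ge0_le_integral_nonmeas => t It.
      by rewrite lee_fin divr_ge0// ltW// pos.
    rewrite -!EFinM -EFinD lee_fin !mulrA -mulrDl ler_wpM2r//.
      by rewrite invr_ge0 ltW// pos.
    by have := schur_split k L0 (rho t It) (h0 t) q1; rewrite kq !mulrA.
  have m1 : measurable_fun I (fun t : measurableTypeR R => ((1 - t) `^ (- k) / ((1 - t) + x))%:E).
    apply: mint; apply: (measurableT_comp (measurable_powR _)).
    exact: measurable_funTS measurable_rho.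
  have m2 : measurable_fun I (fun t : measurableTypeR R => (h t `^ q * (1 - t) `^ al / ((1 - t) + x))%:E).
    apply: mint; apply: measurable_funM; apply: (measurableT_comp (measurable_powR _)) => //.
    exact: measurable_funTS measurable_rho.
  have n1 t : I t -> (0 <= ((1 - t) `^ (- k) / ((1 - t) + x))%:E)%E.
    by move=> /pos tp; rewrite lee_fin divr_ge0 ?powR_ge0// ltW.
  have n2 t : I t -> (0 <= (h t `^ q * (1 - t) `^ al / ((1 - t) + x))%:E)%E.
    by move=> /pos tp; rewrite lee_fin divr_ge0 ?mulr_ge0 ?powR_ge0// ltW.
  have Lq0 : 0 <= L `^ (1 - q) by exact: powR_ge0.
  rewrite ge0_integralD//; first last.
  - by apply: measurable_funeM.
  - by move=> t It; apply: mule_ge0 => //; exact: n2.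
  - by apply: measurable_funeM.
  - by move=> t It; apply: mule_ge0; [rewrite lee_fin ltW|exact: n1].
  - exact: measurable_I01.
  rewrite !ge0_integralZl ?lee_fin ?(ltW L0)//; do ?exact: measurable_I01.
  rewrite hK -EFinM EFinD; apply: leeD => //.
  by rewrite EFinM lee_wpmul2l// lee_fin ltW.
have F0 : (0 <= \int[leb]_(t in I) (h t / ((1 - t) + x))%:E)%E.
  apply: integral_ge0 => t /rho tr; rewrite lee_fin divr_ge0//; lra.
have Ffin : (\int[leb]_(t in I) (h t / ((1 - t) + x))%:E)%E \is a fin_num.
  by rewrite ge0_fin_numE// (le_lt_trans (split_le 1 ltr01))// ltry.
pose F := fine (\int[leb]_(t in I) (h t / ((1 - t) + x))%:E)%E.
have FE : (\int[leb]_(t in I) (h t / ((1 - t) + x))%:E)%E = F%:E by rewrite fineK.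
exists F; split => //; first exact: fine_ge0.
have F1 : 0 <= F by exact: fine_ge0.
have [->|Fn] := eqVneq F 0.
  by rewrite powR0 ?gt_eqF// !mulr_ge0 ?powR_ge0.
have Fp : 0 < F by rewrite lt_neqAle eq_sym Fn.
(* With this choice the first term of the splitting is exactly F/2 and is absorbed on the left;
   absorption is legitimate since [F] is finite, by the splitting with L = 1. *)
pose L := F * x `^ k / (2 * c).
have xk : 0 < x `^ k by rewrite powR_gt0.
have L0 : 0 < L by rewrite !mulr_gt0 ?invr_gt0 ?mulr_gt0.
have := split_le L L0; rewrite FE lee_fin.
have -> : L * (c * x `^ (- k)) = F / 2.
  rewrite /L powRN; move: xk; set y := x `^ k => y0; field.
  by rewrite !gt_eqF.
move=> H.
have H2 : F / 2 <= L `^ (1 - q) * K by lra.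
have Lq : L `^ (q - 1) * L `^ (1 - q) = 1.
  by rewrite -gt0_powRD// (_ : q - 1 + (1 - q) = 0) ?powRr0//; ring.
have H3 : L `^ (q - 1) * (F / 2) <= K.
  apply: (@le_trans _ _ (L `^ (q - 1) * (L `^ (1 - q) * K))).
    by rewrite ler_wpM2l ?powR_ge0.
  by rewrite mulrA Lq mul1r.
have e1 : L `^ (q - 1) * (F / 2) = F `^ q * x `^ al * (2 * (2 * c) `^ (q - 1))^-1.
  have d0 : 0 < 2 * c by rewrite mulr_gt0.
  move: d0; rewrite /L; set d := 2 * c => d0.
  have dE : (d^-1) `^ (q - 1) = (d `^ (q - 1))^-1.
    by rewrite -powR_inv1 ?(ltW d0)// -powRrM mulN1r powRN.
  have Fx : 0 <= F * x `^ k by rewrite mulr_ge0// ltW.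
  have di : 0 <= d^-1 by rewrite invr_ge0 ltW.
  rewrite (powRM (q - 1) Fx di) (powRM (q - 1) F1 (ltW xk)) dE -powRrM kq.
  by rewrite -(mulr_powRB1 F1 q0) invfM; ring.
rewrite e1 ler_pdivrMr ?mulr_gt0 ?powR_gt0 ?mulr_gt0// in H3.
have X0 : 0 < x `^ al by rewrite powR_gt0.
rewrite powRN -(ler_pM2l X0) mulrC (le_trans H3)//.
move: X0; set X := x `^ al; set W := (2 * c) `^ _ => X0.
rewrite le_eqVlt; apply/orP; left; apply/eqP; field.
by rewrite gt_eqF.
Qed.

End HilbertBound.

(** * Upper bounds and boundedness *)

Section ConeUpper.
Context {R : realType}.
Notation leb := (@lebesgue_measure R).
Notation RR := (measurableTypeR R * measurableTypeR R)%type.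
Implicit Types (f : Cplx R -> Cplx R) (z xi : Cplx R) (p q : R).

(** On a segment |z - xi| is at most 3/2 (1 - t) while 1 - |z| is at least (1 - t)/2; on the central
    disc |z - xi| < 3/2 and 1 - |z| > 1/2. *)
Lemma Gamma_half_dist xi z : cabs xi = 1 -> Gamma_half xi z ->
  cabs (z - xi) <= 3 * (1 - cabs z).
Proof.
move=> xi1 [[_ z2]|[w [t [w2 t0 t1 ->]]]].
  by have := cabsB z xi; rewrite xi1; lra.
have -> : (1 - t)%:C%C * w + t%:C%C * xi - xi = (1 - t)%:C%C * (w - xi).
  by rewrite rmorphB/= rmorph1; ring.
rewrite cabsM cabs_real ger0_norm ?subr_ge0 ?(ltW t1)//.
have h1 : (1 - t) * cabs (w - xi) <= (1 - t) * (3 / 2).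
  by rewrite ler_wpM2l ?subr_ge0 ?(ltW t1)//; have := cabsB w xi; rewrite xi1; lra.
have h2 : cabs ((1 - t)%:C%C * w + t%:C%C * xi) <= (1 - t) * cabs w + t.
  rewrite (le_trans (cabsD _ _))// !cabsM !cabs_real xi1 mulr1.
  by rewrite !ger0_norm ?subr_ge0// ltW.
have h3 : (1 - t) * cabs w <= (1 - t) * 2^-1.
  by rewrite ler_wpM2l ?subr_ge0 ?ltW.
lra.
Qed.

Lemma dA_ball_le xi (r : R) : 0 < r ->
  (@dA R (setT `&` [set w : RR | (cabs (cw w - xi) < r)%R]) <= (4 * r `^ 2)%:E)%E.
Proof.
move=> r0; rewrite setTI.
pose J (c : R) : set (measurableTypeR R) := `[(c - r)%R, (c + r)%R]%classic.
have muJ c : leb (J c) = (2 * r)%:E.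
  rewrite lebesgue_measure_itv/= lte_fin ifT; last by lra.
  by rewrite -EFinD; congr EFin; ring.
have mJ c : measurable (J c) by exact: measurable_itv.
have sub : [set w : RR | cabs (cw w - xi) < r] `<=` J (complex.Re xi) `*` J (complex.Im xi).
  move=> w /= h; have := cabs_ge_Re (cw w - xi); have := cabs_ge_Im (cw w - xi).
  rewrite ReD ImD ReN ImN /J/= !in_itv/= => h1 h2.
  have := le_lt_trans h1 h; have := le_lt_trans h2 h; rewrite !ltr_norml => /andP[a1 a2] /andP[b1 b2].
  by split; apply/andP; split; lra.
have le1 : ((leb \x leb) [set w : RR | (cabs (cw w - xi) < r)%R] <= (4 * r ^+ 2)%:E)%E.
  have -> : (4 * r ^+ 2)%:E = ((2 * r)%:E * (2 * r)%:E)%E.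
    by rewrite -EFinM; congr EFin; ring.
  rewrite -{1}(muJ (complex.Re xi)) -(muJ (complex.Im xi)).
  have := product_measure1E leb leb (mJ (complex.Re xi)) (mJ (complex.Im xi)) => <-.
  apply: le_measure; rewrite ?inE//; first exact: measurable_cabs_lt.
  exact: measurableX.
rewrite powR_mulrn ?(ltW r0)//.
rewrite /dA /mscale/=.
apply: le_trans le1; rewrite -[leRHS]mul1e; apply: lee_wpmul2r => //.
by rewrite lee_fin invf_le1 ?pi_gt0// (le_trans _ (pi_ge2 R))// ler1n.
Qed.

(** With D = |1 - xi|, a point z of the cone satisfies D <= |1 - z| + |z - xi| and |z - xi| <= 3 |1
    - z|, hence D + |z - xi| <= 7 |1 - z|. The cone integral then becomes the model integral with n
    = 2, g = 1 and b = al p/q, and q/p < al is the condition b > 1. The function [K] stays abstract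
    so that images H f and test functions are both covered. *)
Lemma cone_upper p q (al : R) : 0 < p -> 0 < q -> q / p < al ->
  exists2 C : R, 0 <= C & forall (F : Cplx R -> Cplx R) (K : R -> R) (theta : R),
    (forall z, disc z -> cabs (F z) `^ q <= cabs (1 - z) `^ (- al) * K (cabs (1 - z))) ->
    (forall x y, 0 < x -> x <= y -> K y <= K x) -> (forall x, 0 < x -> 0 <= K x) ->
    0 < cabs (1 - circle_pt theta) ->
    (cone_integral p F (circle_pt theta) `^ (q / p) <=
     (C * (K (cabs (1 - circle_pt theta) / 7)%R *
           (cabs (1 - circle_pt theta) / 7) `^ (q / p - al)))%:E)%E.
Proof.
move=> p0 q0 qal; pose b := al * (p / q).
have b1 : 1 < b.
  by rewrite /b -ltr_pdivrMr ?divr_gt0// invf_div mul1r.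
have b0 : 0 <= b by rewrite ltW// (lt_trans _ b1).
have [C C0 hC] := @singular_power_integral R 4 2 1 b ltac:(lra) ltac:(lra) b0 ltac:(lra) ltac:(lra).
have qp0 : 0 <= q / p by rewrite divr_ge0 ?ltW.
exists ((3 * C * 7 `^ (1 - b) * 7 `^ b) `^ (q / p)); first exact: powR_ge0.
move=> F K theta hF Kmono K0 D0; set xi := circle_pt theta in D0 *.
set D := cabs (1 - xi) in D0 *.
have xi1 : cabs xi = 1 by exact: cabs_circle_pt.
have D7 : 0 < D / 7 by rewrite divr_gt0.
have geo z : Gamma_half xi z -> [/\ cabs z < 1, 0 < cabs (z - xi),
    cabs (z - xi) <= 3 * (1 - cabs z) & D + cabs (z - xi) <= 7 * cabs (1 - z)].
  move=> Gz; have z1 := Gamma_half_disc xi1 Gz; have zx := Gamma_half_dist xi1 Gz.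
  have h1 : 1 - cabs z <= cabs (1 - z).
    by have := cabsD (1 - z) z; rewrite subrK cabs1; lra.
  split => //.
    have := cabsD (xi - z) z; rewrite subrK xi1 cabs_distC; lra.
  have : D <= cabs (1 - z) + cabs (z - xi).
    by rewrite /D -[1 - xi](_ : (1 - z) + (z - xi) = _) ?cabsD// addrA subrK.
  lra.
pose k := K (D / 7) `^ (p / q).
have k0 : 0 <= k by exact: powR_ge0.
pose c := 3 * 7 `^ b * k.
have c0 : 0 <= c by rewrite !mulr_ge0 ?powR_ge0.
have pt z : Gamma_half xi z ->
  cabs (F z) `^ p / (1 - cabs z ^+ 2) <= c * (cabs (z - xi) `^ (-1) * (D + cabs (z - xi)) `^ (- b)).
  move=> /geo[z1 z0 z3 z7].
  have w0 : 0 < cabs (1 - z) by have := cabs_ge0 (z - xi); lra.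
  have hK : K (cabs (1 - z)) <= K (D / 7).
    by apply: Kmono => //; rewrite ler_pdivrMr// mulrC; have := cabs_ge0 (z - xi); lra.
  have e1 : cabs (F z) `^ p = (cabs (F z) `^ q) `^ (p / q).
    by rewrite -powRrM mulrCA divff ?mulr1// gt_eqF.
  have h1 : cabs (F z) `^ p <= cabs (1 - z) `^ (- b) * k.
    rewrite e1; apply: (@le_trans _ _ ((cabs (1 - z) `^ (- al) * K (D / 7)) `^ (p / q))).
      rewrite ge0_ler_powR ?divr_ge0 ?(ltW p0) ?(ltW q0) ?nnegrE ?powR_ge0//.
        by rewrite mulr_ge0 ?powR_ge0// K0.
      by rewrite (le_trans (hF z z1))// ler_wpM2l ?powR_ge0.
    by rewrite powRM ?powR_ge0 ?K0// -powRrM mulNr.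
  have h2 : cabs (1 - z) `^ (- b) <= 7 `^ b * (D + cabs (z - xi)) `^ (- b).
    have -> : 7 `^ b * (D + cabs (z - xi)) `^ (- b) = ((D + cabs (z - xi)) / 7) `^ (- b).
      rewrite powRM ?invr_ge0 ?addr_ge0 ?cabs_ge0 ?(ltW D0)// mulrC; congr (_ * _).
      by rewrite -(powR_inv1 (ler0n _ 7)) -powRrM mulN1r opprK.
    rewrite powR_le_neg ?oppr_le0//.
      by rewrite divr_gt0// addr_gt0.
    by rewrite ler_pdivrMr// mulrC.
  have d0 : 0 < 1 - cabs z by lra.
  have h3 : (1 - cabs z ^+ 2)^-1 <= 3 * cabs (z - xi) `^ (-1).
    rewrite powR_inv1 ?(ltW z0)//.
    have d2 : 1 - cabs z <= 1 - cabs z ^+ 2.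
      by rewrite lerD2l lerN2 expr2 ler_piMl ?cabs_ge0// ltW.
    apply: (@le_trans _ _ (1 - cabs z)^-1).
      by rewrite lef_pV2 ?posrE// (lt_le_trans d0).
    by rewrite -[leLHS]mul1r ler_pdivrMr// mulrAC ler_pdivlMr// mul1r.
  apply: (@le_trans _ _ ((7 `^ b * (D + cabs (z - xi)) `^ (- b) * k) * (3 * cabs (z - xi) `^ (-1)))).
    apply: ler_pM => //; first exact: powR_ge0.
      by rewrite invr_ge0 subr_ge0 expr_le1 ?cabs_ge0 ?ltW.
    by rewrite (le_trans h1)// ler_wpM2r.
  by rewrite /c le_eqVlt; apply/orP; left; apply/eqP; ring.
have mrho : measurable_fun [set: RR] (fun w : RR => cabs (cw w - xi)).
  by apply: cmeas_cabs; apply: cmeasD; [exact: cmeas_cw|exact: cmeas_cst].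
have H := hC _ _ (@dA R) setT (fun w : RR => cabs (cw w - xi)) measurableT mrho
  (fun w _ => cabs_ge0 _) (dA_ball_le xi) D D0.
have mint : measurable_fun [set: RR] (fun w : RR =>
   (cabs (cw w - xi) `^ (-1) * (D + cabs (cw w - xi)) `^ (- b))%:E).
  apply/measurable_EFinP; apply: measurable_funM;
    apply: (measurableT_comp (measurable_powR _)) => //.
  exact: measurable_funD.
have step : (cone_integral p F xi <= (c * (C * D `^ (2 - 1 - b)))%:E)%E.
  apply: (@le_trans _ _ (\int[@dA R]_(w in setT) (c%:E *
    (cabs (cw w - xi) `^ (-1) * (D + cabs (cw w - xi)) `^ (- b))%:E))%E).
    apply: ge0_le_integral_subset => //.
    - move=> w /= Gw; rewrite lee_fin cone_integrand_ge0//.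
      by have [] := geo _ Gw.
    - by move=> w _; rewrite -EFinM lee_fin !mulr_ge0 ?powR_ge0.
    - by move=> w /= Gw; rewrite -EFinM lee_fin; exact: pt.
  rewrite ge0_integralZl ?lee_fin//; last first.
    by move=> w _; rewrite lee_fin mulr_ge0 ?powR_ge0.
  by rewrite [leRHS]EFinM lee_wpmul2l ?lee_fin.
apply: (le_trans (ge0_le_poweR qp0 (cone_integral_ge0 _ _ xi1) step)).
rewrite poweR_EFin lee_fin.
have kq : k `^ (q / p) = K (D / 7).
  rewrite /k -powRrM (_ : p / q * (q / p) = 1) ?powRr1 ?K0//.
  by field; rewrite !gt_eqF.
have -> : c * (C * D `^ (2 - 1 - b)) = (3 * C * 7 `^ (1 - b) * 7 `^ b) * (k * (D / 7) `^ (1 - b)).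
  have -> : 2 - 1 - b = 1 - b by ring.
  rewrite [(D / 7) `^ _]powRM ?invr_ge0 ?(ltW D0)//.
  rewrite -[7^-1](powR_inv1 (ler0n _ 7)) -[(7 `^ (-1)) `^ _]powRrM mulN1r powRN /c.
  have s0 : 0 < (7 : R) `^ (1 - b) by rewrite powR_gt0.
  by move: s0; set y := 7 `^ (1 - b) => y0; field; rewrite gt_eqF.
rewrite powRM ?mulr_ge0 ?powR_ge0// ler_wpM2l ?powR_ge0//.
rewrite powRM ?powR_ge0// kq -powRrM.
have -> : (1 - b) * (q / p) = q / p - al.
  by rewrite /b; field; rewrite !gt_eqF.
by [].
Qed.

End ConeUpper.

(** * Distance from a boundary point to 1 in terms of its angle *)

Section CircleMeasure.
Context {R : realType}.
Notation leb := (@lebesgue_measure R).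

(** By the double angle formula and the mean value theorem, sin y = y cos(c) cos(y/2) with 0 < c <
    y/2. Both arguments are at most pi/4, so each cosine has square at least 1/2. *)
Lemma sin_ge_half (y : R) : 0 <= y -> y <= pi / 2 -> y / 2 <= sin y.
Proof.
move=> y0 y2; have [->|yn] := eqVneq y 0; first by rewrite mul0r sin0.
have yp : 0 < y by rewrite lt_neqAle eq_sym yn.
have cosb (x : R) : 0 <= x -> x <= y / 2 -> 0 <= cos x /\ 2^-1 <= cos x ^+ 2.
  move=> x0 xy; have h (u : R) : 0 <= u -> u <= pi / 2 -> 0 <= cos u.
    move=> u0 u2; apply: cos_ge0_pihalf; rewrite u2 andbT.
    by rewrite (le_trans _ u0)// oppr_le0 divr_ge0// pi_ge0.
  split; first by apply: h => //; lra.
  have : 0 <= cos (x *+ 2).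
    by apply: h; rewrite -mulr_natr; lra.
  by rewrite cos_mulr2n -mulr_natr; lra.
have y20 : 0 < y / 2 by rewrite divr_gt0.
have [|c cin] := @MVT R sin cos 0 (y / 2) y20 (fun x _ => is_derive_sin x).
  exact/continuous_subspaceT/continuous_sin.
move: cin; rewrite in_itv/= sin0 !subr0 => /andP[c0 c1] hs.
have [a1 a2] := cosb c (ltW c0) (ltW c1).
have [b1 b2] := cosb (y / 2) (ltW y20) (lexx _).
have hp : 2^-1 <= cos c * cos (y / 2).
  rewrite -(@ler_pXn2r _ 2)// ?nnegrE ?mulr_ge0// exprMn.
  by rewrite expr2 ler_pM.
have -> : sin y = y * (cos c * cos (y / 2)).
  rewrite {1}(_ : y = (y / 2) *+ 2); last by rewrite -mulr_natr divfK.
  rewrite sin_mulr2n hs; move: (cos c) (cos _) => u v.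
  by rewrite -mulr_natr; field.
by rewrite ler_pM2l.
Qed.

Lemma cabs_one_sub_circle (theta : R) :
  cabs (1 - circle_pt theta) = 2 * `|sin (theta / 2)|.
Proof.
by rewrite -circle_pt0 cabs_distC cabs_circle_ptB subr0.
Qed.

(** Both ends of the angular interval represent the point 1, whence the alternative. *)
Lemma one_sub_circle_ge (theta : R) : 0 <= theta -> theta <= 2 * pi ->
  theta / 2 <= cabs (1 - circle_pt theta) \/
  (2 * pi - theta) / 2 <= cabs (1 - circle_pt theta).
Proof.
move=> h0 h2; rewrite cabs_one_sub_circle; have [h|h] := leP theta pi.
  left; have := @sin_ge_half (theta / 2) ltac:(lra) ltac:(lra).
  by have := ler_norm (sin (theta / 2)); lra.
right; have := @sin_ge_half (pi - theta / 2) ltac:(lra) ltac:(lra).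
rewrite sinB sinpi cospi mul0r mulN1r sub0r opprK.
by have := ler_norm (sin (theta / 2)); lra.
Qed.

(** The 7 is that of the cone estimate, which evaluates [K] at this point. *)
Definition circ_rho (theta : R) : R := cabs (1 - circle_pt theta) / 7.

Lemma circ_rho_ge0 theta : 0 <= circ_rho theta.
Proof. by rewrite divr_ge0 ?cabs_ge0. Qed.

Lemma circ_rho_gt0 theta : 0 < theta -> theta < 2 * pi -> 0 < circ_rho theta.
Proof.
move=> h0 h2; rewrite divr_gt0//.
have [] := one_sub_circle_ge (ltW h0) (ltW h2) => h; apply: lt_le_trans h; lra.
Qed.

Lemma measurable_circ_rho : measurable_fun [set: measurableTypeR R] (circ_rho : measurableTypeR R -> R).
Proof.
rewrite /circ_rho; apply: measurable_funM => //.
apply: cmeas_cabs; apply: cmeasD; first exact: cmeas_cst.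
split => /=.
  apply: measurable_funN; apply: continuous_measurable_fun; exact: continuous_cos.
apply: measurable_funN; apply: continuous_measurable_fun; exact: continuous_sin.
Qed.

Definition I2pi : set (measurableTypeR R) := `[0, 2 * pi]%classic.

Lemma measurable_I2pi : measurable I2pi.
Proof. exact: measurable_itv. Qed.

(** A small [circ_rho] puts the angle within 14 r of one of the two ends, and 28 is twice 14. *)
Lemma lebesgue_near_circle (r : R) : 0 < r ->
  (leb (I2pi `&` [set x : measurableTypeR R | (circ_rho x < r)%R]) <= (28 * r `^ 1)%:E)%E.
Proof.
move=> r0; rewrite powRr1 ?(ltW r0)//.
pose J1 : set (measurableTypeR R) := `[0, 14 * r]%classic.
pose J2 : set (measurableTypeR R) := `[2 * pi - 14 * r, 2 * pi]%classic.
have r14 : 0 < 14 * r by rewrite mulr_gt0.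
apply: (@le_trans _ _ (leb (J1 `|` J2))).
  apply: le_measure; rewrite ?inE.
  - apply: measurableI; first exact: measurable_I2pi.
    rewrite -[X in measurable X]setTI.
    by apply: (@measurable_fun_ltr _ (measurableTypeR R) _ setT circ_rho (cst r)) => //;
      exact: measurable_circ_rho.
  - by apply: measurableU; exact: measurable_itv.
  - move=> x [/=]; rewrite /I2pi/= in_itv/= => /andP[x0 x2]; rewrite /circ_rho ltr_pdivrMr// => xr.
    rewrite /J1/J2/= !in_itv/= x0 x2 andbT/=.
    by have [] := one_sub_circle_ge x0 x2 => h; [left|right]; lra.
apply: (le_trans (measureU2 _ _ _)); try exact: measurable_itv.
rewrite -[leLHS]/(leb J1 + leb J2)%E !lebesgue_measure_itv/= !lte_fin.
have -> : 0 < 14 * r by [].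
have -> : 2 * pi - 14 * r < 2 * pi by lra.
by rewrite -!EFinD lee_fin; lra.
Qed.

End CircleMeasure.

(** * Integration over the cones and boundedness *)

Section Boundedness.
Context {R : realType}.
Notation leb := (@lebesgue_measure R).
Notation RR := (measurableTypeR R * measurableTypeR R)%type.
Implicit Types (a : (Cplx R)^nat) (f : Cplx R -> Cplx R) (p q : R).

(** At both ends of the angular interval the boundary point is 1, where the cone estimate says
    nothing; the two ends form a null set. *)
Lemma AT_int_le_majorant p q f (g : R -> \bar R) :
  measurable_fun [set: measurableTypeR R] (g : measurableTypeR R -> \bar R) ->
  (forall x, 0 <= g x)%E ->
  (forall theta, 0 < theta -> theta < 2 * pi ->
     (cone_integral p f (circle_pt theta) `^ (q / p) <= g theta)%E) ->
  (AT_int p q f <= \int[leb]_(x in I2pi) g x)%E.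
Proof.
move=> mg g0 fg; rewrite /AT_int integral_mkcond [leRHS]integral_mkcond.
apply: ae_ge0_le_integral_majorant.
- by move=> x; rewrite patchE; case: ifPn => // _; exact: poweR_ge0.
- by move=> x; rewrite patchE; case: ifPn.
- apply/(measurable_restrictT _ measurable_I2pi); exact: measurable_funTS.
exists [set 0; 2 * pi]; split.
- exact: measurableU.
- apply/eqP; rewrite eq_le measure_ge0 andbT (le_trans (measureU2 _ _ _))//.
  by rewrite -[leLHS]/(leb [set 0%R] + leb [set (2 * pi)%R])%E !lebesgue_measure_set1 adde0.
move=> x /= h; apply: contrapT => /not_orP[/eqP x0 /eqP x2]; apply: h.
rewrite !patchE; case: ifPn => // /set_mem; rewrite /= in_itv/= => /andP[h0 h2].
by apply: fg; rewrite lt_neqAle ?x2// eq_sym x0.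
Qed.

Lemma circle_singular_integral (g : R) : 0 < g -> g < 1 ->
  exists2 C : R, 0 <= C & forall e, 0 < e ->
    (\int[leb]_(x in I2pi) (circ_rho x `^ (- g) / (e + circ_rho x))%:E <= (C * e `^ (- g))%:E)%E.
Proof.
move=> g0 g1.
have [C C0 hC] := @singular_power_integral R 28 1 g 1 ltac:(lra) g0 ler01 g1 ltac:(lra).
exists C => // e e0.
have := hC _ _ leb I2pi (circ_rho : measurableTypeR R -> R) measurable_I2pi measurable_circ_rho
  (fun x _ => circ_rho_ge0 x) lebesgue_near_circle e e0.
have -> : 1 - g - 1 = - g by ring.
apply: le_trans; apply: ge0_le_integral_nonmeas => x _.
  by rewrite lee_fin divr_ge0 ?powR_ge0// addr_ge0 ?circ_rho_ge0// ltW.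
by rewrite lee_fin powR_inv1// addr_ge0 ?circ_rho_ge0// ltW.
Qed.

(** The first condition makes the cone integral converge, the second the angular integral of the
    power -(al - q/p), the third the Schur integral. Such an exponent exists because s < 1 amounts
    to q/p + 1 < q. *)
Lemma exists_schur_exponent p q : 2 < p -> 1 < q -> p^-1 + q^-1 < 1 ->
  exists al : R, [/\ q / p < al, al < q / p + 1 & al < q - 1].
Proof.
move=> p2 q1 pq; have q0 : 0 < q by exact: lt_trans q1.
have h : q / p + 1 < q.
  have : (p^-1 + q^-1) * q < 1 * q by rewrite ltr_pM2r.
  by rewrite mulrDl mulVf ?gt_eqF// mul1r mulrC.
pose d := Num.min 1 (q - 1 - q / p).
have d0 : 0 < d by rewrite lt_min ltr01/=; lra.
have d1 : d <= 1 by rewrite ge_min lexx.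
have d2 : d <= q - 1 - q / p by rewrite ge_min lexx orbT.
by exists (q / p + d / 2); split; lra.
Qed.

Lemma measurable_inv_pos d (T : measurableType d) (D : set T) (g : T -> R) :
  (forall x, D x -> 0 < g x) -> measurable_fun D g -> measurable_fun D (fun x => (g x)^-1).
Proof.
move=> g0 mg; apply: (eq_measurable_fun (fun x => g x `^ (-1))).
  by move=> x /set_mem /g0 gx; rewrite powR_inv1// ltW.
exact: (measurableT_comp (measurable_powR _)).
Qed.

(** The Schur test gives |H f|^q <= const |1 - z|^(-al) K(|1 - z|) with [K] decreasing, so the cone
    estimate yields an angular majorant circ_rho^(-gm) K(circ_rho), where gm = al - q/p. Unfolding
    [K] and exchanging the integrals, the angular one contributes (1 - t)^(-gm). The total weight (1
    - t)^(al - gm) is (1 - t)^(q/p), that of the radial estimate for [f]. *)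
Lemma hilbert_AT_int p q : 2 < p -> 1 < q -> p^-1 + q^-1 < 1 ->
  exists2 C : R, 0 <= C & forall a f, power_series_on_disc a f ->
    cvgn (series (fun k => cabs (a k) / k.+1%:R)) ->
    (AT_int p q f < +oo)%E ->
    (AT_int p q (fun z => limn (series (fun n => hilbert_coef a n * z ^+ n))%R)
      <= C%:E * AT_int p q f)%E.
Proof.
move=> p2 q1 pq; have [al [al1 al2 al3]] := exists_schur_exponent p2 q1 pq.
have p1 : 1 < p by apply: lt_trans p2; rewrite ltr1n.
have p0 : 0 < p by exact: lt_trans p1.
have q0 : 0 < q by exact: lt_trans q1.
have qp0 : 0 < q / p by rewrite divr_gt0.
have al0 : 0 < al by exact: lt_trans al1.
have [C1 C10 hC1] := schur_test q1 al0 al3.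
have [C2 C20 hC2] := cone_upper p0 q0 al1.
pose gm := al - q / p.
have gm0 : 0 < gm by rewrite subr_gt0.
have gm1 : gm < 1 by rewrite /gm; lra.
have [C3 C30 hC3] := circle_singular_integral gm0 gm1.
pose cA := 4 * (cone_const `^ (q / p))^-1 : R.
have cA0 : 0 <= cA by rewrite mulr_ge0 ?invr_ge0 ?powR_ge0.
pose B := C2 * (6 `^ q * C1).
have B0 : 0 <= B by rewrite !mulr_ge0 ?powR_ge0.
exists (B * (C3 * cA)); first by apply: mulr_ge0 => //; exact: mulr_ge0.
move=> a f af ha If; set Hf := fun z => _.
pose I : set (measurableTypeR R) := `]0, 1[%classic.
have mI : measurable I by exact: measurable_itv.
have I01 t : I t -> 0 < t < 1 by rewrite /I/= in_itv.
pose h (t : R) := cabs (f t%:C%C).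
have h0 t : 0 <= h t by exact: cabs_ge0.
have mh : measurable_fun I (h : measurableTypeR R -> R).
  exact: (cmeas_cabs (cmeas_restrict_real af)).
pose E (t : R) := (1 - t) `^ (q / p) * h t `^ q.
pose G (t : R) := h t `^ q * (1 - t) `^ al.
have G0 t : 0 <= G t by rewrite mulr_ge0 ?powR_ge0.
have mG : measurable_fun I (G : measurableTypeR R -> R).
  by apply: measurable_funM; apply: (measurableT_comp (measurable_powR _)) => //;
    exact: measurable_funTS (@measurable_rho R).
have EA : (\int[leb]_(t in I) (E t)%:E <= cA%:E * AT_int p q f)%E.
  exact: (AT_weighted_real p1 q0 af).
have mE : measurable_fun I (fun t : measurableTypeR R => (E t)%:E).
  apply/measurable_EFinP; apply: measurable_funM; apply: (measurableT_comp (measurable_powR _)) => //;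
    exact: measurable_funTS (@measurable_rho R).
pose Kb (x : R) : \bar R := (\int[leb]_(t in I) (G t / ((1 - t) + x))%:E)%E.
have Kb0 x : 0 < x -> (0 <= Kb x)%E.
  move=> x0; apply: integral_ge0 => t /I01/andP[t0 t1].
  by rewrite lee_fin divr_ge0//; lra.
(* Since al > q/p and 1 - t < 1, [G] is at most [E], whose integral is finite by the radial
   estimate. *)
have Kfin x : 0 < x -> Kb x \is a fin_num.
  move=> x0; rewrite ge0_fin_numE ?Kb0//.
  apply: (@le_lt_trans _ _ (x^-1%:E * \int[leb]_(t in I) (E t)%:E)%E); last first.
    rewrite lte_mul_pinfty ?lee_fin ?invr_ge0 ?(ltW x0)//.
    by rewrite (le_lt_trans EA)// lte_mul_pinfty ?lee_fin.
  rewrite -ge0_integralZl ?lee_fin ?invr_ge0 ?(ltW x0)//; last first.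
    by move=> t _; rewrite lee_fin mulr_ge0 ?powR_ge0.
  apply: ge0_le_integral_nonmeas => t /I01/andP[t0 t1].
    by rewrite lee_fin divr_ge0//; lra.
  rewrite -EFinM lee_fin mulrC ler_pM ?invr_ge0//; try lra.
    by rewrite lef_pV2 ?posrE//; lra.
  rewrite /G /E mulrC ler_wpM2r ?powR_ge0//.
  by apply: ger_powR; [apply/andP; split; lra|exact: ltW].
pose K (x : R) := fine (Kb x).
have KE x : 0 < x -> Kb x = (K x)%:E by move=> x0; rewrite fineK// Kfin.
have K0 x : 0 < x -> 0 <= K x by move=> x0; rewrite fine_ge0// Kb0.
have Kmono x y : 0 < x -> x <= y -> K y <= K x.
  move=> x0 xy; have y0 : 0 < y by exact: lt_le_trans xy.
  rewrite -lee_fin -!KE//; apply: ge0_le_integral_nonmeas => t /I01/andP[t0 t1].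
    by rewrite lee_fin divr_ge0//; lra.
  by rewrite lee_fin ler_wpM2l// lef_pV2 ?posrE; lra.
have Hbound z : disc z -> cabs (Hf z) `^ q <=
    cabs (1 - z) `^ (- al) * (6 `^ q * C1 * K (cabs (1 - z))).
  move=> z1; set x := cabs (1 - z).
  have x0 : 0 < x.
    have := cabsD (1 - z) z; rewrite subrK cabs1 -/x; rewrite /disc/= in z1; lra.
  have [F [F0 FE Fq]] := hC1 h x (K x) mh h0 x0 (K0 x x0) (KE x x0).
  have HF : cabs (Hf z) <= 6 * F.
    rewrite -lee_fin; apply: (le_trans (hilbert_bound z1 af ha)).
    rewrite ge0_integralZl//.
    - by rewrite [leRHS]EFinM -FE.
    - apply/measurable_EFinP; apply: measurable_funM => //.
      apply: measurable_inv_pos => [t /I01/andP[t0 t1]|]; first by rewrite -/x; lra.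
      by apply: measurable_funD => //; exact: measurable_funTS (@measurable_rho R).
    - by move=> t /I01/andP[t0 t1]; rewrite lee_fin divr_ge0 ?cabs_ge0// -/x; lra.
  apply: (@le_trans _ _ ((6 * F) `^ q)).
    by rewrite ge0_ler_powR ?(ltW q0) ?nnegrE ?cabs_ge0// mulr_ge0.
  rewrite powRM// (le_trans (ler_wpM2l (powR_ge0 _ _) Fq))// le_eqVlt.
  by apply/orP; left; apply/eqP; ring.
pose D : set RR := I2pi `*` I.
have mD : measurable D by exact: measurableX measurable_I2pi mI.
pose Phi0 (w : RR) : R := G w.2 * (circ_rho w.1 `^ (- gm) / ((1 - w.2) + circ_rho w.1)).
pose Phi (w : RR) : \bar R := ((fun w => (Phi0 w)%:E) \_ D) w.
have Dpos w : D w -> 0 < (1 - (w.2 : R)) + circ_rho w.1.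
  by move=> [_ /I01/andP[t0 t1]]; have := circ_rho_ge0 w.1; lra.
have Phi0_ge0 w : D w -> 0 <= Phi0 w.
  by move=> Dw; rewrite mulr_ge0// divr_ge0 ?powR_ge0// ltW// Dpos.
have PhiP w : (0 <= Phi w)%E.
  by rewrite /Phi patchE; case: ifPn => // /set_mem Dw; rewrite lee_fin Phi0_ge0.
have m1 : measurable_fun [set: RR] (fun w : RR => circ_rho w.1).
  exact: (measurableT_comp measurable_circ_rho measurable_fst).
have m2 : measurable_fun [set: RR] (fun w : RR => (1 - (w.2 : R))).
  exact: (measurableT_comp (@measurable_rho R) measurable_snd).
have mPhi : measurable_fun [set: RR] Phi.
  apply/(measurable_restrictT _ mD)/measurable_EFinP.
  apply: measurable_funM.
    apply: (measurable_comp mI _ mG (measurable_funTS measurable_snd)).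
    by move=> _ [w [_ Iw] <-].
  apply: measurable_funM.
    by apply: (measurableT_comp (measurable_powR _)); exact: measurable_funTS.
  apply: measurable_inv_pos; first exact: Dpos.
  by apply: measurable_funD; exact: measurable_funTS.
pose g (theta : R) : \bar R := (B%:E * \int[leb]_t Phi (theta, t))%E.
have FI theta : I2pi theta -> (\int[leb]_t Phi (theta, t) = \int[leb]_(t in I) (Phi0 (theta, t))%:E)%E.
  move=> It; rewrite [RHS]integral_mkcond; apply: eq_integral => t _.
  rewrite /Phi !patchE.
  have -> : ((theta, t) \in D) = (t \in I).
    by apply/idP/idP => /set_mem; [move=> [_ ?]; exact/mem_set|move=> ?; exact/mem_set].
  by [].
have mF := measurable_fun_fubini_tonelli_F (m2 := leb) Phi mPhi PhiP.
apply: (@le_trans _ _ (\int[leb]_(x in I2pi) g x)%E).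
  apply: AT_int_le_majorant.
  - exact: (measurable_funeM B%:E mF).
  - by move=> x; rewrite mule_ge0 ?lee_fin// integral_ge0.
  move=> th th0 th2; have r0 := circ_rho_gt0 th0 th2.
  have D0 : 0 < cabs (1 - circle_pt th).
    by move: r0; rewrite /circ_rho pmulr_lgt0.
  have Ith : I2pi th by rewrite /I2pi/= in_itv/= !ltW.
  have := hC2 Hf (fun x => 6 `^ q * C1 * K x) th Hbound _ _ D0.
  have c0 : 0 <= 6 `^ q * C1 by rewrite mulr_ge0 ?powR_ge0.
  move=> /(_ (fun x y x0 xy => ler_wpM2l c0 (Kmono x y x0 xy))).
  move=> /(_ (fun x x0 => mulr_ge0 c0 (K0 x x0))) /le_trans; apply.
  rewrite /g FI// -/(circ_rho th).
  have -> : (\int[leb]_(t in I) (Phi0 (th, t))%:E = (circ_rho th `^ (- gm))%:E * Kb (circ_rho th))%E.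
    rewrite /Kb -ge0_integralZl//.
    - by apply: eq_integral => t _; rewrite -EFinM /Phi0/=; congr EFin; ring.
    - apply/measurable_EFinP; apply: measurable_funM => //.
      apply: measurable_inv_pos => [t /I01/andP[t0 t1]|]; first by lra.
      by apply: measurable_funD => //; exact: measurable_funTS (@measurable_rho R).
    - by move=> t /I01/andP[t0 t1]; rewrite lee_fin divr_ge0//; lra.
    - by rewrite lee_fin powR_ge0.
  rewrite KE// -!EFinM lee_fin /B opprB le_eqVlt; apply/orP; left; apply/eqP; ring.
rewrite /g ge0_integralZl//; last 3 first.
- exact: measurable_I2pi.
- exact: measurable_funTS mF.
- by move=> x _; exact: integral_ge0.
have -> : ((B * (C3 * cA))%:E * AT_int p q f = B%:E * ((C3 * cA)%:E * AT_int p q f))%E.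
  by rewrite EFinM muleA.
rewrite lee_wpmul2l ?lee_fin//.
apply: (@le_trans _ _ (\int[leb]_x \int[leb]_t Phi (x, t))%E).
  rewrite integral_mkcond; apply: ge0_le_integral_nonmeas => x _.
    by rewrite patchE; case: ifPn => // _; exact: integral_ge0.
  by rewrite patchE; case: ifPn => // _; exact: integral_ge0.
rewrite (fubini_tonelli Phi mPhi PhiP).
apply: (@le_trans _ _ (\int[leb]_(t in I) (C3%:E * (E t)%:E))%E); last first.
  rewrite ge0_integralZl ?lee_fin//; last by move=> t _; rewrite lee_fin mulr_ge0 ?powR_ge0.
  have -> : ((C3 * cA)%:E * AT_int p q f = C3%:E * (cA%:E * AT_int p q f))%E.
    by rewrite EFinM muleA.
  by rewrite lee_wpmul2l ?lee_fin.
rewrite [leRHS]integral_mkcond; apply: ge0_le_integral_nonmeas => t _.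
  by apply: integral_ge0.
rewrite patchE; case: ifPn => [/set_mem It|/negP It]; last first.
  rewrite (_ : (fun x => _) = cst 0%E) ?integral0//; apply/funext => x.
  rewrite /Phi patchE; case: ifPn => // /set_mem[_ /= It']; exfalso; apply: It; exact/mem_set.
have -> : (\int[leb]_x Phi (x, t) = \int[leb]_(x in I2pi) (Phi0 (x, t))%:E)%E.
  rewrite [RHS]integral_mkcond; apply: eq_integral => x _.
  rewrite /Phi !patchE.
  have -> : ((x, t) \in D) = (x \in I2pi).
    by apply/idP/idP => /set_mem; [move=> [? _]; exact/mem_set|move=> ?; exact/mem_set].
  by [].
have /andP[t0 t1] := I01 t It.
have e0 : 0 < 1 - (t : R) by rewrite subr_gt0.
have -> : (\int[leb]_(x in I2pi) (Phi0 (x, t))%:E =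
  (G t)%:E * \int[leb]_(x in I2pi) (circ_rho x `^ (- gm) / ((1 - t) + circ_rho x))%:E)%E.
  rewrite -ge0_integralZl ?lee_fin//.
  - exact: measurable_I2pi.
  - apply/measurable_EFinP; apply: measurable_funM.
      apply: (measurableT_comp (measurable_powR _)); exact: measurable_funTS measurable_circ_rho.
    apply: measurable_inv_pos => [x _|]; first by rewrite ltr_wpDr ?circ_rho_ge0.
    by apply: measurable_funD => //; exact: measurable_funTS measurable_circ_rho.
  - by move=> x _; rewrite lee_fin divr_ge0 ?powR_ge0// addr_ge0 ?circ_rho_ge0 ?ltW.
apply: (@le_trans _ _ ((G t)%:E * (C3 * (1 - t) `^ (- gm))%:E)%E).
  by rewrite lee_wpmul2l ?lee_fin// hC3.
rewrite -!EFinM lee_fin /G /E /gm opprB le_eqVlt; apply/orP; left; apply/eqP.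
have -> : (1 - t) `^ (q / p) = (1 - t) `^ al * (1 - t) `^ (q / p - al).
  by rewrite -gt0_powRD//; congr (_ `^ _); ring.
ring.
Qed.

End Boundedness.

(** * Test functions *)

Section TestFunctions.
Context {R : realType}.
Notation leb := (@lebesgue_measure R).
Implicit Types (a : (Cplx R)^nat) (f g : Cplx R -> Cplx R) (p q s d : R).

Lemma taylorP f : analytic_on_disc f -> power_series_on_disc (taylor f) f.
Proof. by move=> [a af]; rewrite /taylor; case: xgetP => [x _ //|/(_ a)]; case. Qed.

Lemma AT_hilbert_facts p q f : 2 < p -> 1 < q -> p^-1 + q^-1 < 1 -> AT p q f ->
  [/\ power_series_on_disc (taylor f) f,
      cvgn (series (fun k => cabs (taylor f k) / k.+1%:R)),
      (AT_int p q f < +oo)%E &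
      power_series_on_disc (hilbert_coef (taylor f)) (hilbert f)].
Proof.
move=> p2 q1 pq [an nf]; have q0 : 0 < q by exact: lt_trans q1.
have af := taylorP an; have If := (AT_norm_lty p f q0).1 nf.
have ha := AT_coef_summable p2 q1 pq af If.
split; [exact: af|exact: ha|exact: If|].
by move=> z z1; exact: (hilbert_coef_power_cvg ha z1).
Qed.

Definition test_fun s d (z : Cplx R) : Cplx R :=
  (d `^ (1 - s))%:C%C / (1 - (1 - d)%:C%C * z).

Lemma test_fun_power_series s d : 0 < d -> d < 1 ->
  power_series_on_disc (fun k => (d `^ (1 - s))%:C%C * (1 - d)%:C%C ^+ k) (test_fun s d).
Proof.
move=> d0 d1 z z1; rewrite /disc/= in z1.
set c := (d `^ _)%:C%C; pose w : Cplx R := (1 - d)%:C%C * z.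
have w1 : cabs w < 1.
  rewrite cabsM cabs_real ger0_norm; last by lra.
  by apply: (le_lt_trans _ z1); rewrite ler_piMl ?cabs_ge0//; lra.
have w0 : 1 - w != 0.
  apply/eqP => h; have := cabsD (1 - w) w; rewrite subrK h cabs0 cabs1; lra.
have e n : c / (1 - w) - series (fun k => c * (1 - d)%:C%C ^+ k * z ^+ k) n =
    c / (1 - w) * w ^+ n.
  rewrite /series/=; under eq_bigr do rewrite -mulrA -exprMn.
  rewrite -mulr_sumr big_mkord -/w; apply: (mulfI w0).
  have h := subrX1 w n; set S := \sum_(i < n) _ in h *.
  have -> : (1 - w) * (c / (1 - w) - c * S) = c * (1 - (1 - w) * S).
    by field.
  have -> : (1 - w) * S = 1 - w ^+ n by rewrite -opprB mulNr -h opprB.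
  by field.
apply/cvg_cabsP; rewrite /test_fun -/c -/w.
rewrite (_ : (fun n => _) = (fun n => cabs (c / (1 - w)) * cabs w ^+ n)); last first.
  by apply/funext => n; rewrite e cabsM cabsX.
rewrite -(mulr0 (cabs (c / (1 - w)))); apply: cvgM; first exact: cvg_cst.
by apply: cvg_expr; rewrite ger0_norm ?cabs_ge0.
Qed.

Lemma test_fun_le s d z : 0 < d -> d < 1 -> disc z ->
  cabs (test_fun s d z) <= 3 * d `^ (1 - s) / (d + cabs (1 - z)).
Proof.
move=> d0 d1 z1.
have := @cabs_one_sub_real R z (1 - d) z1 ltac:(lra) ltac:(lra).
have -> : 1 - (1 - d) = d by ring.
set A := cabs (1 - _ * z) => h.
have D0 : 0 < d + cabs (1 - z) by rewrite ltr_wpDr ?cabs_ge0.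
have A0 : 0 < A by lra.
rewrite /test_fun cabsM cabsV cabs_real ger0_norm ?powR_ge0// -/A.
rewrite ler_pdivrMr// mulrAC ler_pdivlMr//.
apply: (le_trans (ler_wpM2l (powR_ge0 _ _) h)).
by rewrite mulrA [_ * 3]mulrC.
Qed.

(** In (d + x)^(-q) the factors (d + x)^(-al) and (d + x)^(-1) are kept for the cone and the circle.
    The remaining exponent al - q + 1 is negative, so that factor is at most its value at x = 0. The
    resulting power of [d] in [kp] is d^gm, which exactly cancels the d^(-gm) of the circle
    integral. *)
Lemma test_fun_AT_int p q : 2 < p -> 1 < q -> p^-1 + q^-1 < 1 ->
  exists2 C : R, 0 <= C & forall d, 0 < d -> d < 1 ->
    (AT_int p q (test_fun (p^-1 + q^-1) d) <= C%:E)%E.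
Proof.
move=> p2 q1 pq; have [al [al1 al2 al3]] := exists_schur_exponent p2 q1 pq.
have p0 : 0 < p by apply: lt_trans p2; rewrite ltr0n.
have q0 : 0 < q by exact: lt_trans q1.
have qp0 : 0 < q / p by rewrite divr_gt0.
have al0 : 0 < al by exact: lt_trans al1.
have [C2 C20 hC2] := cone_upper p0 q0 al1.
pose gm := al - q / p.
have gm0 : 0 < gm by rewrite subr_gt0.
have gm1 : gm < 1 by rewrite /gm; lra.
have [C3 C30 hC3] := circle_singular_integral gm0 gm1.
exists (C2 * 3 `^ q * C3); first by rewrite !mulr_ge0 ?powR_ge0.
move=> d d0 d1; set s := p^-1 + q^-1.
pose kp : R := 3 `^ q * d `^ ((1 - s) * q + (al - q + 1)).
have kp0 : 0 <= kp by rewrite mulr_ge0 ?powR_ge0.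
pose K (x : R) := kp / (d + x).
have hF z : disc z -> cabs (test_fun s d z) `^ q <=
    cabs (1 - z) `^ (- al) * K (cabs (1 - z)).
  move=> z1; have h := test_fun_le s d0 d1 z1.
  have x0 : 0 < cabs (1 - z).
    have := cabsD (1 - z) z; rewrite subrK cabs1; rewrite /disc/= in z1; lra.
  move: h x0; set x := cabs (1 - z) => h x0.
  have dx : 0 < d + x by rewrite addr_gt0.
  apply: (@le_trans _ _ ((3 * d `^ (1 - s) / (d + x)) `^ q)).
    by rewrite ge0_ler_powR ?(ltW q0) ?nnegrE ?cabs_ge0// divr_ge0 ?mulr_ge0 ?powR_ge0// ltW.
  have -> : (3 * d `^ (1 - s) / (d + x)) `^ q =
     3 `^ q * d `^ ((1 - s) * q) * (d + x) `^ (- q).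
    have i0 : 0 <= (d + x)^-1 by rewrite invr_ge0 ltW.
    rewrite (powRM q _ i0) ?mulr_ge0 ?powR_ge0// (powRM q (ler0n _ 3) (powR_ge0 _ _)).
    by rewrite -powRrM -(powR_inv1 (ltW dx)) -powRrM mulN1r.
  have -> : (d + x) `^ (- q) = (d + x) `^ (- al) * (d + x)^-1 * (d + x) `^ (al - q + 1).
    by rewrite -(powR_inv1 (ltW dx)) -!gt0_powRD//; congr (_ `^ _); ring.
  have h1 : (d + x) `^ (- al) <= x `^ (- al).
    by rewrite powR_le_neg// ?oppr_le0 ?(ltW al0)// lerDr ltW.
  have h2 : (d + x) `^ (al - q + 1) <= d `^ (al - q + 1).
    by rewrite powR_le_neg// ?lerDl ?(ltW x0)//; lra.
  have kpE : d `^ ((1 - s) * q + (al - q + 1)) = d `^ ((1 - s) * q) * d `^ (al - q + 1).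
    exact: gt0_powRD.
  rewrite /K /kp kpE.
  apply: (@le_trans _ _ (3 `^ q * d `^ ((1 - s) * q) *
     (x `^ (- al) * (d + x)^-1 * d `^ (al - q + 1)))).
    rewrite ler_wpM2l ?mulr_ge0 ?powR_ge0//.
    apply: ler_pM; rewrite ?mulr_ge0 ?powR_ge0 ?invr_ge0 ?(ltW dx)//.
    by rewrite ler_wpM2r// invr_ge0 ltW.
  by rewrite le_eqVlt; apply/orP; left; apply/eqP; ring.
have Kmono x y : 0 < x -> x <= y -> K y <= K x.
  by move=> x0 xy; rewrite ler_wpM2l// lef_pV2 ?posrE; lra.
have K0 x : 0 < x -> 0 <= K x by move=> x0; rewrite divr_ge0//; lra.
pose g (th : R) : \bar R := ((C2 * kp)%:E * (circ_rho th `^ (- gm) / (d + circ_rho th))%:E)%E.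
have mg : measurable_fun [set: measurableTypeR R]
   (fun th : measurableTypeR R => (circ_rho th `^ (- gm) / (d + circ_rho th))%:E).
  apply/measurable_EFinP; apply: measurable_funM.
    by apply: (measurableT_comp (measurable_powR _)); exact: measurable_circ_rho.
  apply: measurable_inv_pos => [x _|]; first by rewrite ltr_wpDr ?circ_rho_ge0.
  by apply: measurable_funD => //; exact: measurable_circ_rho.
have g0 th : (0 <= (circ_rho th `^ (- gm) / (d + circ_rho th))%:E)%E.
  by rewrite lee_fin divr_ge0 ?powR_ge0// addr_ge0 ?circ_rho_ge0 ?ltW.
have ck0 : (0 <= (C2 * kp)%:E)%E by rewrite lee_fin mulr_ge0.
apply: (@le_trans _ _ (\int[leb]_(x in I2pi) g x)%E).
  apply: AT_int_le_majorant.
  - exact: measurable_funeM.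
  - by move=> x; exact: mule_ge0.
  move=> th th0 th2; have r0 := circ_rho_gt0 th0 th2.
  have D0 : 0 < cabs (1 - circle_pt th).
    by move: r0; rewrite /circ_rho pmulr_lgt0.
  apply: (le_trans (hC2 _ K th hF Kmono K0 D0)).
  rewrite -/(circ_rho th) /g /K -EFinM lee_fin /gm opprB le_eqVlt; apply/orP; left; apply/eqP; ring.
rewrite ge0_integralZl//; last 2 first.
- exact: measurable_I2pi.
- exact: measurable_funTS.
apply: (le_trans (lee_wpmul2l ck0 (hC3 d d0))).
rewrite -EFinM lee_fin /kp.
have e0 : (1 - s) * q + (al - q + 1) + (- gm) = 0.
  by rewrite /s /gm; field; rewrite (gt_eqF p0) (gt_eqF q0).
have e1 : d `^ ((1 - s) * q + (al - q + 1)) * d `^ (- gm) = 1.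
  by rewrite -gt0_powRD// e0 powRr0.
move: e1; set u := d `^ (_ + _); set v := d `^ (- gm) => e1.
rewrite (_ : _ * (C3 * v) = C2 * 3 `^ q * C3 * (u * v)); last by ring.
by rewrite e1 mulr1.
Qed.

(** The integral of 1/(d + (1 - t)) is of order log(1/d). Inserting (1 - t)^(-k) >= 1 with k = (1 -
    s)/2 replaces the logarithm by d^(-k), half of the available power d^(1 - s). The constant 18 is
    6 from the kernel times 3 from the test function. *)
Lemma test_fun_hilbert_small s : 0 < s -> s < 1 ->
  exists2 C : R, 0 <= C & forall d (x : R) a, 0 < d -> d < 1 -> 0 < x -> x < 1 ->
    power_series_on_disc a (test_fun s d) ->
    cvgn (series (fun k => cabs (a k) / k.+1%:R)) ->
    cabs (limn (series (fun n => hilbert_coef a n * x%:C%C ^+ n)))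
      <= C / (1 - x) * d `^ ((1 - s) / 2).
Proof.
move=> s0 s1; pose k := (1 - s) / 2.
have k0 : 0 < k by rewrite divr_gt0// subr_gt0.
have k1 : k < 1 by rewrite /k; lra.
have [C C0 hC] := @singular_power_integral R 1 1 k 1 ler01 k0 ler01 k1 ltac:(lra).
exists (18 * C); first by rewrite mulr_ge0.
move=> d x a d0 d1 x0 x1 af ha.
pose I : set (measurableTypeR R) := `]0, 1[%classic.
have I01 t : I t -> 0 < t < 1 by rewrite /I/= in_itv.
have x10 : 0 < 1 - x by rewrite subr_gt0.
have dx : disc (x%:C%C : Cplx R) by rewrite /disc/= cabs_real gtr0_norm.
rewrite -lee_fin; apply: (le_trans (hilbert_bound dx af ha)).
have := hC _ _ leb I (fun t : measurableTypeR R => (1 - t : R)) (@measurable_I01 R) (@measurable_rho R)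
  (fun t It => ltac:(by have /andP[_ /ltW] := I01 t It; rewrite -subr_ge0)) (@lebesgue_near_one R) d d0.
have -> : 1 - k - 1 = - k by ring.
move=> H; pose c := 18 / (1 - x) * d `^ (1 - s).
have c0 : 0 <= c by rewrite mulr_ge0 ?powR_ge0// divr_ge0// ltW.
apply: (@le_trans _ _ (\int[leb]_(t in I) (c%:E * ((1 - t) `^ (- k) * (d + (1 - t)) `^ (-1))%:E))%E).
  apply: ge0_le_integral_nonmeas => t /I01/andP[t0 t1].
    by rewrite -EFinM lee_fin mulr_ge0// divr_ge0 ?cabs_ge0// addr_ge0 ?cabs_ge0 ?subr_ge0 ?ltW.
  have t10 : 0 < 1 - (t : R) by rewrite subr_gt0.
  have dt : 0 < d + (1 - (t : R)) by rewrite addr_gt0.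
  rewrite -!EFinM lee_fin powR_inv1 ?(ltW dt)//.
  have e1 : cabs (1 - x%:C%C : Cplx R) = 1 - x.
    by rewrite (_ : 1 - x%:C%C = (1 - x)%:C%C) ?cabs_real ?gtr0_norm// rmorphB rmorph1.
  have e2 : cabs (1 - (t : R)%:C%C : Cplx R) = 1 - t.
    by rewrite (_ : 1 - (t : R)%:C%C = (1 - (t : R))%:C%C) ?cabs_real ?gtr0_norm// rmorphB rmorph1.
  have dtt : disc ((t : R)%:C%C : Cplx R) by rewrite /disc/= cabs_real gtr0_norm.
  have h := test_fun_le s d0 d1 dtt; rewrite e2 in h.
  have h2 : (1 - t + (1 - x))^-1 <= (1 - x)^-1 by rewrite lef_pV2 ?posrE; lra.
  have h3 : 1 <= (1 - (t : R)) `^ (- k).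
    by rewrite -[leLHS](powRr0 (1 - t)); apply: ger_powR; rewrite ?oppr_le0 ?(ltW k0)// t10/= lerBlDr lerDl ltW.
  rewrite e1; apply: (@le_trans _ _ (6 * (3 * d `^ (1 - s) / (d + (1 - t)) * (1 - x)^-1))).
    by rewrite ler_wpM2l// ler_pM ?cabs_ge0// invr_ge0; lra.
  have -> : 6 * (3 * d `^ (1 - s) / (d + (1 - t)) * (1 - x)^-1) = c * (1 * (d + (1 - t))^-1).
    by rewrite /c; field; rewrite !gt_eqF.
  by rewrite ler_wpM2l// ler_wpM2r// invr_ge0 ltW.
rewrite ge0_integralZl//; last 3 first.
- exact: measurable_I01.
- apply/measurable_EFinP; apply: measurable_funM; apply: (measurableT_comp (measurable_powR _)).
    exact: measurable_funTS (@measurable_rho R).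
  by apply: measurable_funD => //; exact: measurable_funTS (@measurable_rho R).
- by move=> t _; rewrite lee_fin mulr_ge0 ?powR_ge0.
have c0' : (0 <= c%:E)%E by rewrite lee_fin.
apply: (le_trans (lee_wpmul2l c0' H)); rewrite -EFinM lee_fin /c.
have -> : d `^ ((1 - s) / 2) = d `^ (1 - s) * d `^ (- k).
  by rewrite -gt0_powRD//; congr (_ `^ _); rewrite /k; field.
by rewrite le_eqVlt; apply/orP; left; apply/eqP; ring.
Qed.

Lemma test_fun_hilbert_large s d a : 0 < d -> d < 1 ->
  power_series_on_disc a (test_fun s d) ->
  cvgn (series (fun k => cabs (a k) / k.+1%:R)) ->
  d `^ (- s) / 8 <= cabs (limn (series (fun n => hilbert_coef a n * (1 - d)%:C%C ^+ n))).
Proof.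
move=> d0 d1 af ha; set x := 1 - d.
have x0 : 0 < x by rewrite subr_gt0.
have x1 : x < 1 by rewrite /x; lra.
have dx : disc (x%:C%C : Cplx R) by rewrite /disc/= cabs_real gtr0_norm.
pose y := x * x.
have y0 : 0 <= y by rewrite mulr_ge0// ltW.
have y1 : y < 1 by rewrite /y mulr_ilt1 ?ltW.
have hl := cvg_Re (hilbert_coef_power_cvg ha dx).
apply: (le_trans _ (cabs_ge_Re _)); apply: (le_trans _ (ler_norm _)).
rewrite -(cvg_lim (@Rhausdorff R) hl); apply: limr_ge; first exact: cvgP hl.
have /cvgrPdist_le /(_ 2^-1 ltac:(by rewrite invr_gt0))[M _ hM] :
    (fun n => y ^+ n) @ \oo --> (0 : R).
  by apply: cvg_expr; rewrite ger0_norm.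
exists M => // N /= MN.
have yN : y ^+ N <= 2^-1.
  by have := hM N MN; rewrite sub0r normrN ger0_norm// exprn_ge0.
have -> : series (fun n => hilbert_coef a n * x%:C%C ^+ n) N =
    \sum_(n < N) x%:C%C ^+ n * hilbert_coef a n.
  by rewrite /series/= big_mkord; apply: eq_bigr => n _; rewrite mulrC.
rewrite -lee_fin -(hilbert_poly_integral af ha N (fun n => x%:C%C ^+ n)).
pose J : set (measurableTypeR R) := `]x, 1[%classic.
have muJ : (leb J = d%:E)%E.
  by rewrite lebesgue_measure_itv/= lte_fin x1 -EFinD; congr EFin; rewrite /x; ring.
have mJ : measurable J by exact: measurable_itv.
have ptE (t : R) : complex.Re ((\sum_(n < N) x%:C%C ^+ n * t%:C%C ^+ n) * test_fun s d t%:C%C) =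
   (\sum_(n < N) (x * t) ^+ n) * (d `^ (1 - s) / (1 - (1 - d) * t)).
  rewrite (_ : _ * _ = ((\sum_(n < N) (x * t) ^+ n) * (d `^ (1 - s) / (1 - (1 - d) * t)))%:C%C)//.
  have -> : test_fun s d t%:C%C = (d `^ (1 - s) / (1 - (1 - d) * t))%:C%C.
    have cB (u v : R) : (u - v)%:C%C = u%:C%C - v%:C%C by exact: rmorphB.
    have cM (u v : R) : (u * v)%:C%C = u%:C%C * v%:C%C by exact: rmorphM.
    have cV (u : R) : u^-1%:C%C = u%:C%C^-1 by exact: fmorphV.
    by rewrite /test_fun cM cV [in RHS]cB cM rmorph1.
  rewrite [in RHS](rmorphM (real_complex R)) rmorph_sum/=; congr (_ * _).
  by apply: eq_bigr => n _; rewrite rmorphXn/= rmorphM/= exprMn.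
have pt0 (t : R) : 0 < t < 1 ->
    0 <= (\sum_(n < N) (x * t) ^+ n) * (d `^ (1 - s) / (1 - (1 - d) * t)).
  move=> /andP[t0 t1]; rewrite mulr_ge0 ?sumr_ge0//.
    by move=> n _; rewrite exprn_ge0// mulr_ge0// ltW.
  rewrite divr_ge0 ?powR_ge0// subr_ge0 mulr_ile1 ?(ltW t0) ?(ltW t1)//; lra.
have -> : (d `^ (- s) / 8)%:E = (\int[leb]_(t in J) (cst (d `^ (- s) / (8 * d))%:E) t)%E.
  rewrite integral_cst//; transitivity ((d `^ (- s) / (8 * d))%:E * leb J)%E => //.
  rewrite muJ -EFinM; congr EFin; field.
  by rewrite gt_eqF.
apply: ge0_le_integral_subset.
- move=> t; rewrite /J/= !in_itv/= => /andP[t0 ->]; rewrite andbT.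
  exact: lt_trans t0.
- by move=> t _; rewrite lee_fin divr_ge0 ?powR_ge0// mulr_ge0// ltW.
- by move=> t /=; rewrite in_itv/= => t01; rewrite lee_fin ptE pt0.
move=> t; rewrite /J/= in_itv/= => /andP[tx t1]; rewrite lee_fin ptE.
have t0 : 0 < (t : R) by exact: lt_trans tx.
have h1 : (4 * d)^-1 <= \sum_(n < N) (x * t) ^+ n.
  apply: (@le_trans _ _ (\sum_(n < N) y ^+ n)); last first.
    apply: ler_sum => n _; rewrite lerXn2r ?nnegrE ?mulr_ge0 ?(ltW x0) ?(ltW t0)//.
    by rewrite ler_wpM2l ?ltW.
  have y10 : 0 < 1 - y by rewrite subr_gt0.
  rewrite -(ler_pM2l y10) -[X in _ <= X * _]opprB mulNr -subrX1 opprB.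
  have yd : 1 - y <= 2 * d by rewrite /y /x; have := sqr_ge0 d; rewrite expr2; lra.
  apply: (@le_trans _ _ (2 * d * (4 * d)^-1)).
    by rewrite ler_wpM2r// invr_ge0 mulr_ge0// ltW.
  have -> : 2 * d * (4 * d)^-1 = 2^-1 by field; rewrite gt_eqF.
  lra.
have h2 : (2 * d)^-1 <= (1 - (1 - d) * t)^-1.
  have : (1 - d) * t < 1 by rewrite mulr_ilt1 ?(ltW t0)//; lra.
  have : (1 - d) * x <= (1 - d) * t by rewrite ler_wpM2l ?(ltW tx)//; lra.
  have dd : 0 <= d * d by rewrite mulr_ge0 ?ltW.
  move=> h3 h4; rewrite lef_pV2 ?posrE//; [|lra|lra].
  by move: h3; rewrite /x; lra.
apply: (@le_trans _ _ ((4 * d)^-1 * (d `^ (1 - s) / (2 * d)))); last first.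
  by rewrite ler_pM ?invr_ge0 ?divr_ge0 ?powR_ge0 ?mulr_ge0 ?(ltW d0)// ler_wpM2l ?powR_ge0.
rewrite gt0_powRD// powRr1 ?(ltW d0)// le_eqVlt; apply/orP; left; apply/eqP.
by field; rewrite gt_eqF.
Qed.

End TestFunctions.

(** * Failure of compactness *)

Section NotCompact.
Context {R : realType}.
Implicit Types (a b : (Cplx R)^nat) (f g : Cplx R -> Cplx R) (p q : R).

Lemma power_series_on_disc_sub a b f g :
  power_series_on_disc a f -> power_series_on_disc b g ->
  power_series_on_disc (fun k => a k - b k) (fun z => f z - g z).
Proof.
move=> af bg z z1.
rewrite (_ : series _ =
  series (fun k => a k * z ^+ k) - series (fun k => b k * z ^+ k)).
  by apply: cvgB; [exact: af|exact: bg].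
apply/funext => n; rewrite !fctE /series/= -sumrB.
by apply: eq_bigr => k _; rewrite mulrBl.
Qed.

Lemma AT_growth_real p q a f (t : R) : 1 < p -> 0 < q ->
  power_series_on_disc a f -> 0 < t -> t <= 1 ->
  ((t / 4 * (cone_const `^ (q / p) * t `^ (q / p) *
     cabs (f (1 - t)%:C%C) `^ q))%:E <= AT_int p q f)%E.
Proof.
move=> p1 q0 af t0 t1; have := AT_growth p1 q0 af t0 t1 (lexx 0).
by rewrite circle_pt0 mulr1; apply; rewrite mulr_ge0// pi_ge0.
Qed.

Lemma AT_norm_cvg0_int p q (F : nat -> Cplx R -> Cplx R) : 0 < q ->
  (fun k => AT_norm p q (F k)) @ \oo --> 0%E ->
  forall e : R, 0 < e -> \forall k \near \oo, (AT_int p q (F k) <= e%:E)%E.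
Proof.
move=> q0 /fine_cvgP[fin h] e e0.
have d0 : 0 < e `^ q^-1 by rewrite powR_gt0.
move/cvgrPdist_le : h => /(_ _ d0) h; near=> k.
have fk : AT_norm p q (F k) \is a fin_num by near: k; exact: fin.
have hk : `|0 - fine (AT_norm p q (F k))| <= e `^ q^-1 by near: k; exact: h.
rewrite AT_intE// -(fineK fk).
have e1 : e = (e `^ q^-1) `^ q by rewrite -powRrM mulVf ?gt_eqF// powRr1// ltW.
rewrite e1 -poweR_EFin; apply: ge0_le_poweR; rewrite ?(ltW q0)//.
  by rewrite fineK// AT_norm_ge0.
rewrite lee_fin; apply: le_trans hk; rewrite sub0r normrN; exact: ler_norm.
Unshelve. all: by end_near. Qed.

Lemma increasing_seq_ge (phi : nat -> nat) : increasing_seq phi ->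
  forall k, (k <= phi k)%N.
Proof.
move=> h; elim=> [//|k IH]; apply: leq_ltn_trans IH _.
by rewrite ltnNge -[(_ <= _)%N]/(phi k.+1 <= phi k)%O h ltnn.
Qed.

Lemma hilbert_not_compact p q : 2 < p -> 1 < q -> p^-1 + q^-1 < 1 ->
  ~ AT_compact p q (@hilbert R).
Proof.
move=> p2 q1 pq hc.
have p0 : 0 < p by apply: lt_trans p2; rewrite ltr0n.
have p1 : 1 < p by apply: lt_trans p2; rewrite ltr1n.
have q0 : 0 < q by exact: lt_trans q1.
pose s := p^-1 + q^-1.
have s0 : 0 < s by rewrite addr_gt0 ?invr_gt0.
(* The shift by 2 keeps [dl 0] strictly below 1. *)
pose dl n : R := n.+2%:R^-1.
have dl0 n : 0 < dl n by rewrite invr_gt0 ltr0n.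
have dl1 n : dl n < 1 by rewrite invf_lt1 ?ltr0n// ltr1n.
pose u n := test_fun s (dl n).
have [C C0 hC] := test_fun_AT_int p2 q1 pq.
have uAT n : AT p q (u n).
  split; first by eexists; exact: test_fun_power_series.
  by apply/(AT_norm_lty _ _ q0); apply: le_lt_trans (hC _ (dl0 n) (dl1 n)) (ltry _).
have ub : exists M : R, forall n, (AT_norm p q (u n) <= M%:E)%E.
  exists (C `^ q^-1) => n; rewrite AT_normE -poweR_EFin.
  by apply: ge0_le_poweR; rewrite ?invr_ge0 ?(ltW q0) ?AT_int_ge0// hC.
have [phi [g [phii [[b bg] _] nlim]]] := hc u uAT ub.
pose e k := dl (phi k).
pose F k := fun z => hilbert (u (phi k)) z - g z.
have F_series k : exists a, power_series_on_disc a (F k).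
  have [_ _ _ hk] := AT_hilbert_facts p2 q1 pq (uAT (phi k)).
  by eexists; exact: (power_series_on_disc_sub hk bg).
have small : forall c : R, 0 < c -> \forall k \near \oo, (AT_int p q (F k) <= c%:E)%E.
  exact: AT_norm_cvg0_int.
have e_small : forall c : R, 0 < c -> \forall k \near \oo, e k <= c.
  move=> c c0; have /cvgrPdist_le /(_ c c0) h := @cvg_harmonic R.
  near=> k; have hk : `|0 - harmonic k| <= c by near: k; exact: h.
  apply: le_trans hk; rewrite sub0r normrN /harmonic/= ger0_norm ?invr_ge0//.
  rewrite /e /dl lef_pV2 ?posrE ?ltr0n// ler_nat.
  by apply: (@leq_trans (phi k).+1) => //; rewrite ltnS increasing_seq_ge.
pose K := (cone_const : R) `^ (q / p).
have K0 : 0 < K by rewrite powR_gt0 ?cone_const_gt0.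
have gz x : 0 < x -> x < 1 -> cabs (g x%:C%C) = 0.
  move=> x0 x1; apply/eqP/negPn/negP => gx0.
  have m0 : 0 < cabs (g x%:C%C) by rewrite lt_neqAle eq_sym gx0 cabs_ge0.
  set m := cabs _ in m0.
  have [D D0 hD] := test_fun_hilbert_small s0 pq.
  have x10 : 0 < 1 - x by rewrite subr_gt0.
  have kp0 : 0 < (1 - s) / 2 by rewrite divr_gt0// subr_gt0.
  (* Chosen so that D / (1 - x) times [eta] is at most m/2; D + 1 replaces [D], which may be 0. *)
  pose eta := m / 2 * (1 - x) / (D + 1).
  have D1 : 0 < D + 1 by rewrite ltr_wpDl.
  have eta0 : 0 < eta by rewrite divr_gt0// mulr_gt0// divr_gt0.
  have c0 : 0 < eta `^ ((1 - s) / 2)^-1 by rewrite powR_gt0.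
  (* The growth estimate forces at least this value of [AT_int] on any difference of modulus at
     least m/2 at [x]. *)
  pose Kx := (1 - x) / 4 * (K * (1 - x) `^ (q / p) * (m / 2) `^ q).
  have Kx0 : 0 < Kx.
    have a1 : 0 < (1 - x) `^ (q / p) by exact: powR_gt0.
    have a2 : 0 < (m / 2) `^ q by rewrite powR_gt0 ?divr_gt0.
    by apply: mulr_gt0; [rewrite divr_gt0|exact: mulr_gt0 (mulr_gt0 K0 a1) a2].
  have Kx2 : 0 < Kx / 2 by rewrite divr_gt0.
  have [k [ek Fk]] : exists k, e k <= eta `^ ((1 - s) / 2)^-1 /\
      (AT_int p q (F k) <= (Kx / 2)%:E)%E.
    near \oo => k; exists k; split; near: k; [exact: e_small|exact: small].
  have [af ha _ _] := AT_hilbert_facts p2 q1 pq (uAT (phi k)).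
  have h1 : cabs (hilbert (u (phi k)) x%:C%C) <= m / 2.
    apply: (le_trans (hD _ _ _ (dl0 _) (dl1 _) x0 x1 af ha)).
    have h : e k `^ ((1 - s) / 2) <= eta.
      have e1 : eta = (eta `^ ((1 - s) / 2)^-1) `^ ((1 - s) / 2).
        by rewrite -powRrM mulVf ?gt_eqF// powRr1// ltW.
      by rewrite e1 ge0_ler_powR ?nnegrE ?(ltW kp0) ?(ltW c0) ?(ltW (dl0 _)).
    apply: (@le_trans _ _ (D / (1 - x) * eta)).
      by rewrite ler_wpM2l// divr_ge0// ltW.
    have -> : D / (1 - x) * eta = D / (D + 1) * (m / 2).
      by rewrite /eta; field; rewrite !gt_eqF.
    by rewrite ler_piMl ?ler_pdivrMr ?mul1r ?lerDl// divr_ge0// ltW.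
  have h2 : m / 2 <= cabs (F k x%:C%C).
    have := cabsD (g x%:C%C - hilbert (u (phi k)) x%:C%C) (hilbert (u (phi k)) x%:C%C).
    by rewrite subrK cabs_distC -/m -/(F k _); lra.
  have [a aF] := F_series k.
  have := AT_growth_real p1 q0 aF x10 ltac:(by rewrite lerBlDr lerDl ltW).
  rewrite subKr => /le_trans /(_ Fk); rewrite lee_fin -/K => h3.
  have : Kx <= Kx / 2.
    apply: le_trans h3; rewrite /Kx ler_wpM2l ?divr_ge0 ?(ltW x10)//.
    rewrite ler_wpM2l ?mulr_ge0 ?powR_ge0//.
    by rewrite ge0_ler_powR ?nnegrE ?(ltW q0) ?cabs_ge0// divr_ge0 ?cabs_ge0.
  lra.
(* The growth estimate at depth [e k] for a value of size (e k)^(-s)/8: the powers of [e k] cancel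
   because 1 + q/p - s q = 0, so the bound is the same for all k and one k with a smaller [AT_int]
   is contradictory. *)
pose L := K / 4 * 8^-1 `^ q.
have L0 : 0 < L.
  by apply: mulr_gt0; [rewrite divr_gt0|apply: powR_gt0; rewrite invr_gt0].
have L2 : 0 < L / 2 by rewrite divr_gt0.
have [k Fk] : exists k, (AT_int p q (F k) <= (L / 2)%:E)%E.
  near \oo => k; exists k; near: k; exact: small.
have [af ha _ _] := AT_hilbert_facts p2 q1 pq (uAT (phi k)).
have := test_fun_hilbert_large (dl0 _) (dl1 _) af ha.
rewrite -/(e k) => h1; have ek0 : 0 < e k by exact: dl0.
have ek1 : e k < 1 by exact: dl1.
have h2 : e k `^ (- s) / 8 <= cabs (F k (1 - e k)%:C%C).
  apply: (le_trans h1).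
  have := gz (1 - e k) ltac:(by rewrite subr_gt0) ltac:(by rewrite gtrBl).
  have := cabsD (F k (1 - e k)%:C%C) (g (1 - e k)%:C%C).
  by move=> + g0; rewrite g0 addr0 {1}/F subrK.
have [a aF] := F_series k.
have := AT_growth_real p1 q0 aF ek0 (ltW ek1).
move=> /le_trans /(_ Fk); rewrite lee_fin -/K => h3.
suff : L <= L / 2 by lra.
apply: le_trans h3.
apply: (@le_trans _ _ (e k / 4 * (K * e k `^ (q / p) * (e k `^ (- s) / 8) `^ q))).
  have -> : (e k `^ (- s) / 8) `^ q = e k `^ (- s * q) * 8^-1 `^ q.
    by rewrite powRM ?powR_ge0 ?invr_ge0// powRrM.
  have hs : e k * e k `^ (q / p) * e k `^ (- s * q) = 1.
    rewrite -{1}(powRr1 (ltW ek0)) -!gt0_powRD//.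
    rewrite (_ : _ + _ = 0) ?powRr0// /s; field.
    by rewrite (gt_eqF p0) (gt_eqF q0).
  rewrite le_eqVlt; apply/orP; left; apply/eqP; rewrite /L.
  move: hs; move: (e k `^ (q / p)) (e k `^ (- s * q)) (8^-1 `^ q) => u1 u2 u3 hs.
  rewrite -[LHS]mulr1 -hs; by ring.
rewrite ler_wpM2l ?divr_ge0 ?(ltW ek0)// ler_wpM2l ?mulr_ge0 ?powR_ge0 ?(ltW K0)//.
by rewrite ge0_ler_powR ?nnegrE ?(ltW q0) ?cabs_ge0// divr_ge0 ?powR_ge0.
Unshelve. all: by end_near. Qed.

End NotCompact.

Theorem corollary1p7 (R : realType) (p q : R)
  (hp1 : 1 < p) (hq1 : 1 < q) (hpq : p^-1 + q^-1 < 1) (hp2 : 2 < p) :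
  (forall f : Cplx R -> Cplx R, AT p q f ->
     hilbert_well_defined f /\ AT p q (hilbert f)) /\
  AT_bounded p q hilbert /\
  ~ AT_compact p q hilbert.
Proof.
have q0 : 0 < q by exact: lt_trans hq1.
have [C C0 hC] := hilbert_AT_int hp2 hq1 hpq.
split=> [f fAT|]; last split; last exact: hilbert_not_compact.
  have [af ha If hf] := AT_hilbert_facts hp2 hq1 hpq fAT.
  split; first split.
  - exact: hilbert_coef_cvg ha.
  - exact: hf.
  split; first by exists (hilbert_coef (taylor f)).
  apply/(AT_norm_lty _ _ q0); apply: le_lt_trans (hC _ _ af ha If) _.
  by rewrite lte_mul_pinfty ?lee_fin.
exists (C `^ q^-1) => f fAT.
have [af ha If hf] := AT_hilbert_facts hp2 hq1 hpq fAT.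
by apply: AT_norm_le => //; exact: hC.
Qed.
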